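(* Let $m\in\mathbb Z_{\ge0}$ and $c\in\mathbb C$ be fixed, and let $D^c_{m+1}=z^2\frac{d}{dz}\left(\frac{1-z}{z}\right)\left(z\frac{d}{dz}+c-1\right)^m\in\mathbb C[z,\frac{d}{dz}]$, a linear ordinary differential operator of order $m+1$. (1) The function $F(z)=Li_{m,c}(z)$ satisfies $D^c_{m+1}F(z)=0$. (2) The singular points of $D^c_{m+1}$ on the Riemann sphere are contained in $\{0,1,\infty\}$ and are all regular singular points; in particular $D^c_{m+1}$ is a Fuchsian operator for all $c\in\mathbb C$. (3) For $c\in\mathbb C\setminus\mathbb Z_{\le0}$, a basis of solutions of $D^c_{m+1}F=0$ on $z\in\mathbb C\setminus((-\infty,0]\cup[1,\infty))$ is $\{Li_{m,c}(z),\ z^{1-c}(\log z)^{m-1},\ z^{1-c}(\log z)^{m-2},\dots,\ z^{1-c}\}$. (4) For $c=-k\in\mathbb Z_{\le0}$, a basis of solutions of $D^c_{m+1}F=0$ on $z\in\mathbb C\setminus((-\infty,0]\cup[1,\infty))$ is $\{Li^*_{m,-k}(z),\ z^{1-c}(\log z)^{m-1},\dots,\ z^{1-c}\}$, where $Li^*_{m,-k}(z)=\sum_{n\ge0,\,n\ne k}\frac{z^{n+1}}{(n-k)^m}+\frac1{m!}z^{k+1}(\log z)^m$.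
   Context: For $c\notin\mathbb Z_{\le0}$, $Li_{m,c}(z)$ denotes the function $\sum_{n=0}^\infty\frac{z^{n+1}}{(n+c)^m}$ for $|z|<1$ (principal branch powers $(n+c)^{-m}$ are ordinary integer powers here), analytically continued to the cut plane $\mathbb C\setminus((-\infty,0]\cup[1,\infty))$. $\log$ is the principal branch and $z^{1-c}=e^{(1-c)\log z}$. *)

(* Defs.v *)
(* Complex numbers are R[i] for an
   arbitrary R : realType (mathcomp-real-closed), equipped with their own
   normed-field topology (via the regular algebra  R[i]^o), so that
   [derivable f z 1] / [derive1] are genuine complex derivatives. *)
From HB Require Import structures.
From mathcomp Require Import all_boot all_order all_algebra.
From mathcomp Require Import all_classical all_reals all_analysis.
From mathcomp Require Import complex.
Set Implicit Arguments. Unset Strict Implicit. Unset Printing Implicit Defensive.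
Import Order.TTheory GRing.Theory Num.Theory.
Import numFieldNormedType.Exports.
Local Open Scope classical_set_scope.
Local Open Scope ring_scope.

Section Defs.
Variable R : realType.

Definition C : numClosedFieldType := (R[i])^o.

Definition Rec (z : C) : R := complex.Re (z : R[i]).
Definition Imc (z : C) : R := complex.Im (z : R[i]).
Definition ofR (x : R) : C := (x +i* 0)%C.
Definition iC : C := (0 +i* 1)%C.

Definition cmod (z : C) : R := Num.sqrt (Rec z ^+ 2 + Imc z ^+ 2).
Definition Arg (z : C) : R :=
  if (Imc z == 0) && (Rec z < 0) then pi
  else 2 * atan (Imc z / (cmod z + Rec z)).
Definition Log (z : C) : C := ofR (ln (cmod z)) + iC * ofR (Arg z).

Definition cexp (w : C) : C :=
  ofR (expR (Rec w)) * (cos (Imc w) +i* sin (Imc w))%C.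
Definition cpow (z a : C) : C := cexp (a * Log z).

Definition cut_plane (z : C) : Prop :=
  ~ (Imc z = 0 /\ (Rec z <= 0 \/ 1 <= Rec z)).

Definition not_nonpos_int (c : C) : Prop := forall k : nat, c <> - k%:R.

Definition holo_on_cut (F : C -> C) : Prop :=
  forall z, cut_plane z -> derivable F z 1.

Definition Li_term (m : nat) (c : C) (z : C) (n : nat) : C :=
  z ^+ n.+1 / (n%:R + c) ^+ m.

(** F is (the) analytic continuation of Li_{m,c} to the cut plane:
    holomorphic there, and equal to the sum of the series for |z| < 1. *)
Definition is_Li (m : nat) (c : C) (F : C -> C) : Prop :=
  holo_on_cut F /\
  forall z, cut_plane z -> `|z| < 1 ->
    series (Li_term m c z) @ \oo --> F z.

Definition Listar_term (m k : nat) (z : C) (n : nat) : C :=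
  if n == k then 0 else z ^+ n.+1 / (n%:R - k%:R) ^+ m.

Definition is_Listar (m k : nat) (F : C -> C) : Prop :=
  holo_on_cut F /\
  forall z, cut_plane z -> `|z| < 1 ->
    series (Listar_term m k z) @ \oo -->
      F z - (m`!%:R)^-1 * z ^+ k.+1 * Log z ^+ m.

(** ** Linear differential operators in C[z, d/dz]:
    L = [:: a_0; ...; a_n] stands for  sum_j a_j(z) (d/dz)^j. *)
Local Notation diffop := (seq {poly C}).

Definition op_add (L M : diffop) : diffop :=
  mkseq (fun j => L`_j + M`_j) (maxn (size L) (size M)).
Definition op_scale (p : {poly C}) (L : diffop) : diffop := map (fun a => p * a) L.
(** d/dz o L  =  sum_j (a_j' d^j + a_j d^{j+1}) *)
Definition op_dleft (L : diffop) : diffop :=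
  mkseq (fun j => deriv L`_j + (if j is j'.+1 then L`_j' else 0)) (size L).+1.
Definition op_mul (L M : diffop) : diffop :=
  foldr op_add [::] [seq op_scale L`_i (iter i op_dleft M) | i <- iota 0 (size L)].

Definition op_act (L : diffop) (F : C -> C) (z : C) : C :=
  \sum_(j < size L) (L`_j).[z] * iter j (@derive1 C C) F z.

Definition op_coef (L : diffop) (j : nat) : {poly C} := nth 0 L j.
Definition op_order (L : diffop) : nat := (size L).-1.
Definition op_lead (L : diffop) : {poly C} := L`_(op_order L).

Definition theta_op (c : C) : diffop := [:: (c - 1)%:P; 'X].
(** z^2 d/dz o ((1-z)/z)  =  z(1-z) d/dz - 1   (as an element of C[z,d/dz]) *)
Definition outer_op : diffop := [:: -1; 'X * (1 - 'X)].

Definition Dop (m : nat) (c : C) : diffop :=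
  op_mul outer_op (iter m (op_mul (theta_op c)) [:: 1]).

(** ** Singular points.  With n = order, p_j = a_j / a_n:
    - z0 in C is an ordinary point iff every p_j is holomorphic at z0;
    - z0 satisfies the Fuchs condition (ordinary or regular singular)
      iff (z-z0)^(n-j) p_j is holomorphic at z0 for all j;
    - infinity is ordinary or regular singular iff z^(n-j) p_j is
      holomorphic at infinity for all j. *)
Definition ordinary_point (L : diffop) (z0 : C) : Prop :=
  forall j, (j <= op_order L)%N -> op_coef L j != 0 ->
    (mup z0 (op_lead L) <= mup z0 (op_coef L j))%N.
Definition singular_point (L : diffop) (z0 : C) : Prop := ~ ordinary_point L z0.
Definition fuchs_condition (L : diffop) (z0 : C) : Prop :=
  forall j, (j <= op_order L)%N -> op_coef L j != 0 ->
    (mup z0 (op_lead L) <= mup z0 (op_coef L j) + (op_order L - j))%N.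
Definition regular_singular_point (L : diffop) (z0 : C) : Prop :=
  singular_point L z0 /\ fuchs_condition L z0.
Definition fuchs_condition_infty (L : diffop) : Prop :=
  forall j, (j <= op_order L)%N -> op_coef L j != 0 ->
    ((size (op_coef L j)).-1 + (op_order L - j) <= (size (op_lead L)).-1)%N.
Definition fuchsian (L : diffop) : Prop :=
  (forall z0, fuchs_condition L z0) /\ fuchs_condition_infty L.

Definition solution_on_cut (L : diffop) (F : C -> C) : Prop :=
  holo_on_cut F /\ forall z, cut_plane z -> op_act L F z = 0.

Definition basis_of_solutions (L : diffop) (n : nat) (f : 'I_n -> C -> C) : Prop :=
  (forall i, solution_on_cut L (f i)) /\
  (forall a : 'I_n -> C,
     (forall z, cut_plane z -> \sum_(i < n) a i * f i z = 0) -> forall i, a i = 0) /\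
  (forall F, solution_on_cut L F ->
     exists a : 'I_n -> C, forall z, cut_plane z -> F z = \sum_(i < n) a i * f i z).

Definition sol_family (m : nat) (c : C) (F : C -> C) : 'I_m.+1 -> C -> C :=
  fun i => if nat_of_ord i is j.+1 then (fun z => cpow z (1 - c) * Log z ^+ j) else F.

End Defs.
Arguments sol_family [R] m c F i z.

(* Main.v *)
(** Put [B = z d/dz + c - 1], so that [D F = z^2 d/dz ((1 - z)/z) B^m F].  Since
    [(1 - z)/z] times [B^m F] has zero derivative exactly when [D F = 0], the equation
    amounts to [B^m F = a z/(1 - z)] for a constant [a].  Multiplication by [z^(c-1)] turns
    [B] into [d/d(Log z)], so the kernel of [B^m] consists of the functions [z^(1-c) p(Log z)]
    with [deg p < m].  Termwise [B Li_{m+1,c} = Li_{m,c}], provided a term with [n + c = 0] is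
    replaced by [z^(n+1) (Log z)^m / m!], and [Li_{0,c} = z/(1 - z)].  Integrating this
    recursion on the cut plane, which is star-shaped about [1/2], constructs the continuations;
    the series converges to them uniformly on segments issuing from [1/2].

    That [D] may be applied to every holomorphic function, and that a continuation is unique,
    are Cauchy's theorem that derivatives of holomorphic functions are holomorphic and the
    identity theorem, which are derived here from Goursat's lemma.  Path integrals are
    differences of primitives along paths. *)

Require Import Defs.
From HB Require Import structures.
From mathcomp Require Import all_boot all_order all_algebra.
From mathcomp Require Import all_classical all_reals all_analysis.
From mathcomp Require Import complex.
From mathcomp Require Import ring lra.
Import Order.TTheory GRing.Theory Num.Theory.
Import numFieldNormedType.Exports.
Local Open Scope classical_set_scope.
Local Open Scope ring_scope.

Set Implicit Arguments.
Unset Strict Implicit.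
Unset Printing Implicit Defensive.

(** * Complex numbers *)

(** Two features of the statement shape the proof. A solution is only assumed complex differentiable
    once, while [derive1] is total, so iterated derivatives carry meaning only after Cauchy's
    theorem. And [is_Li] and [is_Listar] constrain a function only where |z| < 1, so an arbitrary
    continuation must be identified with a constructed one before any equation is known for it
    elsewhere. In Cauchy's formula the difference quotient is a priori merely continuous at w;
    therefore Goursat's lemma is extended to triangles with one bad vertex. In the construction the
    natural base point 0 lies on the boundary of the cut plane, so the integration constants are
    fixed at 1/2, where the series converges like a geometric one. Convergence is then propagated
    from 1/2: the error at level m + 1, multiplied by z^(c-1), has as derivative z^(c-2) times the
    error at level m. This is why uniform convergence along whole segments is carried through the
    induction. *)

Section ComplexBasics.
Variable R : realType.
Local Notation C := (C R).
Implicit Types (x y e : R) (z w : C).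

Lemma ofRD x y : ofR (x + y) = ofR x + ofR y :> C.
Proof. exact: (rmorphD (real_complex R)). Qed.
Lemma ofRB x y : ofR (x - y) = ofR x - ofR y :> C.
Proof. exact: (rmorphB (real_complex R)). Qed.
Lemma ofRN x : ofR (- x) = - ofR x :> C.
Proof. exact: (rmorphN (real_complex R)). Qed.
Lemma ofRM x y : ofR (x * y) = ofR x * ofR y :> C.
Proof. exact: (rmorphM (real_complex R)). Qed.
Lemma ofRV x : ofR x^-1 = (ofR x)^-1 :> C.
Proof. exact: (fmorphV (real_complex R)). Qed.
Lemma ofR0 : ofR 0 = 0 :> C. Proof. by []. Qed.
Lemma ofR1 : ofR 1 = 1 :> C. Proof. by []. Qed.
Lemma ofR_nat n : ofR n%:R = n%:R :> C.
Proof. exact: (rmorph_nat (real_complex R)). Qed.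
Lemma ofRX x n : ofR (x ^+ n) = ofR x ^+ n :> C.
Proof. exact: (rmorphXn (real_complex R)). Qed.
Lemma ofR_inj x y : ofR x = ofR y :> C -> x = y.
Proof. by case. Qed.
Lemma ofR_eq0 x : (ofR x == 0 :> C) = (x == 0).
Proof. by apply/eqP/eqP => [[]//|->]. Qed.

Lemma RecD z w : Rec (z + w) = Rec z + Rec w.
Proof. by case: z w => [a b] [c d]. Qed.
Lemma ImcD z w : Imc (z + w) = Imc z + Imc w.
Proof. by case: z w => [a b] [c d]. Qed.
Lemma RecN z : Rec (- z) = - Rec z. Proof. by case: z. Qed.
Lemma ImcN z : Imc (- z) = - Imc z. Proof. by case: z. Qed.
Lemma RecB z w : Rec (z - w) = Rec z - Rec w.
Proof. by rewrite RecD RecN. Qed.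
Lemma ImcB z w : Imc (z - w) = Imc z - Imc w.
Proof. by rewrite ImcD ImcN. Qed.
Lemma RecM z w : Rec (z * w) = Rec z * Rec w - Imc z * Imc w.
Proof. by case: z w => [a b] [c d]. Qed.
Lemma ImcM z w : Imc (z * w) = Rec z * Imc w + Imc z * Rec w.
Proof. by case: z w => [a b] [c d]. Qed.
Lemma Rec_ofR x : Rec (ofR x : C) = x. Proof. by []. Qed.
Lemma Imc_ofR x : Imc (ofR x : C) = 0. Proof. by []. Qed.
Lemma Rec_ofRM x z : Rec (ofR x * z) = x * Rec z.
Proof. by rewrite RecM Rec_ofR Imc_ofR mul0r subr0. Qed.
Lemma complex_ext z w : Rec z = Rec w -> Imc z = Imc w -> z = w.
Proof. by case: z w => [a b] [c d] /= ; rewrite /Rec /Imc /= => -> ->. Qed.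
Lemma complexE z : z = ofR (Rec z) + iC R * ofR (Imc z).
Proof.
by apply: complex_ext; rewrite ?RecD ?ImcD ?RecM ?ImcM /= /Rec /Imc /= ; ring.
Qed.

Lemma normC_cmod z : `|z| = ofR (cmod z).
Proof. exact: normc_def. Qed.
Lemma ler_ofR x y : (ofR x <= ofR y :> C) = (x <= y).
Proof. exact: lecR. Qed.
Lemma ltr_ofR x y : (ofR x < ofR y :> C) = (x < y).
Proof. exact: ltcR. Qed.

Lemma cmod_ge0 z : 0 <= cmod z. Proof. exact: sqrtr_ge0. Qed.
Lemma cmod_eq0 z : (cmod z == 0) = (z == 0).
Proof. by rewrite -ofR_eq0 -normC_cmod normr_eq0. Qed.
Lemma cmod0 : cmod (0 : C) = 0. Proof. by apply/eqP; rewrite cmod_eq0. Qed.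
Lemma cmod_gt0 z : (0 < cmod z) = (z != 0).
Proof. by rewrite lt_def cmod_eq0 cmod_ge0 andbT. Qed.
Lemma cmodD z w : cmod (z + w) <= cmod z + cmod w.
Proof. by rewrite -ler_ofR ofRD -!normC_cmod ler_normD. Qed.
Lemma cmodN z : cmod (- z) = cmod z.
Proof. by apply: ofR_inj; rewrite -!normC_cmod normrN. Qed.
Lemma cmodB z w : cmod (z - w) <= cmod z + cmod w.
Proof. by rewrite -(cmodN w) cmodD. Qed.
Lemma cmod_distC z w : cmod (z - w) = cmod (w - z).
Proof. by rewrite -cmodN opprB. Qed.
Lemma cmodM z w : cmod (z * w) = cmod z * cmod w.
Proof. by apply: ofR_inj; rewrite ofRM -!normC_cmod normrM. Qed.
Lemma cmodV z : cmod z^-1 = (cmod z)^-1.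
Proof. by apply: ofR_inj; rewrite ofRV -!normC_cmod normfV. Qed.
Lemma cmodX z n : cmod (z ^+ n) = cmod z ^+ n.
Proof. by apply: ofR_inj; rewrite ofRX -!normC_cmod normrX. Qed.
Lemma cmod_ofR x : cmod (ofR x : C) = `|x|.
Proof. by rewrite /cmod /= expr0n addr0 sqrtr_sqr. Qed.
Lemma cmod1 : cmod (1 : C) = 1. Proof. by rewrite -ofR1 cmod_ofR normr1. Qed.
Lemma cmod_sqr z : cmod z ^+ 2 = Rec z ^+ 2 + Imc z ^+ 2.
Proof. by rewrite sqr_sqrtr // addr_ge0 ?sqr_ge0. Qed.
Lemma Rec_le_cmod z : `|Rec z| <= cmod z.
Proof. by rewrite -sqrtr_sqr ler_wsqrtr // lerDl sqr_ge0. Qed.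
Lemma Imc_le_cmod z : `|Imc z| <= cmod z.
Proof. by rewrite -sqrtr_sqr ler_wsqrtr // lerDr sqr_ge0. Qed.
Lemma cmod_iC : cmod (iC R) = 1.
Proof. by rewrite /cmod /= expr0n expr1n add0r sqrtr1. Qed.
Lemma cmod_le z : cmod z <= `|Rec z| + `|Imc z|.
Proof.
rewrite {1}[z]complexE (le_trans (cmodD _ _)) // cmodM cmod_iC !cmod_ofR.
by rewrite mul1r.
Qed.
Lemma cmod_dist_triangle z w u : cmod (z - u) <= cmod (z - w) + cmod (w - u).
Proof. by rewrite -[z - u](subrKA w) cmodD. Qed.

(** Balls of [C] have radii in [C], but a radius that is positive in the order of [C] is real, so
    radii can be taken in [R]. *)
Lemma nbhsCP z (A : set C) :
  nbhs z A <-> exists2 e, 0 < e & forall w, cmod (w - z) < e -> A w.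
Proof.
split.
  move=> /nbhs_ballP[e /= e0 eA].
  have eR : e = ofR (Rec e).
    by apply: complex_ext => //; apply/eqP; move: e0; rewrite ltcE => /andP[].
  exists (Rec e); first by rewrite -ltr_ofR -eR.
  move=> w we; apply: eA; rewrite -ball_normE /= normC_cmod eR ltr_ofR.
  by rewrite cmod_distC.
move=> [e e0 eA]; apply/nbhs_ballP; exists (ofR e) => /=; first by rewrite ltr_ofR.
move=> w; rewrite -ball_normE /= normC_cmod ltr_ofR cmod_distC; exact: eA.
Qed.

Lemma cvgCP (T : Type) (F : set_system T) (FF : Filter F) (f : T -> C) z :
  f @ F --> z <-> forall e, 0 < e -> \forall t \near F, cmod (f t - z) < e.
Proof.
split=> [fz e e0|fz A /nbhsCP[e e0 eA]].
  by apply: (fz [set w | cmod (w - z) < e]); apply/nbhsCP; exists e.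
by near=> t; apply: eA; near: t; exact: fz.
Unshelve. all: by end_near. Qed.

Lemma continuous_ofR : continuous (@ofR R : R -> C).
Proof.
move=> x; apply/cvgCP => e e0.
apply/nbhs_ballP; exists e => // t; rewrite /ball /= => xt.
by rewrite -ofRB cmod_ofR distrC.
Qed.

Lemma continuous_Rec : continuous (@Rec R).
Proof.
move=> z A /nbhs_ballP[e /= e0 eA]; apply/nbhsCP; exists e => // w wz.
apply: eA; rewrite /ball /=.
by rewrite distrC; apply: le_lt_trans wz; rewrite -RecB Rec_le_cmod.
Qed.
Lemma continuous_Imc : continuous (@Imc R).
Proof.
move=> z A /nbhs_ballP[e /= e0 eA]; apply/nbhsCP; exists e => // w wz.
apply: eA; rewrite /ball /=.
by rewrite distrC; apply: le_lt_trans wz; rewrite -ImcB Imc_le_cmod.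
Qed.
Lemma continuous_cmod : continuous (@cmod R).
Proof.
move=> z A /nbhs_ballP[e /= e0 eA]; apply/nbhsCP; exists e => // w wz.
apply: eA; rewrite /ball /=.
apply: le_lt_trans wz; rewrite ler_norml; apply/andP; split.
  by rewrite lerBrDl lerBlDl -{1}[w](subrK z) cmodD.
by rewrite cmod_distC lerBlDr -{1}[z](subrK w) cmodD.
Qed.

End ComplexBasics.

Section ClosedFieldLimits.
Variable K : numClosedFieldType.
Variables (T : Type) (F : set_system T).
Context {FF : Filter F}.
Lemma ccvg_cst (k : K) : (fun _ : T => k) @ F --> k.
Proof. exact: cvg_cst. Qed.
Lemma ccvgD (f g : T -> K) (a b : K) : f @ F --> a -> g @ F --> b -> (fun s => f s + g s) @ F --> a + b.
Proof. by move=> fa gb; apply: cvgD. Qed.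
Lemma ccvgM (f g : T -> K) (a b : K) : f @ F --> a -> g @ F --> b -> (fun s => f s * g s) @ F --> a * b.
Proof. by move=> fa gb; apply: cvgM. Qed.
Lemma ccvgV (f : T -> K) (a : K) : a != 0 -> f @ F --> a  -> (fun s => (f s)^-1) @ F --> a^-1.
Proof. by move=> a0 fa; apply: cvgV. Qed.
Lemma ccvgN (f : T -> K) (a : K) : f @ F --> a  -> (fun s => - (f s)) @ F --> - a.
Proof. by move=> fa;  apply: cvgN. Qed.
Lemma ccvgB (f g : T -> K) (a b : K) : f @ F --> a -> g @ F --> b -> (fun s => f s - g s) @ F --> a - b.
Proof. by move=> fa gb; apply: cvgB. Qed.
End ClosedFieldLimits.

(** * Derivatives and paths *)

Section Derivatives.
Variable R : realType.
Local Notation C := (C R).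
Implicit Types (x y e : R) (z w l k : C).

(** Caratheodory's form of differentiability: [F s = F t + (i s - i t) * phi s]
    with [phi] continuous at [t].  Taking [i] to be the identity of C or the
    inclusion of R treats holomorphic functions and C-valued paths at once. *)
Definition der (T : topologicalType) (i F : T -> C) (t : T) (l : C) : Prop :=
  exists phi : T -> C, [/\ phi @ t --> phi t, phi t = l &
    \forall s \near t, F s = F t + (i s - i t) * phi s].

Definition cder : (C -> C) -> C -> C -> Prop := @der C id.
Definition rder : (R -> C) -> R -> C -> Prop := @der R (@ofR R).

Section DerTheory.
Variables (T : topologicalType) (i : T -> C) (t : T).
Hypothesis ic : i @ t --> i t.
Implicit Types F G : T -> C.

Lemma derP F l : der i F t l <-> forall e, 0 < e -> \forall s \near t,
  cmod (F s - F t - l * (i s - i t)) <= e * cmod (i s - i t).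
Proof.
split=> [[phi [phic <- Fphi]] e e0|Fl].
  have /cvgCP phie := phic.
  near=> s.
  have -> : F s = F t + (i s - i t) * phi s by near: s.
  rewrite [_ - _ - _](_ : _ = (phi s - phi t) * (i s - i t)); last by ring.
  rewrite cmodM ler_wpM2r ?cmod_ge0// ltW//; near: s; exact: phie.
(* The slope, completed by [l] where [i s = i t]; at such points the estimate forces [F s = F t]. *)
exists (fun s => if i s == i t then l else (F s - F t) / (i s - i t)).
rewrite eqxx; split; [|by []|].
- apply/cvgCP => e e0; near=> s.
  have e2 : e / 2 < e by rewrite ltr_pdivrMr// ltr_pMr// ltr1n.
  have : cmod (F s - F t - l * (i s - i t)) <= e / 2 * cmod (i s - i t).
    by near: s; apply: Fl; rewrite divr_gt0.
  case: eqVneq => [_ _|ne H]; first by rewrite subrr cmod0.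
  apply: le_lt_trans e2; rewrite -subr_eq0 in ne.
  rewrite -(@ler_pM2r _ (cmod (i s - i t))) ?cmod_gt0// -cmodM.
  by rewrite mulrBl mulfVK.
- near=> s; case: eqVneq => [E|ne]; last first.
    by rewrite mulrC mulfVK ?subr_eq0// addrC subrK.
  have : cmod (F s - F t - l * (i s - i t)) <= 1 * cmod (i s - i t).
    by near: s; exact: Fl.
  rewrite E subrr mul0r addr0 mulr0 subr0 cmod0 mulr0 => H.
  by apply/eqP; rewrite -subr_eq0 -cmod_eq0 eq_le H cmod_ge0.
Unshelve. all: by end_near. Qed.

Lemma der_cvg F l : der i F t l -> F @ t --> F t.
Proof.
move=> [phi [phic _ Fphi]].
have H : (fun s => F t + (i s - i t) * phi s) @ t --> F t.
  rewrite -[X in _ --> X]addr0 -(mul0r (phi t)) -(subrr (i t)).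
  apply: ccvgD.
    exact: ccvg_cst.
  apply: ccvgM.
    apply: ccvgB.
      exact: ic.
    exact: ccvg_cst.
  exact: phic.
apply: cvg_trans H; apply: near_eq_cvg.
by apply: filterS Fphi => s ->.
Qed.

Lemma der_near F G l : (\forall s \near t, F s = G s) -> der i F t l -> der i G t l.
Proof.
move=> FG [phi [phic phil Fphi]]; exists phi; split; [exact: phic|exact: phil|].
have FGt : F t = G t by exact: nbhs_singleton FG.
near=> s; rewrite -FGt; have <- : F s = G s by near: s.
by near: s.
Unshelve. all: by end_near. Qed.

Lemma der_ext F G l : F =1 G -> der i F t l -> der i G t l.
Proof. by move=> FG; apply: der_near; near=> s.
Unshelve. all: by end_near. Qed.

Lemma der_cst k : der i (fun=> k) t 0.
Proof.
by exists (fun=> 0); split; [exact: ccvg_cst|by []|near=> s; rewrite mulr0 addr0].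
Unshelve. all: by end_near. Qed.

Lemma der_incl : der i i t 1.
Proof.
by exists (fun=> 1); split; [exact: ccvg_cst|by []|near=> s; rewrite mulr1 addrC subrK].
Unshelve. all: by end_near. Qed.

Lemma derD F G l k : der i F t l -> der i G t k -> der i (fun s => F s + G s) t (l + k).
Proof.
move=> [phi [phic <- Fphi]] [psi [psic <- Gpsi]].
exists (fun s => phi s + psi s); split; [exact: (ccvgD phic psic)|by []|].
near=> s; have -> : F s = F t + (i s - i t) * phi s by near: s.
have -> : G s = G t + (i s - i t) * psi s by near: s.
by ring.
Unshelve. all: by end_near. Qed.

Lemma derM F G l k : der i F t l -> der i G t k ->
  der i (fun s => F s * G s) t (l * G t + F t * k).
Proof.
move=> Fl; have Fc := der_cvg Fl; move: Fl.
move=> [phi [phic <- Fphi]] [psi [psic <- Gpsi]].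
exists (fun s => phi s * G t + F s * psi s); split; [|by []|].
  exact: (ccvgD (ccvgM phic (ccvg_cst (k:=G t))) (ccvgM Fc psic)).
near=> s; have -> : F s = F t + (i s - i t) * phi s by near: s.
have -> : G s = G t + (i s - i t) * psi s by near: s.
by ring.
Unshelve. all: by end_near. Qed.

Lemma derZ k F l : der i F t l -> der i (fun s => k * F s) t (k * l).
Proof.
by move=> Fl; have := derM (der_cst k) Fl; rewrite mul0r add0r.
Qed.

Lemma derN F l : der i F t l -> der i (fun s => - F s) t (- l).
Proof.
move=> /(derZ (-1)); rewrite mulN1r; apply: der_ext => s; exact: mulN1r.
Qed.

Lemma derB F G l k : der i F t l -> der i G t k -> der i (fun s => F s - G s) t (l - k).
Proof. by move=> Fl /derN; exact: derD. Qed.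

Lemma derV F l : F t != 0 -> der i F t l -> der i (fun s => (F s)^-1) t (- l / F t ^+ 2).
Proof.
move=> F0 Fl; have Fc := der_cvg Fl.
have Fn0 : \forall s \near t, F s != 0.
  have : 0 < cmod (F t) by rewrite cmod_gt0.
  move: Fc => /cvgCP /[apply]; apply: filterS => s; apply: contraTneq => ->.
  by rewrite sub0r cmodN ltxx.
move: Fl => [phi [phic <- Fphi]].
exists (fun s => - phi s * ((F s)^-1 * (F t)^-1)); split.
- exact: (ccvgM (ccvgN phic) (ccvgM (ccvgV F0 Fc) (ccvg_cst (k:=(F t)^-1)))).
- by rewrite expr2 invfM.
near=> s.
have Fs0 : F s != 0 by near: s.
have : F s = F t + (i s - i t) * phi s by near: s.
set d := i s - i t => E.
have -> : d * (- phi s * ((F s)^-1 * (F t)^-1)) = (F t - (F t + d * phi s)) / (F s * F t).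
  rewrite invfM; ring.
rewrite -E; field; by rewrite ?F0 ?Fs0.
Unshelve. all: by end_near. Qed.

Lemma der_comp (F : C -> C) (w : T -> C) l k :
  cder F (w t) l -> der i w t k -> der i (fun s => F (w s)) t (l * k).
Proof.
move=> [phi [phic <- Fphi]] wk; have wc := der_cvg wk.
move: wk => [psi [psic <- wpsi]].
exists (fun s => phi (w s) * psi s); split; [|by []|].
  exact: (ccvgM (@cvg_comp _ _ _ w phi _ _ _ wc phic) psic).
near=> s.
have -> : F (w s) = F (w t) + (w s - w t) * phi (w s).
  by near: s; exact: (wc _ Fphi).
have {1}-> : w s = w t + (i s - i t) * psi s by near: s.
by rewrite [w t + _]addrC addrK; ring.
Unshelve. all: by end_near. Qed.

Lemma derX F l n : der i F t l ->
  der i (fun s => F s ^+ n) t (n%:R * F t ^+ n.-1 * l).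
Proof.
move=> Fl; elim: n => [|n IH]; first by rewrite !mul0r; exact: der_cst.
have := derM Fl IH.
have -> : l * F t ^+ n + F t * (n%:R * F t ^+ n.-1 * l) = n.+1%:R * F t ^+ n.+1.-1 * l.
  by case: n {IH} => [|n] /=; rewrite ?exprS ?expr0 -?natr1 /=; ring.
by apply: der_ext => s; rewrite exprS.
Qed.

Lemma der_sum (I : Type) (r : seq I) (P : pred I) (F : I -> T -> C) (l : I -> C) :
  (forall j, der i (F j) t (l j)) ->
  der i (fun s => \sum_(j <- r | P j) F j s) t (\sum_(j <- r | P j) l j).
Proof.
move=> Fl; elim: r => [|j r IH].
  by rewrite big_nil; apply: der_ext (der_cst 0) => s; rewrite big_nil.
rewrite big_cons; case: ifP => Pj; last first.
  by apply: der_ext IH => s; rewrite big_cons Pj.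
by apply: der_ext (derD (Fl j) IH) => s; rewrite big_cons Pj.
Qed.

End DerTheory.

Lemma cvg_idC z : (@id C) @ z --> @id C z. Proof. exact: cvg_id. Qed.

(** Transfers the calculus rules to the [derivable] and [derive1] of the statement. *)
Lemma cder_is_derive F z l : cder F z l <-> is_derive z 1 F l.
Proof.
split.
  move=> Fl.
  have H : (fun h => h^-1 *: (F (h *: (1 : C) + z) - F z)) @ 0^' --> l.
    apply/cvgCP => e e0.
    have /derP /(_ (e / 2)) := Fl.
    rewrite divr_gt0// => /(_ isT)/nbhsCP[d d0 Fd].
    apply/nbhsCP; exists d => // h; rewrite subr0 => hd h0 /=.
    have := Fd (h + z); rewrite addrK => /(_ hd) H.
    have -> : h^-1 *: (F (h *: (1 : C) + z) - F z) - l = h^-1 * (F (h + z) - F z - l * h).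
      by rewrite /GRing.scale /= mulr1 [RHS]mulrBr [l * h]mulrC mulKf.
    have h0' : 0 < cmod h by rewrite cmod_gt0.
    rewrite cmodM cmodV mulrC ltr_pdivrMr//.
    apply: le_lt_trans H _; rewrite ltr_pM2r//.
    by rewrite ltr_pdivrMr// ltr_pMr// ltr1n.
  have Hd : derivable F z 1 by apply/cvg_ex; exists l; exact: H.
  by apply: DeriveDef => //; exact: cvg_lim H.
move=> [Fd <-]; apply/derP => e e0.
have /cvgCP /(_ _ e0) /nbhsCP[d d0 H] : (fun h => h^-1 *: (F (h *: (1 : C) + z) - F z)) @ 0^' --> 'D_1 F z.
  exact: Fd.
apply/nbhsCP; exists d => // w wd.
have [->|wz] := eqVneq w z; first by rewrite !subrr mulr0 subr0 cmod0 mulr0.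
have wz0 : w - z != 0 by rewrite subr_eq0.
have := H (w - z); rewrite subr0 => /(_ wd wz0) /=.
rewrite /GRing.scale /= mulr1 subrK => H'.
have -> : F w - F z - 'D_1 F z * (w - z) = ((w - z)^-1 * (F w - F z) - 'D_1 F z) * (w - z).
  by rewrite mulrBl -mulrA mulrCA mulVf// mulr1.
by rewrite cmodM ler_wpM2r ?cmod_ge0// ltW.
Qed.

Lemma cder_derive1 F z l : cder F z l -> F^`()%classic z = l.
Proof. by move=> /cder_is_derive Fl; rewrite derive1E; exact: derive_val. Qed.

Lemma cder_derivable F z l : cder F z l -> derivable F z 1.
Proof. by move=> /cder_is_derive[]. Qed.

Lemma derivable_cder F z : derivable F z 1 -> cder F z (F^`()%classic z).
Proof. by move=> Fd; apply/cder_is_derive; rewrite derive1E; apply: DeriveDef. Qed.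

Lemma rder_Rec (F : R -> C) x l : rder F x l -> is_derive x 1 (fun t => Rec (F t)) (Rec l).
Proof.
move=> /derP H.
have H' : (fun h => h^-1 *: (Rec (F (h *: (1 : R) + x)) - Rec (F x))) @ 0^' --> Rec l.
  apply/cvgrPdist_lt => e e0; have := H (e / 2); rewrite divr_gt0// => /(_ isT).
  move=> /nbhs_ballP[d /= d0 Hd].
  apply/nbhs_ballP; exists d => // h; rewrite /ball /= sub0r normrN => hd h0.
  have := Hd (h + x); rewrite /ball /= opprD addrCA subrr addr0 normrN => /(_ hd).
  rewrite -ofRB addrK => {}H.
  rewrite distrC /GRing.scale /= mulr1.
  have -> : h^-1 * (Rec (F (h + x)) - Rec (F x)) - Rec l
     = h^-1 * Rec (F (h + x) - F x - l * ofR h).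
    by rewrite !RecB mulrC [l * _]mulrC Rec_ofRM mulrBr [_^-1 * (h * _)]mulrA mulVf// mul1r mulrC.
  rewrite normrM normfV mulrC ltr_pdivrMr ?normr_gt0//.
  apply: le_lt_trans (Rec_le_cmod _) _; apply: le_lt_trans H _.
  rewrite cmod_ofR ltr_pM2r ?normr_gt0//.
  by rewrite ltr_pdivrMr// ltr_pMr// ltr1n.
have Hd : derivable (fun t => Rec (F t)) x 1 by apply/cvg_ex; exists (Rec l); exact: H'.
by apply: DeriveDef => //; exact: cvg_lim H'.
Qed.

Lemma is_derive_rder (f : R -> R) x (l : R) : is_derive x 1 f l -> rder (fun t => ofR (f t)) x (ofR l).
Proof.
move=> [fd <-]; apply/derP => e e0.
have /cvgrPdist_lt /(_ _ e0) /nbhs_ballP[d /= d0 H] :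
    (fun h => h^-1 *: (f (h *: (1 : R) + x) - f x)) @ 0^' --> 'D_1 f x.
  exact: fd.
apply/nbhs_ballP; exists d => // w wd.
rewrite -!ofRB -ofRM -ofRB !cmod_ofR.
have [->|wz] := eqVneq w x; first by rewrite !subrr mulr0 subr0 normr0 mulr0.
have wz0 : w - x != 0 by rewrite subr_eq0.
have := H (w - x); rewrite /ball /= sub0r opprB => /(_ wd wz0) /=.
rewrite /GRing.scale /= mulr1 subrK => H'.
have -> : f w - f x - 'D_1 f x * (w - x) = ((w - x)^-1 * (f w - f x) - 'D_1 f x) * (w - x).
  by rewrite mulrBl -mulrA mulrCA mulVf// mulr1.
by rewrite normrM ler_wpM2r ?normr_ge0// distrC ltW.
Qed.

End Derivatives.

(** * Complex-valued paths on [0,1]: mean value inequality and primitives *)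

Section Paths.
Variable R : realType.
Local Notation C := (C R).
Implicit Types (t x y e : R) (z w l k : C).

Lemma cder_cvg (F : C -> C) z l : cder F z l -> F @ z --> F z.
Proof. by move=> H; have := @der_cvg R _ id z (@cvg_idC R z) F l H. Qed.
Lemma cder_near (F G : C -> C) z l :
  (\forall s \near z, F s = G s) -> cder F z l -> cder G z l.
Proof. exact: der_near. Qed.
Lemma cder_cst k z : cder (fun=> k) z 0.
Proof. exact: der_cst. Qed.
Lemma cder_id z : cder id z 1.
Proof. exact: der_incl. Qed.
Lemma cderD (F G : C -> C) z l k :
  cder F z l -> cder G z k -> cder (fun s => F s + G s) z (l + k).
Proof. exact: derD. Qed.
Lemma cderM (F G : C -> C) z l k :
  cder F z l -> cder G z k -> cder (fun s => F s * G s) z (l * G z + F z * k).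
Proof. move=> *; exact: (@derM R _ id z (@cvg_idC R z)). Qed.
Lemma cderZ k (F : C -> C) z l : cder F z l -> cder (fun s => k * F s) z (k * l).
Proof. move=> *; exact: (@derZ R _ id z (@cvg_idC R z)). Qed.
Lemma cderB (F G : C -> C) z l k :
  cder F z l -> cder G z k -> cder (fun s => F s - G s) z (l - k).
Proof. move=> *; exact: (@derB R _ id z (@cvg_idC R z)). Qed.
Lemma cderV (F : C -> C) z l :
  F z != 0 -> cder F z l -> cder (fun s => (F s)^-1) z (- l / F z ^+ 2).
Proof. move=> *; exact: (@derV R _ id z (@cvg_idC R z)). Qed.
Lemma cderX (F : C -> C) z l n :
  cder F z l -> cder (fun s => F s ^+ n) z (n%:R * F z ^+ n.-1 * l).
Proof. move=> *; exact: (@derX R _ id z (@cvg_idC R z)). Qed.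
Lemma cder_comp (F G : C -> C) z l k :
  cder F (G z) l -> cder G z k -> cder (fun s => F (G s)) z (l * k).
Proof. move=> *; exact: (@der_comp R _ id z (@cvg_idC R z)). Qed.

Lemma rder_cvg (P : R -> C) t l : rder P t l -> P @ t --> P t.
Proof. by move=> H; have := @der_cvg R _ (@ofR R) t (@continuous_ofR R t) P l H. Qed.
Lemma rderZ k (F : R -> C) t l : rder F t l -> rder (fun s => k * F s) t (k * l).
Proof. move=> *; exact: (@derZ R _ (@ofR R) t (@continuous_ofR R t)). Qed.
Lemma rderB (F G : R -> C) t l k :
  rder F t l -> rder G t k -> rder (fun s => F s - G s) t (l - k).
Proof. move=> *; exact: (@derB R _ (@ofR R) t (@continuous_ofR R t)). Qed.
Lemma rder_comp (F : C -> C) (w : R -> C) t l k :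
  cder F (w t) l -> rder w t k -> rder (fun s => F (w s)) t (l * k).
Proof. move=> *; exact: (@der_comp R _ (@ofR R) t (@continuous_ofR R t)). Qed.

Lemma rder_affine (P : R -> C) x y t l :
  rder P (x + y * t) l -> rder (fun s => P (x + y * s)) t (ofR y * l).
Proof.
move=> [phi [phic <- Pphi]].
have ac : (fun s : R => x + y * s) @ t --> x + y * t.
  by apply: cvgD; [exact: cvg_cst|apply: cvgM; [exact: cvg_cst|exact: cvg_id]].
exists (fun s => ofR y * phi (x + y * s)); split; [|by []|].
  exact: (ccvgM (ccvg_cst (k:=ofR y)) (@cvg_comp _ _ _ _ phi _ _ _ ac phic)).
have H : \forall s \near t, P (x + y * s) = P (x + y * t) +
    (ofR (x + y * s) - ofR (x + y * t)) * phi (x + y * s) := ac _ Pphi.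
near=> s; have -> : P (x + y * s) = P (x + y * t) +
    (ofR (x + y * s) - ofR (x + y * t)) * phi (x + y * s) by near: s.
by rewrite !ofRD !ofRM; ring.
Unshelve. all: by end_near. Qed.

Lemma rder_segment z w t : rder (fun s => z + ofR s * w) t w.
Proof.
exists (fun=> w); split; [exact: (ccvg_cst (k:=w))|by []|].
by near=> s; ring.
Unshelve. all: by end_near. Qed.

Definition unit_itv t : Prop := 0 <= t <= 1.

(** The mean value inequality is the real mean value theorem applied to the
    component of [P] in the direction [P 1 - P 0]. *)
Lemma rder_bound (P g : R -> C) (M : R) :
  (forall t, unit_itv t -> rder P t (g t)) ->
  (forall t, unit_itv t -> cmod (g t) <= M) -> cmod (P 1 - P 0) <= M.
Proof.
move=> Pg gM; set D := P 1 - P 0.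
have M0 : 0 <= M by apply: le_trans (gM 0 _); rewrite ?cmod_ge0// /unit_itv lexx ler01.
have [->|D0] := eqVneq D 0; first by rewrite cmod0.
pose D' : C := ofR (Rec D) - iC R * ofR (Imc D).
have D'M z : Rec (D' * z) = Rec D * Rec z + Imc D * Imc z.
  by rewrite RecM /D' RecB ImcB RecM ImcM /= /Rec /Imc /=; ring.
have D'norm : cmod D' = cmod D.
  by rewrite /cmod /D' RecB ImcB RecM ImcM /= /Rec /Imc /=; congr Num.sqrt; ring.
have dphi t : unit_itv t ->
    is_derive t 1 (fun s => Rec (D' * P s)) (Rec (D' * g t)).
  by move=> /Pg /(rderZ D') /rder_Rec.
have [||c c01] := @MVT R (fun s => Rec (D' * P s)) (fun t => Rec (D' * g t)) 0 1 ltr01.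
- by move=> t; rewrite in_itv /= => /andP[t0 t1]; apply: dphi; rewrite /unit_itv !ltW.
- apply: derivable_within_continuous => t; rewrite in_itv /= => t01.
  by have [] := dphi t t01.
rewrite subr0 mulr1 => H.
have : cmod D ^+ 2 <= cmod D * M.
  have -> : cmod D ^+ 2 = Rec (D' * g c).
    by rewrite -H -RecB -mulrBr -/D D'M cmod_sqr !expr2.
  apply: le_trans (ler_norm _) _; apply: le_trans (Rec_le_cmod _) _.
  rewrite cmodM D'norm ler_wpM2l ?cmod_ge0// gM//.
  by move: c01; rewrite in_itv /unit_itv /= => /andP[a b]; rewrite !ltW.
by rewrite expr2 ler_pM2l// cmod_gt0.
Qed.

Lemma real_primitive (f : R -> R) : continuous f ->
  exists F : R -> R, forall t, unit_itv t -> is_derive t 1 F (f t).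
Proof.
move=> fc.
(* Starting at -1, with integrability up to 2, puts [0,1] in the interior, so the derivative is
   two-sided at 0 and 1 as well. *)
exists (fun x0 => (\int[lebesgue_measure]_(t in [set` Interval (BLeft (- 1)) (BRight x0)]) f t)%R).
move=> t /andP[t0 t1].
have t2 : t < 2 by lra.
have int : lebesgue_measure.-integrable [set` Interval (BLeft (- 1)) (BRight (2:R))] (EFin \o f).
  apply: continuous_compact_integrable; first exact: segment_compact.
  exact: continuous_subspaceT.
have [||d e] := continuous_FTC1 t2 int.
- by rewrite lte_fin; lra.
- exact: fc.
by rewrite -e derive1E; exact: DeriveDef.
Qed.

Lemma primitive_exists (g : R -> C) : (forall t, g @ t --> g t) ->
  exists P : R -> C, forall t, unit_itv t -> rder P t (g t).
Proof.
move=> gc.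
have [] := @real_primitive (fun t => Rec (g t)).
  by move=> t; exact: (@cvg_comp _ _ _ g (@Rec R) _ _ _ (gc t) (@continuous_Rec R (g t))).
move=> P1 H1.
have [] := @real_primitive (fun t => Imc (g t)).
  by move=> t; exact: (@cvg_comp _ _ _ g (@Imc R) _ _ _ (gc t) (@continuous_Imc R (g t))).
move=> P2 H2.
exists (fun t => ofR (P1 t) + iC R * ofR (P2 t)) => t t01.
rewrite [g t]complexE; apply: derD.
  exact: is_derive_rder (H1 t t01).
apply: rderZ; exact: is_derive_rder (H2 t t01).
Qed.

End Paths.

(** * Segment integrals and Goursat's lemma *)

Section SegmentIntegrals.
Variable R : realType.
Local Notation C := (C R).
Implicit Types (t x y e : R) (z w l k a b : C) (f g F : C -> C).

Definition seg a b t : C := a + ofR t * (b - a).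

Lemma seg0 a b : seg a b 0 = a. Proof. by rewrite /seg ofR0 mul0r addr0. Qed.
Lemma seg1 a b : seg a b 1 = b. Proof. by rewrite /seg ofR1 mul1r addrC subrK. Qed.
Lemma seg_rev a b t : seg b a t = seg a b (1 - t).
Proof. by rewrite /seg ofRB ofR1; ring. Qed.
Lemma unit_itv0 : unit_itv (0 : R). Proof. by rewrite /unit_itv lexx ler01. Qed.
Lemma unit_itv1 : unit_itv (1 : R). Proof. by rewrite /unit_itv lexx ler01. Qed.
Lemma unit_itv_rev t : unit_itv t -> unit_itv (1 - t).
Proof. by rewrite /unit_itv => /andP[? ?]; apply/andP; split; lra. Qed.
Lemma unit_itv_conv x y t : unit_itv x -> unit_itv y -> unit_itv t ->
  unit_itv (x + t * (y - x)).
Proof.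
by rewrite /unit_itv => /andP[? ?] /andP[? ?] /andP[? ?]; apply/andP; split; nra.
Qed.

Definition continuous_on_seg f a b : Prop :=
  forall t, unit_itv t -> f @ seg a b t --> f (seg a b t).

Definition is_seg_int f a b l : Prop := exists P : R -> C,
  (forall t, unit_itv t -> rder P t ((b - a) * f (seg a b t))) /\ l = P 1 - P 0.

(** Total in its endpoints, so that [seg_int f w] can itself serve as a primitive of [f] on a
    domain. *)
Definition seg_int f a b : C := xget 0 [set l | is_seg_int f a b l].

(** A function continuous on [0,1] only is first extended by clamping. *)
Lemma is_seg_int_exists f a b : continuous_on_seg f a b -> exists l, is_seg_int f a b l.
Proof.
move=> fc; pose cl t : R := Num.max 0 (Num.min 1 t).
have cl01 t : unit_itv (cl t).
  by rewrite /unit_itv /cl le_max lexx /= ge_max ler01 ge_min lexx.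
have clE t : unit_itv t -> cl t = t.
  by move=> /andP[t0 t1]; rewrite /cl min_r// max_r.
have clc t : cl @ t --> cl t.
  rewrite /cl; apply: (@continuous_max R R (fun=> 0) (fun t => Num.min 1 t) t).
    exact: cvg_cst.
  apply: (@continuous_min R R (fun=> 1) id t).
    exact: cvg_cst.
  exact: cvg_id.
have [|P HP] := @primitive_exists R (fun t => (b - a) * f (seg a b (cl t))).
  move=> t.
  have sc : (fun t => seg a b (cl t)) @ t --> seg a b (cl t).
    have sc' := rder_cvg (@rder_segment R a (b - a) (cl t)).
    exact: (@cvg_comp _ _ _ cl (seg a b) _ _ _ (clc t) sc').
  apply: (ccvgM (ccvg_cst (k := b - a))).
  exact: (@cvg_comp _ _ _ (fun t => seg a b (cl t)) f _ _ _ sc (fc _ (cl01 t))).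
by exists (P 1 - P 0), P; split=> // t t01; have := HP t t01; rewrite clE.
Qed.

(** Two primitives differ by a path of derivative 0, whose increment the mean value inequality
    bounds by 0. *)
Lemma is_seg_int_unique f a b l k : is_seg_int f a b l -> is_seg_int f a b k -> l = k.
Proof.
move=> [P [HP ->]] [Q [HQ ->]].
have : cmod ((P 1 - Q 1) - (P 0 - Q 0)) <= 0.
  apply: (@rder_bound R (fun t => P t - Q t)
    (fun t => (b - a) * f (seg a b t) - (b - a) * f (seg a b t))) => [t t01|t _].
    exact: rderB (HP t t01) (HQ t t01).
  by rewrite subrr cmod0.
rewrite le_eqVlt ltNge cmod_ge0 orbF cmod_eq0 => /eqP H.
by apply/eqP; rewrite -subr_eq0; apply/eqP; rewrite -[RHS]H; ring.
Qed.

Lemma seg_intE f a b l : is_seg_int f a b l -> seg_int f a b = l.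
Proof.
move=> fl; apply: (is_seg_int_unique _ fl).
exact: (@xgetPex _ 0 [set l | is_seg_int f a b l] (ex_intro _ l fl)).
Qed.

Lemma seg_intP f a b : continuous_on_seg f a b -> is_seg_int f a b (seg_int f a b).
Proof. by move=> /is_seg_int_exists[l fl]; rewrite (seg_intE fl). Qed.

Lemma is_seg_int_bound f a b l (M : R) : is_seg_int f a b l ->
  (forall t, unit_itv t -> cmod (f (seg a b t)) <= M) -> cmod l <= cmod (b - a) * M.
Proof.
move=> [P [HP ->]] fM; apply: rder_bound HP _ => t t01.
by rewrite cmodM ler_wpM2l ?cmod_ge0 ?fM.
Qed.

Lemma is_seg_intB f g a b l k :
  is_seg_int f a b l -> is_seg_int g a b k -> is_seg_int (fun z => f z - g z) a b (l - k).
Proof.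
move=> [P [HP ->]] [Q [HQ ->]]; exists (fun t => P t - Q t); split.
  by move=> t t01; rewrite mulrBr; exact: rderB (HP t t01) (HQ t t01).
by ring.
Qed.

Lemma is_seg_int_primitive f F a b :
  (forall t, unit_itv t -> cder F (seg a b t) (f (seg a b t))) ->
  is_seg_int f a b (F b - F a).
Proof.
move=> Ff; exists (fun t => F (seg a b t)); rewrite seg0 seg1; split=> // t t01.
rewrite mulrC; apply: rder_comp; first exact: Ff.
exact: rder_segment.
Qed.

Lemma is_seg_int_rev f a b l : is_seg_int f a b l -> is_seg_int f b a (- l).
Proof.
move=> [P [HP ->]]; exists (fun t => P (1 + (-1) * t)); split; last first.
  by rewrite mulr1 mulr0 subrr addr0 opprB.
move=> t t01; have tE : 1 + (-1) * t = 1 - t by ring.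
have := HP (1 - t) (unit_itv_rev t01); rewrite -seg_rev -{1}tE => /rder_affine.
by rewrite ofRN ofR1 mulN1r -mulNr opprB.
Qed.

Lemma is_seg_int_split f a b l x : unit_itv x -> is_seg_int f a b l ->
  exists l1 l2, [/\ l = l1 + l2, is_seg_int f a (seg a b x) l1 &
    is_seg_int f (seg a b x) b l2].
Proof.
move=> x01 [P [HP ->]]; exists (P x - P 0), (P 1 - P x); split; first by ring.
- exists (fun t => P (0 + x * t)); split; last by rewrite mulr1 mulr0 !add0r.
  move=> t t01; have u := unit_itv_conv unit_itv0 x01 t01.
  have := HP _ u; rewrite subr0 [t * x]mulrC => /rder_affine.
  have -> : seg a (seg a b x) t = seg a b (0 + x * t) by rewrite /seg add0r ofRM; ring.
  have -> : seg a b x - a = ofR x * (b - a) by rewrite /seg; ring.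
  by rewrite mulrA.
- exists (fun t => P (x + (1 - x) * t)); split; last first.
    by rewrite mulr1 mulr0 addr0 subrKC.
  move=> t t01; have u := unit_itv_conv x01 unit_itv1 t01.
  have := HP _ u; rewrite [t * _]mulrC => /rder_affine.
  have -> : seg (seg a b x) b t = seg a b (x + (1 - x) * t).
    by rewrite /seg ofRD ofRM ofRB ofR1; ring.
  have -> : b - seg a b x = ofR (1 - x) * (b - a) by rewrite /seg ofRB ofR1; ring.
  by rewrite mulrA.
Qed.

Lemma seg_int_rev f a b : continuous_on_seg f a b -> seg_int f b a = - seg_int f a b.
Proof. by move=> /seg_intP/is_seg_int_rev/seg_intE. Qed.

Lemma seg_int_split f a b x : unit_itv x -> continuous_on_seg f a b ->
  seg_int f a b = seg_int f a (seg a b x) + seg_int f (seg a b x) b.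
Proof.
move=> x01 /seg_intP/(is_seg_int_split x01)[l1 [l2 [-> /seg_intE-> /seg_intE->]]].
by [].
Qed.

End SegmentIntegrals.

(** * Halving estimates *)

Section Geometric.
Variable R : realType.
Implicit Types (x e : R).

Lemma half_gt0 n : 0 < (2^-1 : R) ^+ n.
Proof. by rewrite exprn_gt0// invr_gt0. Qed.

Lemma half_small (e : R) : 0 < e -> exists n, (2^-1 : R) ^+ n < e.
Proof.
move=> e0; exists (Num.truncn e^-1).+1.
rewrite exprVn invf_plt ?posrE ?exprn_gt0//.
have := truncnS_gt e^-1; move=> H; apply: (lt_le_trans H).
by rewrite -natrX ler_nat ltnW// ltn_expl.
Qed.

Lemma le_half_small (a c : R) : (forall n, a <= c * 2^-1 ^+ n) -> a <= 0.
Proof.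
move=> H; rewrite leNgt; apply/negP => a0.
have c0 : 0 < c by have := H 0%N; rewrite expr0 mulr1; lra.
have [n] := half_small (divr_gt0 a0 c0).
rewrite ltr_pdivlMr// mulrC => n_small.
by have := lt_le_trans n_small (H n); rewrite ltxx.
Qed.

(** The intervals about [x n] of radius [2 * 2^-1 ^+ n] are nested, because a step of [2^-1 ^+ n]
    plus the next radius is exactly the current one; [X] is the supremum of their left ends. *)
Lemma half_steps_limit (x : nat -> R) :
  (forall n, `|x n.+1 - x n| <= 2^-1 ^+ n) ->
  exists X, forall n, `|x n - X| <= 2 * 2^-1 ^+ n.
Proof.
move=> Hx.
have step n k : x n - 2 * 2^-1 ^+ n <= x (n + k)%N - 2 * 2^-1 ^+ (n + k) /\
                x (n + k)%N + 2 * 2^-1 ^+ (n + k) <= x n + 2 * 2^-1 ^+ n.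
  elim: k => [|k [IH1 IH2]]; first by rewrite addn0.
  have := Hx (n + k)%N; rewrite addnS exprS ler_norml => /andP[a b].
  by split; lra.
have cross n m : x n - 2 * 2^-1 ^+ n <= x m + 2 * 2^-1 ^+ m.
  case: (leqP n m) => nm.
    have [a _] := step n (m - n)%N; rewrite subnKC// in a.
    by have := half_gt0 m; lra.
  have [_ a] := step m (n - m)%N; rewrite subnKC ?(ltnW nm)// in a.
  by have := half_gt0 n; lra.
pose A := range (fun n => x n - 2 * 2^-1 ^+ n).
have A0 : A !=set0 by exists (x 0%N - 2 * 2^-1 ^+ 0), 0%N.
have Aub m : ubound A (x m + 2 * 2^-1 ^+ m) by move=> _ [n _ <-].
exists (sup A) => n; rewrite ler_norml; apply/andP; split.
  have := ge_sup A0 (Aub n); lra.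
have : x n - 2 * 2^-1 ^+ n <= sup A.
  by apply: ub_le_sup; [exists (x 0%N + 2 * 2^-1 ^+ 0)|exists n].
by lra.
Qed.

Lemma conv_close (x x' X r t : R) : `|x - X| <= r -> `|x' - X| <= r ->
  unit_itv t -> `|x + t * (x' - x) - X| <= r.
Proof.
rewrite !ler_norml => /andP[? ?] /andP[? ?] /andP[? ?].
by apply/andP; split; nra.
Qed.

(** Pigeonhole for the four children of a triangle: [s1] and [s2] are moduli of partial sums, and if
    three children fall short of a quarter of [M], the fourth does not. *)
Lemma quarter_max (M s1 s2 k1 k2 k3 k4 : R) :
  M <= s2 + k4 -> s2 <= s1 + k3 -> s1 <= k1 + k2 ->
  4 * k1 < M -> 4 * k2 < M -> 4 * k3 < M -> M <= 4 * k4.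
Proof. by lra. Qed.

End Geometric.

(** * Goursat's lemma by repeated subdivision *)

Section Goursat.
Variable R : realType.
Local Notation C := (C R).
Implicit Types (t x y s e : R) (z w l k : C).

Definition tri_int (f : C -> C) (a b c : C) : C :=
  seg_int f a b + seg_int f b c + seg_int f c a.

Section Triangle.
Variables (f : C -> C) (a b c : C).

(** Affine coordinates on the triangle, with [D] as parameter domain: subdivision happens among
    pairs of reals, and degenerate triangles are included. *)
Let V x y : C := a + ofR x * (b - a) + ofR y * (c - a).
Let D x y : Prop := [/\ 0 <= x, 0 <= y & x + y <= 1].

Hypothesis f_cont : forall x y, D x y -> f @ V x y --> f (V x y).

Let segV x y x' y' t :
  seg (V x y) (V x' y') t = V (x + t * (x' - x)) (y + t * (y' - y)).
Proof. by rewrite /seg /V !ofRD !ofRM !ofRB; ring. Qed.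

Let D_conv x y x' y' t : unit_itv t -> D x y -> D x' y' ->
  D (x + t * (x' - x)) (y + t * (y' - y)).
Proof. by move=> /andP[t0 t1] [? ? ?] [? ? ?]; split; nra. Qed.

Let f_cont_seg x y x' y' : D x y -> D x' y' ->
  continuous_on_seg f (V x y) (V x' y').
Proof. by move=> d d' t t01; rewrite segV; apply: f_cont; exact: D_conv. Qed.

Let K x y x' y' : C := seg_int f (V x y) (V x' y').
Let Krev x y x' y' : D x y -> D x' y' -> K x' y' x y = - K x y x' y'.
Proof. by move=> d d'; apply: seg_int_rev; exact: f_cont_seg. Qed.
Let Ksplit x y x' y' u v : D x y -> D x' y' ->
  u = x + 2^-1 * (x' - x) -> v = y + 2^-1 * (y' - y) ->
  K x y x' y' = K x y u v + K u v x' y'.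
Proof.
move=> d d' -> ->; rewrite /K -segV; apply: seg_int_split; last exact: f_cont_seg.
by rewrite /unit_itv; apply/andP; split; lra.
Qed.

(** A homothetic copy of the full triangle, with one corner and a signed ratio [s]. The middle piece
    of a subdivision is upside down, so its ratio has the opposite sign. *)
Let tri x y s : Prop := [/\ D x y, D (x + s) y & D x (y + s)].
Let mu x y s : C := tri_int f (V x y) (V (x + s) y) (V x (y + s)).

Let tri_children x y s : tri x y s ->
  [/\ tri x y (s / 2), tri (x + s / 2) y (s / 2), tri x (y + s / 2) (s / 2)
    & tri (x + s / 2) (y + s / 2) (- (s / 2))].
Proof.
by move=> [[? ? ?] [? ? ?] [? ? ?]]; split; split; split; lra.
Qed.

Let mu_children x y s : tri x y s ->
  mu x y s = mu x y (s / 2) + mu (x + s / 2) y (s / 2) + mu x (y + s / 2) (s / 2)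
             + mu (x + s / 2) (y + s / 2) (- (s / 2)).
Proof.
move=> T; have [d0 d1 d2] := T; have [[_ e1 e2] [_ _ e3] _ _] := tri_children T.
rewrite /mu /tri_int -!/(K _ _ _ _).
have -> : x + s / 2 + s / 2 = x + s by field.
have -> : y + s / 2 + s / 2 = y + s by field.
have -> : x + s / 2 + - (s / 2) = x by ring.
have -> : y + s / 2 + - (s / 2) = y by ring.
rewrite (@Ksplit x y (x + s) y (x + s / 2) y)//; [|by field|by field].
rewrite (@Ksplit (x + s) y x (y + s) (x + s / 2) (y + s / 2))//; [|by field|by field].
rewrite (@Ksplit x (y + s) x y x (y + s / 2))//; [|by field|by field].
rewrite (@Krev (x + s / 2) (y + s / 2) (x + s / 2) y)//.
rewrite (@Krev (x + s / 2) (y + s / 2) x (y + s / 2))//.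
rewrite (@Krev (x + s / 2) y x (y + s / 2))//.
(* [k1] to [k6] are the halves of the outer edges; [k7], [k8], [k9] are the inner edges, each
   traversed once in either direction. *)
have abel (k1 k2 k3 k4 k5 k6 k7 k8 k9 : C) : k1 + k2 + (k3 + k4) + (k5 + k6) =
    k1 + k7 + k6 + (k2 + k3 + k8) + (- k9 + k4 + k5) + (k9 + - k7 + - k8) by ring.
exact: abel.
Qed.

(** One of the four children carries at least a quarter of the integral. The implication stands
    under the existential so that [choice] yields a total successor function. *)
Let step (p : R * R * R) : exists q : R * R * R, tri p.1.1 p.1.2 p.2 ->
  [/\ tri q.1.1 q.1.2 q.2, `|q.2| = `|p.2| / 2,
    `|q.1.1 - p.1.1| <= `|p.2| / 2, `|q.1.2 - p.1.2| <= `|p.2| / 2 &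
    cmod (mu p.1.1 p.1.2 p.2) <= 4 * cmod (mu q.1.1 q.1.2 q.2)].
Proof.
case: p => [[x y] s] /=.
have [T|] := pselect (tri x y s); last by exists (x, y, s).
have [T1 T2 T3 T4] := tri_children T.
have n2 : `|s / 2| = `|s| / 2 by rewrite normrM (@ger0_norm _ 2^-1)// invr_ge0.
have z0 u : `|u - u| <= `|s| / 2 :> R by rewrite subrr normr0 divr_ge0.
have z1 u : `|u + s / 2 - u| <= `|s| / 2 by rewrite addrC addKr n2.
have := cmodD (mu x y (s / 2) + mu (x + s / 2) y (s / 2) + mu x (y + s / 2) (s / 2))
  (mu (x + s / 2) (y + s / 2) (- (s / 2))).
rewrite -mu_children// => H.
have H1 := cmodD (mu x y (s / 2) + mu (x + s / 2) y (s / 2)) (mu x (y + s / 2) (s / 2)).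
have H2 := cmodD (mu x y (s / 2)) (mu (x + s / 2) y (s / 2)).
have [L1|L1] := leP (cmod (mu x y s)) (4 * cmod (mu x y (s / 2))).
  by exists (x, y, s / 2) => /= _; split.
have [L2|L2] := leP (cmod (mu x y s)) (4 * cmod (mu (x + s / 2) y (s / 2))).
  by exists (x + s / 2, y, s / 2) => /= _; split.
have [L3|L3] := leP (cmod (mu x y s)) (4 * cmod (mu x (y + s / 2) (s / 2))).
  by exists (x, y + s / 2, s / 2) => /= _; split.
exists (x + s / 2, y + s / 2, - (s / 2)) => /= _.
split; [exact: T4|by rewrite normrN|exact: z1|exact: z1|].
exact: (quarter_max H H1 H2 L1 L2 L3).
Qed.

Hypothesis f_der : forall x y, D x y -> exists l, cder f (V x y) l.

(** The chosen triangles shrink to a point [p]. Passing to a child costs a factor 4 in the integral,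
    while the deviation of [f] from its affine approximation at [p] integrates to at most a multiple
    of [e * 4^-n]; the two powers of 4 cancel and [e] is arbitrary. *)
Theorem goursat_bary : mu 0 0 1 = 0.
Proof.
have [next nextP] := choice step.
pose st n := iter n next (0, 0, 1).
pose X n := (st n).1.1; pose Y n := (st n).1.2; pose S n := (st n).2.
have stP n : tri (X n) (Y n) (S n) /\ `|S n| = 2^-1 ^+ n.
  elim: n => [|n [T Sn]].
    by rewrite /X /Y /S /= normr1 expr0; split; [split; split; lra|].
  have [T' S' _ _ _] := nextP (st n) T; split; first exact: T'.
  by rewrite exprSr -Sn; exact: S'.
have nxt n := nextP (st n) (stP n).1.
have Sn n : `|S n| = 2^-1 ^+ n by case: (stP n).
have hn n := half_gt0 R n.
have [X0 HX] : exists X0, forall n, `|X n - X0| <= 2 * 2^-1 ^+ n.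
  apply: half_steps_limit => n; have [_ _ H _ _] := nxt n.
  by apply: (le_trans H); have := hn n; rewrite -/(S n) Sn; lra.
have [Y0 HY] : exists Y0, forall n, `|Y n - Y0| <= 2 * 2^-1 ^+ n.
  apply: half_steps_limit => n; have [_ _ _ H _] := nxt n.
  by apply: (le_trans H); have := hn n; rewrite -/(S n) Sn; lra.
have mun n : cmod (mu 0 0 1) <= 4 ^+ n * cmod (mu (X n) (Y n) (S n)).
  elim: n => [|n IH]; first by rewrite expr0 mul1r.
  apply: (le_trans IH); rewrite exprSr -mulrA; apply: ler_wpM2l.
    by apply: exprn_ge0.
  by have [_ _ _ _ H] := nxt n; exact: H.
(* The inequalities defining [D] hold at every corner [(X n, Y n)], hence at the limit up to a
   multiple of [2^-1 ^+ n]. *)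
have D0 : D X0 Y0.
  split.
  - rewrite -oppr_le0; apply: (@le_half_small R _ 2) => n.
    have [[[x0 _ _] _ _] _] := stP n.
    by have := HX n; rewrite ler_norml => /andP[_]; lra.
  - rewrite -oppr_le0; apply: (@le_half_small R _ 2) => n.
    have [[[_ y0 _] _ _] _] := stP n.
    by have := HY n; rewrite ler_norml => /andP[_]; lra.
  - rewrite -subr_le0; apply: (@le_half_small R _ 4) => n.
    have [[[_ _ xy] _ _] _] := stP n.
    have := HX n; rewrite ler_norml => /andP[+ _].
    by have := HY n; rewrite ler_norml => /andP[+ _]; lra.
have [l fl] := f_der D0; set p := V X0 Y0 in fl.
pose L := cmod (b - a) + cmod (c - a).
have L0 : 0 <= L by rewrite addr_ge0 ?cmod_ge0.
have Vdist x y x' y' r : `|x' - x| <= r -> `|y' - y| <= r ->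
    cmod (V x' y' - V x y) <= r * L.
  move=> hx hy; have -> : V x' y' - V x y = ofR (x' - x) * (b - a) + ofR (y' - y) * (c - a).
    by rewrite /V !ofRB; ring.
  apply: le_trans (cmodD _ _) _; rewrite !cmodM !cmod_ofR /L mulrDr.
  by apply: lerD; rewrite ler_wpM2r ?cmod_ge0.
(* The affine approximation has the global primitive [H], so its edge integrals telescope to 0
   around any triangle. *)
pose h w := f p + l * (w - p).
pose H w := f p * w + l * (2^-1 * (w - p) ^+ 2).
have Hh w : cder H w (h w).
  have -> : h w = f p * 1 + l * (2^-1 * (2%:R * (w - p) ^+ 2.-1 * (1 - 0))).
    by rewrite /h /= subr0 expr1; field.
  apply: cderD; first by apply: cderZ; exact: cder_id.
  by apply: cderZ; apply: cderZ; apply: cderX; apply: cderB; [exact: cder_id|exact: cder_cst].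
have edge e n x y x' y' : 0 < e -> D x y -> D x' y' ->
    (forall w, cmod (w - p) <= 3 * 2^-1 ^+ n * L ->
      cmod (f w - f p - l * (w - p)) <= e * cmod (w - p)) ->
    `|x - X0| <= 3 * 2^-1 ^+ n -> `|y - Y0| <= 3 * 2^-1 ^+ n ->
    `|x' - X0| <= 3 * 2^-1 ^+ n -> `|y' - Y0| <= 3 * 2^-1 ^+ n ->
    `|x' - x| <= 2^-1 ^+ n -> `|y' - y| <= 2^-1 ^+ n ->
    cmod (K x y x' y' - (H (V x' y') - H (V x y))) <= 3 * e * L ^+ 2 * (2^-1 ^+ n) ^+ 2.
  move=> e0 d d' near_p hx hy hx' hy' hxx hyy.
  have I1 := seg_intP (f_cont_seg d d').
  have I2 : is_seg_int h (V x y) (V x' y') (H (V x' y') - H (V x y)).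
    by apply: is_seg_int_primitive => t _; exact: Hh.
  have := is_seg_int_bound (is_seg_intB I1 I2).
  move=> /(_ (e * (3 * 2^-1 ^+ n * L))) B; apply: le_trans (B _) _ => [t t01|].
    have close : cmod (seg (V x y) (V x' y') t - p) <= 3 * 2^-1 ^+ n * L.
      by rewrite segV; apply: Vdist; exact: conv_close.
    rewrite /h opprD addrA.
    by apply: le_trans (near_p _ close) _; rewrite ler_pM2l.
  have := Vdist _ _ _ _ _ hxx hyy => {}B.
  have -> : 3 * e * L ^+ 2 * (2^-1 ^+ n) ^+ 2 = (2^-1 ^+ n * L) * (e * (3 * 2^-1 ^+ n * L)).
    by ring.
  by apply: ler_wpM2r => //; rewrite !mulr_ge0// ltW.
have small e : 0 < e -> cmod (mu 0 0 1) <= 9 * e * L ^+ 2.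
  move=> e0; have /derP/(_ e e0)/nbhsCP[d d0 Hd] := fl.
  have L1 : 0 < 3 * (L + 1) by lra.
  have [n nd] := half_small (divr_gt0 d0 L1).
  rewrite ltr_pdivlMr// in nd.
  apply: (le_trans (mun n)).
  have [[dA dB dC] _] := stP n.
  have near_p w : cmod (w - p) <= 3 * 2^-1 ^+ n * L ->
      cmod (f w - f p - l * (w - p)) <= e * cmod (w - p).
    move=> wp; apply: Hd; apply: le_lt_trans wp _; apply: le_lt_trans nd.
    by have := hn n; nra.
  (* The corner is within [2 * 2^-1 ^+ n] of the limit and the sides measure [2^-1 ^+ n], which
     gives the factor 3 in [edge]; the three edges together give 9. *)
  have hX := HX n; have hY := HY n; have hS := Sn n.
  have hX' : `|X n - X0| <= 3 * 2^-1 ^+ n by have := hn n; lra.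
  have hY' : `|Y n - Y0| <= 3 * 2^-1 ^+ n by have := hn n; lra.
  have hSn : `|S n| <= 2^-1 ^+ n by rewrite hS.
  have hXS : `|X n + S n - X0| <= 3 * 2^-1 ^+ n.
    by rewrite addrAC; apply: le_trans (ler_normD _ _) _; lra.
  have hYS : `|Y n + S n - Y0| <= 3 * 2^-1 ^+ n.
    by rewrite addrAC; apply: le_trans (ler_normD _ _) _; lra.
  have zz (u : R) : `|u - u| <= 2^-1 ^+ n by rewrite subrr normr0 ltW.
  have z1 u : `|u + S n - u| <= 2^-1 ^+ n by rewrite addrC addKr.
  have z2 u : `|u - (u + S n)| <= 2^-1 ^+ n by rewrite distrC.
  have E1 := edge e n _ _ _ _ e0 dA dB near_p hX' hY' hXS hY' (z1 _) (zz _).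
  have E2 := edge e n _ _ _ _ e0 dB dC near_p hXS hY' hX' hYS (z2 _) (z1 _).
  have E3 := edge e n _ _ _ _ e0 dC dA near_p hX' hYS hX' hY' (zz _) (z2 _).
  have -> : mu (X n) (Y n) (S n) =
      (K (X n) (Y n) (X n + S n) (Y n) - (H (V (X n + S n) (Y n)) - H (V (X n) (Y n)))) +
      (K (X n + S n) (Y n) (X n) (Y n + S n) - (H (V (X n) (Y n + S n)) - H (V (X n + S n) (Y n)))) +
      (K (X n) (Y n + S n) (X n) (Y n) - (H (V (X n) (Y n)) - H (V (X n) (Y n + S n)))).
    by rewrite /mu /tri_int -!/(K _ _ _ _); ring.
  set k1 := K _ _ _ _ - _ in E1 *; set k2 := K _ _ _ _ - _ in E2 *.
  set k3 := K _ _ _ _ - _ in E3 *.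
  have T1 := cmodD (k1 + k2) k3; have T2 := cmodD k1 k2.
  have : cmod (k1 + k2 + k3) <= 9 * e * L ^+ 2 * (2^-1 ^+ n) ^+ 2 by lra.
  move=> /(ler_wpM2l (exprn_ge0 n (ler0n R 4))) E; apply: (le_trans E).
  rewrite mulrCA -exprM mulnC exprM -exprMn.
  have -> : (4 * 2^-1 ^+ 2 = 1 :> R) by field.
  by rewrite expr1n mulr1.
apply/eqP; rewrite -cmod_eq0 eq_le cmod_ge0 andbT leNgt; apply/negP => mu0.
(* With [e = m / (18 * (L ^+ 2 + 1))] the bound [9 * e * L ^+ 2] is at most [m / 2], which a
   positive [m] cannot respect. *)
have L2 : 0 < 18 * (L ^+ 2 + 1) by have := sqr_ge0 L; lra.
have := small _ (divr_gt0 mu0 L2).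
set m := cmod _ in mu0 *.
have -> : 9 * (m / (18 * (L ^+ 2 + 1))) * L ^+ 2 = m * (L ^+ 2 / (L ^+ 2 + 1)) / 2.
  by field; have := sqr_ge0 L; rewrite gt_eqF//; lra.
have : L ^+ 2 / (L ^+ 2 + 1) <= 1 by rewrite ler_pdivrMr; have := sqr_ge0 L; lra.
by nra.
Qed.

End Triangle.

Theorem goursat (f : C -> C) (a b c : C) :
  (forall x y, 0 <= x -> 0 <= y -> x + y <= 1 ->
     exists l, cder f (a + ofR x * (b - a) + ofR y * (c - a)) l) ->
  tri_int f a b c = 0.
Proof.
move=> fd.
have := @goursat_bary f a b c.
have -> : a + ofR 0 * (b - a) + ofR 0 * (c - a) = a by rewrite ofR0; ring.
have -> : a + ofR (0 + 1) * (b - a) + ofR 0 * (c - a) = b by rewrite add0r ofR0 ofR1; ring.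
have -> : a + ofR 0 * (b - a) + ofR (0 + 1) * (c - a) = c by rewrite add0r ofR0 ofR1; ring.
apply.
- by move=> x y [x0 y0 xy]; have [l /cder_cvg] := fd x y x0 y0 xy.
- by move=> x y [x0 y0 xy]; exact: fd.
Qed.

End Goursat.

(** * Primitives on star-shaped domains and punctured discs *)

Section Primitives.
Variable R : realType.
Local Notation C := (C R).
Implicit Types (t x y s e d : R) (z w l k a b c u v : C) (f F : C -> C).

Lemma seg_dist a b t : unit_itv t -> cmod (seg a b t - a) <= cmod (b - a).
Proof.
move=> /andP[t0 t1]; have -> : seg a b t - a = ofR t * (b - a) by rewrite /seg; ring.
by rewrite cmodM cmod_ofR ger0_norm// ler_piMl// cmod_ge0.
Qed.

(** The vanishing triangle integral turns the increment of [seg_int f w] from z to v into the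
    integral of [f] over the short segment from z to v, which is compared with the integral of the
    constant [f z]. *)
Lemma seg_int_cder f w z d : 0 < d ->
  (forall v, cmod (v - z) < d ->
    [/\ continuous_on_seg f w v, f @ v --> f v & tri_int f w z v = 0]) ->
  cder (seg_int f w) z (f z).
Proof.
move=> d0 H; apply/derP => e e0.
have [cz fz _] : [/\ continuous_on_seg f w z, f @ z --> f z & tri_int f w z z = 0].
  by apply: H; rewrite subrr cmod0.
have /cvgCP/(_ e e0)/nbhsCP[d1 d10 fe] := fz.
apply/nbhsCP; exists (Num.min d d1); first by rewrite lt_min d0.
move=> v; rewrite lt_min => /andP[vd vd1].
have [cv fv T] := H v vd.
have cseg : continuous_on_seg f z v.
  move=> t t01; have [] // := H (seg z v t).
  exact: le_lt_trans (seg_dist _ _ t01) vd.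
have -> : seg_int f w v - seg_int f w z = seg_int f z v.
  move: T; rewrite /tri_int (seg_int_rev cv) => /eqP.
  by rewrite subr_eq0 => /eqP <-; ring.
have I2 : is_seg_int (fun=> f z) z v (f z * v - f z * z).
  apply: is_seg_int_primitive => t _; rewrite -[X in cder _ _ X]mulr1.
  by apply: cderZ; exact: cder_id.
have := is_seg_int_bound (is_seg_intB (seg_intP cseg) I2).
rewrite -mulrBr => /(_ e) B.
rewrite -[id v]/v -[id z]/z [e * _]mulrC.
apply: B => t t01; apply: ltW; apply: fe.
exact: le_lt_trans (seg_dist _ _ t01) vd1.
Qed.

(** The hypothesis is star shape about [w] in the form that Goursat's lemma consumes: for v near z
    the whole triangle w, z, v lies in [U], not only the segments from [w]. *)
Lemma star_primitive (U : C -> Prop) w f :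
  (forall z, U z -> exists2 d, 0 < d & forall v, cmod (v - z) < d ->
    forall x y, 0 <= x -> 0 <= y -> x + y <= 1 ->
    U (w + ofR x * (z - w) + ofR y * (v - w))) ->
  (forall z, U z -> exists l, cder f z l) ->
  forall z, U z -> cder (seg_int f w) z (f z).
Proof.
move=> starU fd z Uz; have [d d0 Hd] := starU z Uz.
apply: (seg_int_cder d0) => v vd; have vU := Hd v vd; split.
- move=> t /andP[t0 t1]; have := vU 0 t (lexx _) t0.
  by rewrite add0r ofR0 mul0r addr0 => /(_ t1)/fd[l /cder_cvg].
- have := vU 0 1 (lexx _) ler01; rewrite add0r ofR0 ofR1 mul0r addr0 mul1r subrKC.
  by move=> /(_ (lexx _))/fd[l /cder_cvg].
- by apply: goursat => x y x0 y0 xy; apply: fd; exact: vU.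
Qed.

(** The vertex where differentiability fails is cut off by the small triangle
    with vertices [a], [seg a b r], [seg a c r], over which the bounded function
    [f] has an integral of order [r]. *)
Lemma goursat_vertex f a b c : f @ a --> f a ->
  (forall x y, 0 <= x -> 0 <= y -> x + y <= 1 -> 0 < x + y ->
    exists l, cder f (a + ofR x * (b - a) + ofR y * (c - a)) l) ->
  tri_int f a b c = 0.
Proof.
move=> fa fd.
have fc x y : 0 <= x -> 0 <= y -> x + y <= 1 ->
    f @ (a + ofR x * (b - a) + ofR y * (c - a)) --> f (a + ofR x * (b - a) + ofR y * (c - a)).
  move=> x0 y0 xy; have [xy0|xy0] := ltP 0 (x + y).
    by have [l /cder_cvg] := fd x y x0 y0 xy xy0.
  have -> : x = 0 by lra.
  have -> : y = 0 by lra.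
  by rewrite ofR0 !mul0r !addr0.
have cseg x y x' y' u v : 0 <= x -> 0 <= y -> x + y <= 1 ->
    0 <= x' -> 0 <= y' -> x' + y' <= 1 ->
    u = a + ofR x * (b - a) + ofR y * (c - a) ->
    v = a + ofR x' * (b - a) + ofR y' * (c - a) -> continuous_on_seg f u v.
  move=> x0 y0 xy x0' y0' xy' -> -> t /andP[t0 t1].
  have -> : seg (a + ofR x * (b - a) + ofR y * (c - a))
      (a + ofR x' * (b - a) + ofR y' * (c - a)) t =
      a + ofR (x + t * (x' - x)) * (b - a) + ofR (y + t * (y' - y)) * (c - a).
    by rewrite /seg !ofRD !ofRM !ofRB; ring.
  by apply: fc; nra.
(* The segment from [seg a b r] to [c] splits the rest of the triangle into two triangles that avoid
   [a], to which [goursat] applies. *)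
have cut r : 0 < r -> r <= 1 ->
    tri_int f a b c = tri_int f a (seg a b r) (seg a c r).
  move=> r0 r1; have r01 : unit_itv r by rewrite /unit_itv ltW.
  have pE : seg a b r = a + ofR r * (b - a) + ofR 0 * (c - a) by rewrite /seg ofR0; ring.
  have qE : seg a c r = a + ofR 0 * (b - a) + ofR r * (c - a) by rewrite /seg ofR0; ring.
  have aE : a = a + ofR 0 * (b - a) + ofR 0 * (c - a) by rewrite ofR0; ring.
  have bE : b = a + ofR 1 * (b - a) + ofR 0 * (c - a) by rewrite ofR0 ofR1; ring.
  have cE : c = a + ofR 0 * (b - a) + ofR 1 * (c - a) by rewrite ofR0 ofR1; ring.
  have T1 : tri_int f (seg a b r) b c = 0.
    apply: goursat => x y x0 y0 xy.
    have -> : seg a b r + ofR x * (b - seg a b r) + ofR y * (c - seg a b r) =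
        a + ofR (r * (1 - x - y) + x) * (b - a) + ofR y * (c - a).
      by rewrite /seg ofRD ofRM !ofRB ofR1; ring.
    by apply: fd; nra.
  have T2 : tri_int f (seg a b r) c (seg a c r) = 0.
    apply: goursat => x y x0 y0 xy.
    have -> : seg a b r + ofR x * (c - seg a b r) + ofR y * (seg a c r - seg a b r) =
        a + ofR (r * (1 - x - y)) * (b - a) + ofR (x + y * r) * (c - a).
      by rewrite /seg ofRD !ofRM !ofRB ofR1; ring.
    by apply: fd; nra.
  have cab : continuous_on_seg f a b by apply: (cseg _ _ _ _ _ _ _ _ _ _ _ _ aE bE); lra.
  have cac : continuous_on_seg f a c by apply: (cseg _ _ _ _ _ _ _ _ _ _ _ _ aE cE); lra.
  have cpc : continuous_on_seg f (seg a b r) c.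
    by apply: (cseg _ _ _ _ _ _ _ _ _ _ _ _ pE cE); lra.
  have cpq : continuous_on_seg f (seg a b r) (seg a c r).
    by apply: (cseg _ _ _ _ _ _ _ _ _ _ _ _ pE qE); lra.
  have caq : continuous_on_seg f a (seg a c r).
    by apply: (cseg _ _ _ _ _ _ _ _ _ _ _ _ aE qE); lra.
  have cqc : continuous_on_seg f (seg a c r) c.
    by apply: (cseg _ _ _ _ _ _ _ _ _ _ _ _ qE cE); lra.
  rewrite -[LHS]subr0 -T1 -[RHS]addr0 -[X in _ = _ + X]T2 /tri_int.
  rewrite (seg_int_split r01 cab) (seg_int_rev cac) (seg_int_split r01 cac).
  rewrite (seg_int_rev cpc) (seg_int_rev cpq) (seg_int_rev caq) (seg_int_rev cqc).
  by move: (seg_int f _ _) => ?; ring.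
have /cvgCP/(_ 1 ltr01)/nbhsCP[d d0 Hd] := fa.
pose M := cmod (f a) + 1; have M0 : 0 < M by rewrite ltr_wpDl ?cmod_ge0.
have fM v : cmod (v - a) < d -> cmod (f v) <= M.
  move=> /Hd/ltW; rewrite /M -lerBlDl; apply: le_trans.
  by rewrite lerBlDl -{1}[f v](subrKC (f a)) cmodD.
pose L := cmod (b - a) + cmod (c - a) + 1.
have b0 := cmod_ge0 (b - a); have c0 := cmod_ge0 (c - a).
have L0 : 0 < L by rewrite /L; lra.
apply/eqP; rewrite -cmod_eq0 eq_le cmod_ge0 andbT leNgt; apply/negP => T0.
have LM0 : 0 < 3 * L * M by rewrite !mulr_gt0.
(* Ratio below [d / L] keeps the small triangle where [M] bounds [f]; the last bound makes its three
   edges, of at most [r * L * M] each, contribute less than the supposed integral. *)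
have [|n] := @half_small R (Num.min 1 (Num.min (d / L) (cmod (tri_int f a b c) / (3 * L * M)))).
  by rewrite !lt_min ltr01 !divr_gt0.
set r := 2^-1 ^+ n; rewrite !lt_min !ltr_pdivlMr// => /and3P[r1 rd rT].
have r0 : 0 < r := half_gt0 R n.
suff : cmod (tri_int f a (seg a b r) (seg a c r)) <= r * (3 * L * M).
  by rewrite -cut// ?(ltW r1)// leNgt rT.
have edge x y x' y' u v : 0 <= x -> 0 <= y -> x <= r -> y <= r ->
    0 <= x' -> 0 <= y' -> x' <= r -> y' <= r -> x + y <= r -> x' + y' <= r ->
    u = a + ofR x * (b - a) + ofR y * (c - a) ->
    v = a + ofR x' * (b - a) + ofR y' * (c - a) -> cmod (seg_int f u v) <= r * L * M.
  move=> x0 y0 xr yr x0' y0' xr' yr' xyr xyr' uE vE.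
  have xy1 : x + y <= 1 by lra.
  have xy1' : x' + y' <= 1 by lra.
  have cuv := cseg _ _ _ _ _ _ x0 y0 xy1 x0' y0' xy1' uE vE.
  have := is_seg_int_bound (seg_intP cuv) => /(_ M) B.
  apply: le_trans (B _) _ => [t /andP[t0 t1]|].
    apply: fM; rewrite uE vE.
    have -> : seg (a + ofR x * (b - a) + ofR y * (c - a))
        (a + ofR x' * (b - a) + ofR y' * (c - a)) t - a =
        ofR (x + t * (x' - x)) * (b - a) + ofR (y + t * (y' - y)) * (c - a).
      by rewrite /seg !ofRD !ofRM !ofRB; ring.
    have X0 : 0 <= x + t * (x' - x) by nra.
    have X1 : x + t * (x' - x) <= r by nra.
    have Y0 : 0 <= y + t * (y' - y) by nra.
    have Y1 : y + t * (y' - y) <= r by nra.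
    apply: le_lt_trans (cmodD _ _) _; rewrite !cmodM !cmod_ofR !ger0_norm//.
    by apply: le_lt_trans rd; rewrite /L; nra.
  apply: ler_wpM2r; first exact: ltW.
  have -> : v - u = ofR (x' - x) * (b - a) + ofR (y' - y) * (c - a).
    by rewrite uE vE !ofRB; ring.
  apply: le_trans (cmodD _ _) _; rewrite !cmodM !cmod_ofR.
  have X1 : `|x' - x| <= r by rewrite ler_norml; apply/andP; split; lra.
  have Y1 : `|y' - y| <= r by rewrite ler_norml; apply/andP; split; lra.
  by rewrite /L; nra.
have pE : seg a b r = a + ofR r * (b - a) + ofR 0 * (c - a) by rewrite /seg ofR0; ring.
have qE : seg a c r = a + ofR 0 * (b - a) + ofR r * (c - a) by rewrite /seg ofR0; ring.
have aE : a = a + ofR 0 * (b - a) + ofR 0 * (c - a) by rewrite ofR0; ring.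
have E1 : cmod (seg_int f a (seg a b r)) <= r * L * M.
  by apply: (edge _ _ _ _ _ _ _ _ _ _ _ _ _ _ _ _ aE pE); lra.
have E2 : cmod (seg_int f (seg a b r) (seg a c r)) <= r * L * M.
  by apply: (edge _ _ _ _ _ _ _ _ _ _ _ _ _ _ _ _ pE qE); lra.
have E3 : cmod (seg_int f (seg a c r) a) <= r * L * M.
  by apply: (edge _ _ _ _ _ _ _ _ _ _ _ _ _ _ _ _ qE aE); lra.
rewrite /tri_int; apply: le_trans (cmodD _ _) _.
have -> : r * (3 * L * M) = r * L * M + r * L * M + r * L * M by ring.
by apply: lerD => //; apply: le_trans (cmodD _ _) _; exact: lerD.
Qed.

Lemma disc_conv a (r : R) w z v x y : cmod (w - a) < r -> cmod (z - a) < r ->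
  cmod (v - a) < r -> 0 <= x -> 0 <= y -> x + y <= 1 ->
  cmod (w + ofR x * (z - w) + ofR y * (v - w) - a) < r.
Proof.
move=> wr zr vr x0 y0 xy.
have -> : w + ofR x * (z - w) + ofR y * (v - w) - a =
    ofR (1 - x - y) * (w - a) + ofR x * (z - a) + ofR y * (v - a).
  by rewrite !ofRB ofR1; ring.
apply: le_lt_trans (cmodD _ _) _; apply: le_lt_trans (lerD (cmodD _ _) (lexx _)) _.
rewrite !cmodM !cmod_ofR !ger0_norm//; last by lra.
pose m := Num.max (cmod (w - a)) (Num.max (cmod (z - a)) (cmod (v - a))).
have mr : m < r by rewrite !gt_max wr zr vr.
have m1 : cmod (w - a) <= m by rewrite le_max lexx.
have m2 : cmod (z - a) <= m by rewrite !le_max lexx orbT.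
have m3 : cmod (v - a) <= m by rewrite !le_max lexx !orbT.
apply: le_lt_trans mr; move: (cmod (w - a)) (cmod (z - a)) (cmod (v - a)) m1 m2 m3.
by move=> p q s p1 q1 s1; have xy' : 0 <= 1 - x - y; [lra|nra].
Qed.

(** Made for the difference quotient of Cauchy's formula. When v is closer to z than [w] is, the
    triangle w, z, v meets [w] only in its vertex, because the modulus of
    [(x + y)(z - w) + y(v - z)] is positive for [x + y > 0]; so [goursat_vertex] applies. *)
Lemma disc_primitive_punctured a (r : R) w f : cmod (w - a) < r -> f @ w --> f w ->
  (forall z, cmod (z - a) < r -> z != w -> exists l, cder f z l) ->
  forall z, cmod (z - a) < r -> z != w -> cder (seg_int f w) z (f z).
Proof.
move=> wr fw fd z zr zw.
have zw0 : 0 < cmod (z - w) by rewrite cmod_gt0 subr_eq0.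
apply: (@seg_int_cder f w z (Num.min (r - cmod (z - a)) (cmod (z - w)))).
  by rewrite lt_min zw0 subr_gt0 zr.
move=> v; rewrite lt_min ltrBrDr => /andP[vz vzw].
have vr : cmod (v - a) < r.
  by apply: le_lt_trans vz; rewrite -[v - a](subrKA z) cmodD.
have vertex x y : 0 <= x -> 0 <= y -> x + y <= 1 -> 0 < x + y ->
    exists l, cder f (w + ofR x * (z - w) + ofR y * (v - w)) l.
  move=> x0 y0 xy xy0; apply: fd; first exact: disc_conv.
  rewrite -subr_eq0 -cmod_gt0.
  have -> : w + ofR x * (z - w) + ofR y * (v - w) - w =
      ofR (x + y) * (z - w) + ofR y * (v - z) by rewrite ofRD; ring.
  have := cmodB (ofR (x + y) * (z - w) + ofR y * (v - z)) (ofR y * (v - z)).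
  rewrite addrK !cmodM !cmod_ofR !ger0_norm//; last by lra.
  move: (cmod (v - z)) (cmod (z - w)) (cmod (_ * _ + _)) zw0 vzw => q p m p0 qp H.
  apply: (@lt_le_trans _ _ ((x + y) * p - y * q)); last by rewrite lerBlDr.
  rewrite mulrDl -addrA -mulrBr; have [y0'|y0'] := ltP 0 y.
    by rewrite ltr_wpDl ?mulr_gt0 ?subr_gt0// mulr_ge0// ltW.
  have xp : 0 < x by lra.
  apply: ltr_pwDl; first exact: mulr_gt0.
  by apply: mulr_ge0 => //; rewrite subr_ge0 ltW.
split.
- move=> t /andP[t0 t1]; have [->|tn0] := eqVneq t 0; first by rewrite seg0.
  have tp : 0 < t by rewrite lt_def tn0.
  have := vertex 0 t (lexx _) t0; rewrite add0r ofR0 mul0r addr0.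
  by move=> /(_ t1 tp)[l /cder_cvg].
- have := vertex 0 1 (lexx _) ler01; rewrite add0r ofR0 ofR1 mul0r addr0 mul1r subrKC.
  by move=> /(_ (lexx _) ltr01)[l /cder_cvg].
- exact: goursat_vertex.
Qed.

End Primitives.

(** * Exponential, logarithm and powers *)

Section ExpLog.
Variable R : realType.
Local Notation C := (C R).
Implicit Types (t x y e : R) (z w l k a b : C).

Lemma cexpD z w : cexp (z + w) = cexp z * cexp w.
Proof.
rewrite /cexp RecD ImcD expRD ofRM cosD sinD.
by apply: complex_ext; rewrite !(RecM, ImcM) /Rec /Imc /=; ring.
Qed.

Lemma cexp0 : cexp (0 : C) = 1.
Proof.
by rewrite /cexp /Rec /Imc /= expR0 cos0 sin0 ofR1 mul1r; exact: complex_ext.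
Qed.

Lemma cexp_neq0 z : cexp z != 0.
Proof.
have E : cexp z * cexp (- z) = 1 by rewrite -cexpD subrr cexp0.
by apply: contra_eq_neq E => ->; rewrite mul0r eq_sym oner_neq0.
Qed.

Lemma cexpN z : cexp (- z) = (cexp z)^-1.
Proof.
by apply: (mulfI (cexp_neq0 z)); rewrite -cexpD subrr cexp0 mulfV ?cexp_neq0.
Qed.

Lemma cexpMn z n : cexp (n%:R * z) = cexp z ^+ n.
Proof.
elim: n => [|n IH]; first by rewrite mul0r cexp0 expr0.
by rewrite -natr1 mulrDl mul1r cexpD IH exprSr.
Qed.

Let cis y : C := ofR (cos y) + iC R * ofR (sin y).

Let cexpE z : cexp z = ofR (expR (Rec z)) * cis (Imc z).
Proof.
rewrite /cexp; congr (_ * _); rewrite /cis.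
by apply: complex_ext; rewrite !(RecD, ImcD, RecM, ImcM) /Rec /Imc /=; ring.
Qed.

Let near_ofR (P : R -> Prop) : (\forall t \near (0 : R), P t) ->
  exists2 d, 0 < d & forall t, `|t| < d -> P t.
Proof.
move=> /nbhs_ballP[d /= d0 H]; exists d => // t td.
by apply: H; rewrite /ball /= sub0r normrN.
Qed.

Let rder_expR0 : rder (fun t => ofR (expR t) : C) 0 1.
Proof.
have := @is_derive_rder R expR 0 (expR 0); rewrite expR0 ofR1; apply.
by rewrite -[X in is_derive _ _ _ X]expR0; exact: is_derive_expR.
Qed.

Let rder_cis0 : rder cis 0 (iC R).
Proof.
have -> : iC R = ofR (- sin 0) + iC R * ofR (cos 0).
  by rewrite sin0 oppr0 cos0 ofR1 mulr1 ofR0 add0r.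
apply: derD; first exact: (is_derive_rder (is_derive_cos 0)).
by apply: rderZ; exact: (is_derive_rder (is_derive_sin 0)).
Qed.

Let cder_cexp0 : cder (@cexp R) 0 1.
Proof.
apply/derP => e e0.
pose e1 := Num.min 1 (e / 3).
have e10 : 0 < e1 by rewrite lt_min ltr01 divr_gt0.
have e11 : e1 <= 1 by rewrite ge_min lexx.
have e13 : e1 <= e / 3 by rewrite ge_min lexx orbT.
have /derP/(_ e1 e10)/near_ofR[d1 d10 H1] := rder_expR0.
have /derP/(_ e1 e10)/near_ofR[d2 d20 H2] := rder_cis0.
(* The two first-order errors are at most [e / 3] times |h| each, and the product term [4 * |h|^2]
   is at most [e / 3] times |h| once |h| < [e / 12]. *)
apply/nbhsCP; exists (Num.min (e / 12) (Num.min d1 d2)).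
  by rewrite !lt_min d10 d20 divr_gt0.
move=> h; rewrite subr0 !lt_min => /and3P[he hd1 hd2].
have xh := Rec_le_cmod h; have yh := Imc_le_cmod h.
have := H1 (Rec h) (le_lt_trans xh hd1).
have := H2 (Imc h) (le_lt_trans yh hd2).
rewrite cexp0 ofR0 !subr0 expR0 ofR1 {2}/cis cos0 sin0 ofR1 ofR0 mulr0 addr0 !mul1r.
rewrite !cmod_ofR cexpE; set A := ofR (expR _); set E := cis _.
set x : C := ofR (Rec h); set y : C := ofR (Imc h) => HE HA.
have hE : h = x + iC R * y := complexE h.
have -> : A * E - 1 - id h = (A - 1 - x) + (E - 1 - iC R * y) + (A - 1) * (E - 1).
  by rewrite {1}hE /=; ring.
have cx : cmod x = `|Rec h| by rewrite cmod_ofR.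
have cy : cmod (iC R * y) = `|Imc h| by rewrite cmodM cmod_iC mul1r cmod_ofR.
have A1 : cmod (A - 1) <= 2 * `|Rec h|.
  have := cmodD (A - 1 - x) x; rewrite subrK cx => B.
  by apply: (le_trans B); have := normr_ge0 (Rec h); nra.
have E1 : cmod (E - 1) <= 2 * `|Imc h|.
  have := cmodD (E - 1 - iC R * y) (iC R * y); rewrite subrK cy => B.
  by apply: (le_trans B); have := normr_ge0 (Imc h); nra.
apply: le_trans (cmodD _ _) _; rewrite cmodM.
have AE : cmod (A - 1) * cmod (E - 1) <= 4 * (cmod h * cmod h).
  have -> : 4 * (cmod h * cmod h) = (2 * cmod h) * (2 * cmod h) by ring.
  by apply: ler_pM; rewrite ?cmod_ge0//; [apply: (le_trans A1)|apply: (le_trans E1)];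
     rewrite ler_pM2l.
have T := cmodD (A - 1 - x) (E - 1 - iC R * y).
have h0 := cmod_ge0 h.
apply: (@le_trans _ _ (e1 * cmod h + e1 * cmod h + 4 * (cmod h * cmod h))).
  apply: lerD => //; apply: (le_trans T); apply: lerD.
    by apply: le_trans HA _; rewrite ler_pM2l.
  by apply: le_trans HE _; rewrite ler_pM2l.
by rewrite /=; move: (cmod h) h0 he => m m0 me; nra.
Qed.

Lemma cder_cexp z : cder (@cexp R) z (cexp z).
Proof.
have H : cder (fun w => cexp z * cexp (w - z)) z (cexp z * (1 * (1 - 0))).
  apply: cderZ; apply: cder_comp; first by rewrite subrr; exact: cder_cexp0.
  by apply: cderB; [exact: cder_id|exact: cder_cst].
rewrite subr0 !mulr1 in H; apply: cder_near H.
by near=> w; rewrite -cexpD subrKC.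
Unshelve. all: by end_near. Qed.

(** The complement of the ray of reals <= 0, written as positivity of the denominator in the
    half-angle formula of [Arg]; in this form it is visibly open. *)
Definition slit z : Prop := 0 < cmod z + Rec z.

Lemma slitP z : slit z <-> ~ (Imc z = 0 /\ Rec z <= 0).
Proof.
have sq := cmod_sqr z; have c0 := cmod_ge0 z.
split=> [zs [i0 r0]|H]; rewrite /slit.
  rewrite i0 [0 ^+ 2]expr0n addr0 in sq.
  have : cmod z = - Rec z.
    by apply/eqP; rewrite -(@eqrXn2 _ 2)// ?sqrrN ?sq// oppr_ge0.
  by move: zs; rewrite /slit => /[swap] ->; rewrite addNr ltxx.
rewrite lt_neqAle eq_sym addrC; have := Rec_le_cmod z.
rewrite ler_norml => /andP[r1 r2]; apply/andP; split; last by lra.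
apply/eqP => E; apply: H; have rE : cmod z = - Rec z by lra.
split; last by lra.
by move: sq; rewrite rE sqrrN => /eqP; rewrite -subr_eq0 opprD addNKr oppr_eq0 sqrf_eq0 => /eqP.
Qed.

Lemma slit_neq0 z : slit z -> z != 0.
Proof. by apply: contraPneq => ->; rewrite /slit cmod0 addr0 ltxx. Qed.

Lemma cut_plane_slit z : cut_plane z -> slit z.
Proof. by move=> zc; apply/slitP => -[i0 r0]; apply: zc; split=> //; left. Qed.

Lemma slit_near z : slit z -> \forall w \near z, slit w.
Proof.
have c : (fun w => cmod w + Rec w) @ z --> cmod z + Rec z.
  exact: (cvgD (@continuous_cmod R z) (@continuous_Rec R z)).
move=> zs; have /cvgrPdist_lt/(_ _ zs) := c; apply: filterS => w.
by rewrite ltr_norml /slit => /andP[_]; lra.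
Qed.

Lemma Arg_slit z : slit z -> Arg z = 2 * atan (Imc z / (cmod z + Rec z)).
Proof.
move=> /slitP H; rewrite /Arg; case: ifP => // /andP[/eqP i0 r0].
by exfalso; apply: H; split=> //; exact: ltW.
Qed.

(** With [u] the tangent of half the argument, [1 + u ^+ 2 = 2 * cmod z / (cmod z + Rec z)], and the
    double-angle formulas give [Rec z / cmod z] and [Imc z / cmod z]. *)
Lemma cexp_Log z : slit z -> cexp (Log z) = z.
Proof.
move=> zs; have zn0 := slit_neq0 zs; have r0 : 0 < cmod z by rewrite cmod_gt0.
have rL : Rec (Log z) = ln (cmod z).
  by rewrite /Log RecD RecM /Rec /Imc /=; ring.
have iL : Imc (Log z) = Arg z.
  by rewrite /Log ImcD ImcM /Rec /Imc /=; ring.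
rewrite cexpE rL iL lnK ?posrE// Arg_slit//; move: zs; rewrite /slit.
set p := cmod z + Rec z; set u := Imc z / p => p0.
have sq := cmod_sqr z.
have pn0 : p != 0 by rewrite gt_eqF.
have rn0 : cmod z != 0 by rewrite gt_eqF.
have u1 : 1 + u ^+ 2 = 2 * cmod z / p.
  rewrite /u expr_div_n; apply: (mulfI (expf_neq0 2 pn0)).
  rewrite mulrDr mulr1 mulrCA mulfV ?expf_neq0// mulr1.
  have -> : p ^+ 2 * (2 * cmod z / p) = p * (2 * cmod z) by field.
  by have := sq; rewrite /p; nra.
have u2 : 1 + u ^+ 2 != 0 by rewrite u1 mulf_neq0 ?invr_neq0// mulf_neq0.
have ca2 : cos (atan u) ^+ 2 = (1 + u ^+ 2)^-1.
  by rewrite cos_atan exprVn sqr_sqrtr// addr_ge0 ?sqr_ge0.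
have ca0 : cos (atan u) != 0 by rewrite gt_eqF// cos_gt0_pihalf// atan_gtNpi2 atan_ltpi2.
have sa : sin (atan u) = u * cos (atan u).
  by rewrite -{2}[u]atanK /tan mulfVK.
have c2 : cos (2 * atan u) = Rec z / cmod z.
  rewrite mulr_natl mulr2n cosD sa.
  have -> : cos (atan u) * cos (atan u) - u * cos (atan u) * (u * cos (atan u))
     = (1 - u ^+ 2) * cos (atan u) ^+ 2 by ring.
  have -> : 1 - u ^+ 2 = 2 - (1 + u ^+ 2) by ring.
  by rewrite ca2 u1 /p; field; rewrite rn0.
have s2 : sin (2 * atan u) = Imc z / cmod z.
  rewrite mulr_natl mulr2n sinD sa.
  have -> : u * cos (atan u) * cos (atan u) + cos (atan u) * (u * cos (atan u))
     = 2 * u * cos (atan u) ^+ 2 by ring.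
  by rewrite ca2 u1 /u; field; rewrite rn0.
apply: complex_ext; rewrite /cis c2 s2 !(RecM, ImcM, RecD, ImcD) /Rec /Imc /= -/(Rec z) -/(Imc z).
  by field.
by field.
Qed.

Lemma cvg_nearC (f g : C -> C) z l :
  (\forall w \near z, f w = g w) -> f @ z --> l -> g @ z --> l.
Proof.
move=> fg fl A Al; have Hf : \forall w \near z, A (f w) := fl A Al.
have : \forall w \near z, A (g w).
  near=> w; have <- : f w = g w by near: w.
  by near: w.
by [].
Unshelve. all: by end_near. Qed.

Lemma Log_cvg z : slit z -> (@Log R) @ z --> Log z.
Proof.
move=> zs; have r0 : 0 < cmod z by rewrite cmod_gt0 slit_neq0.
have lnc : (fun w => ofR (ln (cmod w)) : C) @ z --> ofR (ln (cmod z)).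
  have H1 : (fun w => ln (cmod w)) @ z --> ln (cmod z).
    exact: (@cvg_comp _ _ _ (@cmod R) (@ln R) _ _ _ (@continuous_cmod R z) (continuous_ln r0)).
  exact: (@cvg_comp _ _ _ (fun w => ln (cmod w)) (@ofR R) _ _ _ H1 (@continuous_ofR R _)).
pose q (w : C) : R := Imc w / (cmod w + Rec w).
have qc : q @ z --> q z.
  have c2 : (fun w => cmod w + Rec w) @ z --> cmod z + Rec z.
    exact: (cvgD (@continuous_cmod R z) (@continuous_Rec R z)).
  have c3 : (fun w => (cmod w + Rec w)^-1) @ z --> (cmod z + Rec z)^-1.
    have nz : cmod z + Rec z != 0 by rewrite gt_eqF.
    exact: (cvgV nz c2).
  exact: (cvgM (@continuous_Imc R z) c3).
have argc : (fun w => ofR (2 * atan (q w)) : C) @ z --> ofR (2 * atan (q z)).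
  have H1 : (fun w => atan (q w)) @ z --> atan (q z).
    exact: (@cvg_comp _ _ _ q (@atan R) _ _ _ qc (@continuous_atan R _)).
  have H2 : (fun w => 2 * atan (q w)) @ z --> 2 * atan (q z).
    exact: (cvgM (@cvg_cst _ (2 : R) _ (nbhs z) _) H1).
  exact: (@cvg_comp _ _ _ (fun w => 2 * atan (q w)) (@ofR R) _ _ _ H2 (@continuous_ofR R _)).
have H : (fun w => ofR (ln (cmod w)) + iC R * ofR (2 * atan (q w)) : C) @ z -->
    ofR (ln (cmod z)) + iC R * ofR (2 * atan (q z)).
  exact: (ccvgD lnc (ccvgM (ccvg_cst (k := iC R)) argc)).
have -> : Log z = ofR (ln (cmod z)) + iC R * ofR (2 * atan (q z)).
  by rewrite /Log Arg_slit.
refine (@cvg_nearC _ _ _ _ _ H); have ns := slit_near zs.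
near=> w; have ws : slit w by near: w.
by rewrite /Log Arg_slit.
Unshelve. all: by end_near. Qed.

(** Derivative of an inverse function: the Caratheodory slope of [cexp] at [Log z], composed with
    the continuous [Log] and inverted, is a slope of [Log]. *)
Lemma cder_Log z : slit z -> cder (@Log R) z z^-1.
Proof.
move=> zs; have Lc := Log_cvg zs.
have [phi [phic phiE Hphi]] := cder_cexp (Log z).
rewrite cexp_Log// in phiE Hphi.
have pc : (fun w => phi (Log w)) @ z --> phi (Log z).
  exact: (@cvg_comp _ _ _ (@Log R) phi _ _ _ Lc phic).
have pn0 : phi (Log z) != 0 by rewrite phiE slit_neq0.
exists (fun w => (phi (Log w))^-1); split; [exact: (ccvgV pn0 pc)|by rewrite phiE|].
have nz : \forall w \near z, phi (Log w) != 0.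
  have : 0 < cmod (phi (Log z)) by rewrite cmod_gt0.
  move: pc => /cvgCP /[apply]; apply: filterS => s; apply: contraTneq => ->.
  by rewrite sub0r cmodN ltxx.
have H2 : \forall w \near z, cexp (Log w) = z + (id (Log w) - id (Log z)) * phi (Log w) := Lc _ Hphi.
have ns := slit_near zs.
near=> w.
have n0 : phi (Log w) != 0 by near: w.
have ws : slit w by near: w.
have : cexp (Log w) = z + (id (Log w) - id (Log z)) * phi (Log w) by near: w.
rewrite cexp_Log// => E.
have wz : id w - id z = (Log w - Log z) * phi (Log w).
  by apply: (addrI z); rewrite -E subrKC.
by rewrite wz mulfK// subrKC.
Unshelve. all: by end_near. Qed.

Lemma cpowD z a b : cpow z (a + b) = cpow z a * cpow z b.
Proof. by rewrite /cpow mulrDl cexpD. Qed.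
Lemma cpow_neq0 z a : cpow z a != 0. Proof. exact: cexp_neq0. Qed.
Lemma cpow0 z : cpow z 0 = 1. Proof. by rewrite /cpow mul0r cexp0. Qed.
Lemma cpow_nat z n : slit z -> cpow z n%:R = z ^+ n.
Proof. by move=> zs; rewrite /cpow cexpMn cexp_Log. Qed.
Lemma cpow1 z : slit z -> cpow z 1 = z.
Proof. by move=> zs; rewrite -[1]/(1%:R) cpow_nat. Qed.
Lemma cpowN z a : cpow z (- a) = (cpow z a)^-1.
Proof. by rewrite /cpow mulNr cexpN. Qed.

Lemma cder_cpow z a : slit z -> cder (fun w => cpow w a) z (a * cpow z (a - 1)).
Proof.
move=> zs; have -> : a * cpow z (a - 1) = cexp (a * Log z) * (a * z^-1).
  by rewrite cpowD cpowN cpow1// /cpow; ring.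
apply: (@cder_comp R (@cexp R)); first exact: cder_cexp.
by apply: cderZ; exact: cder_Log.
Qed.

Lemma Log_ofR x : 0 < x -> Log (ofR x) = ofR (ln x) :> C.
Proof.
move=> x0; have c : cmod (ofR x : C) = x by rewrite cmod_ofR gtr0_norm.
rewrite /Log Arg_slit ?c; last by rewrite /slit c Rec_ofR addr_gt0.
by rewrite Imc_ofR mul0r atan0 mulr0 ofR0 mulr0 addr0.
Qed.

Definition twopii : C := iC R * ofR (2 * pi).

Lemma cexp_twopii : cexp twopii = 1.
Proof.
rewrite cexpE /twopii RecM ImcM /= !(mul0r, mulr0, subr0, mul1r, add0r, oppr0).
by rewrite expR0 /cis mulr_natl cos2pi sin2pi ofR1 ofR0 !(mul1r, mulr0, mulr1, addr0).
Qed.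

Lemma twopii_neq0 : twopii != 0.
Proof.
rewrite /twopii mulf_neq0//; first by rewrite -cmod_eq0 cmod_iC oner_neq0.
by rewrite ofR_eq0 gt_eqF// mulr_gt0// pi_gt0.
Qed.

End ExpLog.

(** * Cauchy's formula and the identity theorem *)

Section CauchyFormula.
Variable R : realType.
Local Notation C := (C R).
Implicit Types (t x y e d : R) (z w l k a b h u v : C) (f F : C -> C).

Lemma path_bounded (g : R -> C) : (forall t, unit_itv t -> g @ t --> g t) ->
  exists2 M, 0 <= M & forall t, unit_itv t -> cmod (g t) <= M.
Proof.
move=> gc.
have [|c c01 H] := @EVT_max R (fun t => cmod (g t)) 0 1 ler01.
  apply: continuous_in_subspaceT => t; rewrite inE /= in_itv /= => t01.
  exact: (@cvg_comp _ _ _ g (@cmod R) _ _ _ (gc t t01) (@continuous_cmod R (g t))).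
exists (cmod (g c)); first exact: cmod_ge0.
by move=> t t01; apply: H; rewrite in_itv.
Qed.

Lemma cmod_cexp z : cmod (cexp z) = expR (Rec z).
Proof.
apply/eqP; rewrite -(@eqrXn2 _ 2)// ?cmod_ge0 ?expR_ge0// cmod_sqr.
rewrite /cexp RecM ImcM /Rec /Imc /= !mul0r subr0 addr0 !exprMn -mulrDr.
by rewrite cos2Dsin2 mulr1.
Qed.

Definition circ a (r : R) t : C := a + ofR r * cexp (twopii R * ofR t).

Section Circle.
Variables (a : C) (r : R).
Hypothesis r0 : 0 < r.
Local Notation om := (circ a r).

Lemma circ_dist t : cmod (om t - a) = r.
Proof.
rewrite /circ addrC addKr cmodM cmod_ofR gtr0_norm// cmod_cexp.
by rewrite /twopii !RecM !ImcM /Rec /Imc /= !(mul0r, mulr0, subr0, mul1r, add0r, oppr0) expR0 mulr1.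
Qed.

Lemma circ_loop : om 1 = om 0.
Proof. by rewrite /circ ofR0 ofR1 mulr0 mulr1 cexp0 cexp_twopii. Qed.

Lemma rder_circ t : rder om t (twopii R * (om t - a)).
Proof.
have -> : twopii R * (om t - a) = 0 + ofR r * (cexp (twopii R * ofR t) * (twopii R * 1)).
  by rewrite /circ; ring.
apply: derD; first exact: der_cst.
apply: rderZ; apply: (@rder_comp R (@cexp R)); first exact: cder_cexp.
by apply: rderZ; exact: der_incl.
Qed.

Lemma circ_cvg t : om @ t --> om t. Proof. exact: rder_cvg (rder_circ t). Qed.

Lemma circ_sub_ge w t : r - cmod (w - a) <= cmod (om t - w).
Proof.
rewrite lerBlDr -{1}(circ_dist t) -[om t - a](subrKA w); exact: cmodD.
Qed.

Lemma circ_sub_neq0 w t : cmod (w - a) < r -> om t - w != 0.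
Proof.
by move=> wr; rewrite -cmod_gt0 (lt_le_trans _ (circ_sub_ge w t))// subr_gt0.
Qed.

(** On the circle [dz / (z - w) = dz / (z - a) / (1 - (w - a) / (z - a))], and the
    denominator has positive real part, so that [Log] of it is a primitive. *)
Lemma circ_winding w : cmod (w - a) < r -> exists P : R -> C,
  (forall t, rder P t ((om t - a) / (om t - w))) /\ P 1 - P 0 = 1.
Proof.
move=> wr.
pose q t : C := 1 - (w - a) * (om t - a)^-1.
have oa t : om t - a != 0 by rewrite -cmod_gt0 circ_dist.
have qs t : slit (q t).
  apply: ltr_wpDl; first exact: cmod_ge0.
  rewrite RecB subr_gt0; have -> : Rec (1 : C) = 1 by [].
  apply: le_lt_trans (ler_norm _) _; apply: le_lt_trans (Rec_le_cmod _) _.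
  by rewrite cmodM cmodV circ_dist ltr_pdivrMr// mul1r.
have qE t : om t - w = (om t - a) * q t.
  by rewrite /q mulrBr mulr1 mulrCA mulfV// mulr1; ring.
have t0 := twopii_neq0 R.
exists (fun t => ofR t + (twopii R)^-1 * Log (q t)); split; last first.
  by rewrite /q circ_loop ofR1 ofR0; ring.
move=> t.
have dq : rder q t ((w - a) * twopii R / (om t - a)).
  have dd : rder (fun s => om s - a) t (twopii R * (om t - a) - 0).
    by apply: rderB; [exact: rder_circ|exact: der_cst].
  have dV : rder (fun s => (om s - a)^-1) t (- (twopii R * (om t - a) - 0) / (om t - a) ^+ 2).
    exact: (@derV R _ (@ofR R) t (@continuous_ofR R t) _ _ (oa t) dd).
  have := rderB (der_cst (@ofR R) t 1) (rderZ (w - a) dV).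
  by congr rder; rewrite subr0; field; exact: oa.
have qn0 := slit_neq0 (qs t).
have -> : (om t - a) / (om t - w) = 1 + (twopii R)^-1 * ((q t)^-1 * ((w - a) * twopii R / (om t - a))).
  have -> : 1 = (om t - w) / (om t - w) by rewrite mulfV// circ_sub_neq0.
  have -> : (om t - w)^-1 = ((om t - a) * q t)^-1 by rewrite -qE.
  by field; rewrite qn0 t0 oa.
apply: derD; first exact: der_incl.
apply: rderZ; apply: rder_comp => //; exact: cder_Log.
Qed.

(** In the parameter t the integrand is f(z) dz / (2 pi i (z - w)). The difference quotient [g] is
    continuous at [w] and holomorphic elsewhere, so it has a primitive [G] off [w], whose increment
    around the circle is 0; what remains is [f w] times the winding integral. *)
Theorem cauchy_formula f (s : R) w : r < s -> cmod (w - a) < r ->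
  (forall z, cmod (z - a) < s -> exists l, cder f z l) ->
  exists P : R -> C,
    (forall t, unit_itv t -> rder P t (f (om t) * ((om t - a) / (om t - w)))) /\
    P 1 - P 0 = f w.
Proof.
move=> rs wr fd; have ws := lt_trans wr rs.
have [fw fwd] := fd w ws.
pose g z := if z == w then fw else (f z - f w) / (z - w).
have gw : g @ w --> g w.
  have [phi [phic phiw Hphi]] := fwd.
  have -> : g w = phi w by rewrite /g eqxx phiw.
  apply: (@cvg_nearC R phi g w (phi w) _ phic).
  near=> z; rewrite /g; case: eqVneq => [->//|zw].
  have -> : f z = f w + (id z - id w) * phi z by near: z.
  by rewrite addrC addKr mulrC mulKf// subr_eq0.
have gd z : cmod (z - a) < s -> z != w -> exists l, cder g z l.
  move=> zs zw; have [l fl] := fd z zs.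
  have zw0 : z - w != 0 by rewrite subr_eq0.
  have dzw : cder (fun u => u - w) z (1 - 0).
    by apply: cderB; [exact: cder_id|exact: cder_cst].
  have := cderM (cderB fl (cder_cst (f w) z)) (@cderV R (fun u => u - w) z _ zw0 dzw).
  set L := (_ + _) => H; exists L; apply: cder_near H.
  have : \forall u \near z, cmod (u - z) < cmod (z - w).
    by apply/nbhsCP; exists (cmod (z - w)) => //; rewrite cmod_gt0.
  apply: filterS => u; rewrite /g; case: eqVneq => [->|//].
  by rewrite cmod_distC ltxx.
have Gd := disc_primitive_punctured ws gw gd.
set G := seg_int g w in Gd.
have [P2 [HP2 P2E]] := circ_winding wr.
have t0 := twopii_neq0 R.
exists (fun t => (twopii R)^-1 * G (om t) + f w * P2 t); split; last first.
  by rewrite circ_loop -[RHS]mulr1 -P2E; ring.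
move=> t t01.
have ow := circ_sub_neq0 t wr; have ow' : om t != w by rewrite -subr_eq0.
have os : cmod (om t - a) < s by rewrite circ_dist.
have -> : f (om t) * ((om t - a) / (om t - w)) =
   (twopii R)^-1 * (g (om t) * (twopii R * (om t - a))) + f w * ((om t - a) / (om t - w)).
  by rewrite /g (negbTE ow'); field; rewrite t0 ow.
apply: derD; last by apply: rderZ; exact: HP2.
by apply: rderZ; apply: rder_comp; [exact: Gd|exact: rder_circ].
Unshelve. all: by end_near. Qed.

Lemma cauchy_bound f (s : R) w (M : R) : r < s -> cmod (w - a) < r ->
  (forall z, cmod (z - a) < s -> exists l, cder f z l) ->
  (forall t, unit_itv t -> cmod (f (om t)) <= M) ->
  cmod (f w) <= M * (r / (r - cmod (w - a))).
Proof.
move=> rs wr fd fM; have [P [HP <-]] := cauchy_formula rs wr fd.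
apply: (rder_bound HP) => t t01; rewrite !cmodM cmodV circ_dist.
apply: ler_pM; rewrite ?cmod_ge0 ?fM//.
  by rewrite divr_ge0 ?cmod_ge0// ltW.
rewrite ler_pM2l// lef_pV2 ?posrE ?circ_sub_ge// ?subr_gt0//.
by rewrite cmod_gt0 circ_sub_neq0.
Qed.

End Circle.

Definition is_path_int (g : R -> C) l : Prop :=
  exists P : R -> C, (forall t, unit_itv t -> rder P t (g t)) /\ P 1 - P 0 = l.

(** Differentiation under the integral sign. A kernel remainder quadratic in v - w, uniformly in t,
    bounds the derivative of the combined primitives, and the mean value inequality passes this
    bound to their increment. *)
Lemma path_int_der (psi : R -> C) (k k' : R -> C -> C) (T : C -> C) w l (M B d : R) :
  0 < d -> 0 <= M -> 0 <= B -> (forall t, unit_itv t -> cmod (psi t) <= M) ->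
  (forall t v, unit_itv t -> cmod (v - w) < d ->
    cmod (k t v - k t w - (v - w) * k' t w) <= B * cmod (v - w) ^+ 2) ->
  (forall v, cmod (v - w) < d -> is_path_int (fun t => psi t * k t v) (T v)) ->
  is_path_int (fun t => psi t * k' t w) l ->
  cder T w l.
Proof.
move=> d0 M0 B0 psiM kB HT [Q [HQ <-]]; apply/derP => e e0.
have MB0 : 0 < M * B + 1 by rewrite ltr_wpDl ?mulr_ge0.
apply/nbhsCP; exists (Num.min d (e / (M * B + 1))).
  by rewrite lt_min d0 divr_gt0.
move=> v; rewrite lt_min => /andP[vd]; rewrite ltr_pdivlMr// => ve.
have [P1 [HP1 <-]] := HT v vd.
have [P2 [HP2 <-]] : is_path_int (fun t => psi t * k t w) (T w).
  by apply: HT; rewrite subrr cmod0.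
have -> : P1 1 - P1 0 - (P2 1 - P2 0) - (Q 1 - Q 0) * (id v - id w) =
    (P1 1 - P2 1 - (v - w) * Q 1) - (P1 0 - P2 0 - (v - w) * Q 0).
  by rewrite -[id v]/v -[id w]/w; ring.
rewrite -[id v]/v -[id w]/w.
apply: (@rder_bound R (fun t => P1 t - P2 t - (v - w) * Q t)
  (fun t => psi t * k t v - psi t * k t w - (v - w) * (psi t * k' t w))) => t t01.
  by apply: rderB; [apply: rderB; [exact: HP1|exact: HP2]|apply: rderZ; exact: HQ].
have -> : psi t * k t v - psi t * k t w - (v - w) * (psi t * k' t w) =
    psi t * (k t v - k t w - (v - w) * k' t w) by ring.
rewrite cmodM.
have H1 := psiM t t01; have H2 := kB t v t01 vd.
apply: (@le_trans _ _ (M * (B * cmod (v - w) ^+ 2))).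
  by apply: ler_pM; rewrite ?cmod_ge0.
have c0 := cmod_ge0 (v - w).
have -> : M * (B * cmod (v - w) ^+ 2) = (M * B * cmod (v - w)) * cmod (v - w) by ring.
by apply: ler_wpM2r => //; lra.
Qed.

(** The remainder is exactly h^2 / (u^2 (u - h)), and both |u| and |u - h| are at least [d]. *)
Lemma kernel1 u h (d : R) : 0 < d -> 2 * d <= cmod u -> cmod h < d ->
  cmod ((u - h)^-1 - u^-1 - h * (u ^+ 2)^-1) <= d^-1 ^+ 3 * cmod h ^+ 2.
Proof.
move=> d0 ud hd.
have uh : d <= cmod (u - h).
  have := cmodD (u - h) h; rewrite subrK; lra.
have u0 : u != 0 by rewrite -cmod_gt0; lra.
have uh0 : u - h != 0 by rewrite -cmod_gt0; lra.
have -> : (u - h)^-1 - u^-1 - h * (u ^+ 2)^-1 = (u^-1 * u^-1 * (u - h)^-1) * h ^+ 2.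
  by field; rewrite ?u0 ?uh0.
rewrite cmodM cmodX; apply: ler_wpM2r; first by rewrite exprn_ge0// cmod_ge0.
rewrite !cmodM !cmodV !exprS expr0 mulr1 mulrA.
have H1 : (cmod u)^-1 <= d^-1 by rewrite lef_pV2 ?posrE//; lra.
have H2 : (cmod (u - h))^-1 <= d^-1 by rewrite lef_pV2 ?posrE//; lra.
by rewrite !ler_pM ?mulr_ge0 ?invr_ge0 ?cmod_ge0.
Qed.

(** The remainder is h^2 (3 u - 2 h) / (u^3 (u - h)^2); since |h / u| <= 1, its two summands
    contribute 3 and 2 to the constant 5. *)
Lemma kernel2 u h (d : R) : 0 < d -> 2 * d <= cmod u -> cmod h < d ->
  cmod (((u - h) ^+ 2)^-1 - (u ^+ 2)^-1 - h * (2 * (u ^+ 3)^-1)) <=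
    5 * d^-1 ^+ 4 * cmod h ^+ 2.
Proof.
move=> d0 ud hd.
have uh : d <= cmod (u - h).
  have := cmodD (u - h) h; rewrite subrK; lra.
have u0 : u != 0 by rewrite -cmod_gt0; lra.
have uh0 : u - h != 0 by rewrite -cmod_gt0; lra.
have -> : ((u - h) ^+ 2)^-1 - (u ^+ 2)^-1 - h * (2 * (u ^+ 3)^-1) =
    (3 * u^-1 * u^-1 * (u - h)^-1 * (u - h)^-1 - 2 * h * (u^-1 * u^-1 * u^-1 * (u - h)^-1 * (u - h)^-1)) * h ^+ 2.
  by field; rewrite ?u0 ?uh0.
rewrite cmodM cmodX; apply: ler_wpM2r; first by rewrite exprn_ge0// cmod_ge0.
have H1 : (cmod u)^-1 <= d^-1 by rewrite lef_pV2 ?posrE//; lra.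
have H2 : (cmod (u - h))^-1 <= d^-1 by rewrite lef_pV2 ?posrE//; lra.
have c2 : cmod (2 : C) = 2 by rewrite -ofR_nat cmod_ofR ger0_norm.
have c3 : cmod (3 : C) = 3 by rewrite -ofR_nat cmod_ofR ger0_norm.
have K1 : cmod (u^-1 * u^-1 * (u - h)^-1 * (u - h)^-1) <= d^-1 ^+ 4.
  rewrite !cmodM !cmodV !exprS expr0 mulr1 !mulrA.
  by rewrite !ler_pM ?mulr_ge0 ?invr_ge0 ?cmod_ge0.
have K2 : cmod (h * u^-1) <= 1.
  rewrite cmodM cmodV ler_pdivrMr ?cmod_gt0// mul1r; lra.
apply: le_trans (cmodB _ _) _.
have -> : 5 * d^-1 ^+ 4 = 3 * d^-1 ^+ 4 + 2 * (1 * d^-1 ^+ 4) by ring.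
have -> : 3 * u^-1 * u^-1 * (u - h)^-1 * (u - h)^-1 = 3 * (u^-1 * u^-1 * (u - h)^-1 * (u - h)^-1) by ring.
have -> : 2 * h * (u^-1 * u^-1 * u^-1 * (u - h)^-1 * (u - h)^-1) =
  2 * (h * u^-1 * (u^-1 * u^-1 * (u - h)^-1 * (u - h)^-1)) by ring.
rewrite !(cmodM 2) !(cmodM 3) c2 c3 (cmodM (h * u^-1)).
apply: lerD; rewrite ler_pM2l//.
by apply: ler_pM; rewrite ?cmod_ge0.
Qed.

(** Cauchy's formula represents [f w] by the kernel (z - w)^-1. With [T n] the integral for the
    kernel (z - w)^-n, differentiating under the integral gives first [T 2] on a disc and then
    [2 * T 3] at its centre. *)
Theorem derivative_derivable f a (s : R) : 0 < s ->
  (forall z, cmod (z - a) < s -> exists l, cder f z l) ->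
  exists g : C -> C, exists l, (\forall z \near a, cder f z (g z)) /\ cder g a l.
Proof.
move=> s0 fd; pose r := s / 2.
have r0 : 0 < r by rewrite divr_gt0.
have rs : r < s by rewrite /r; lra.
pose om := circ a r; pose psi t := f (om t) * (om t - a).
have fomc t : (fun t => f (om t)) @ t --> f (om t).
  have [|l /cder_cvg fc] := fd (om t); first by rewrite circ_dist.
  have oc : om @ t --> om t := @circ_cvg a r t.
  exact: (@cvg_comp _ _ _ om f _ _ _ oc fc).
have subc v t : (fun t => om t - v) @ t --> om t - v.
  have oc : om @ t --> om t := @circ_cvg a r t.
  exact: (ccvgB oc (ccvg_cst (k := v))).
have psic t : psi @ t --> psi t by exact: (ccvgM (fomc t) (subc a t)).
have [M M0 psiM] := path_bounded (fun t _ => psic t).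
have Kex v n : cmod (v - a) < r -> exists l, is_path_int (fun t => psi t * ((om t - v) ^+ n)^-1) l.
  move=> vr; have [|P HP] := @primitive_exists R (fun t => psi t * ((om t - v) ^+ n)^-1).
    move=> t; have n0 := circ_sub_neq0 r0 t vr.
    have Xc : (fun t => (om t - v) ^+ n) @ t --> (om t - v) ^+ n.
      elim: n => [|n IH]; first exact: (ccvg_cst (k := 1)).
      have := ccvgM (FF := nbhs_filter t) (subc v t) IH; rewrite -exprS.
      by under eq_fun do rewrite -exprS.
    exact: (ccvgM (psic t) (ccvgV (expf_neq0 n n0) Xc)).
  by exists (P 1 - P 0), P.
pose T n v := xget 0 [set l | is_path_int (fun t => psi t * ((om t - v) ^+ n)^-1) l].
have TP n v : cmod (v - a) < r -> is_path_int (fun t => psi t * ((om t - v) ^+ n)^-1) (T n v).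
  by move=> vr; have := @xgetPex _ 0 [set l | is_path_int (fun t => psi t * ((om t - v) ^+ n)^-1) l] (Kex v n vr).
have disc w : cmod (w - a) < r -> exists2 d, 0 < d &
    (forall t, 2 * d <= cmod (om t - w)) /\ (forall v, cmod (v - w) < d -> cmod (v - a) < r).
  move=> wr; exists ((r - cmod (w - a)) / 2); first by rewrite divr_gt0// subr_gt0.
  split=> [t|v vd]; first by have := circ_sub_ge a r0 w t; rewrite -/om; lra.
  have := cmodD (v - w) (w - a); rewrite subrKA; have := wr; lra.
have opp t v w : om t - v = (om t - w) - (v - w) by ring.
have fT w : cmod (w - a) < r -> is_path_int (fun t => psi t * (om t - w)^-1) (f w).
  move=> wr; have [P [HP PE]] := cauchy_formula r0 rs wr fd.
  by exists P; split=> // t t01; have := HP t t01; rewrite mulrA.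
have d1 w : cmod (w - a) < r -> cder f w (T 2%N w).
  move=> wr; have [d d0 [dom dr]] := disc w wr.
  have B0 : 0 <= d^-1 ^+ 3 by rewrite exprn_ge0// invr_ge0 ltW.
  apply: (path_int_der (k := fun t v => (om t - v)^-1) (k' := fun t v => ((om t - v) ^+ 2)^-1)
    d0 M0 B0 psiM _ _ (TP 2%N w wr)).
    by move=> t v t01 vd; rewrite (opp t v w); exact: kernel1.
  by move=> v vd; apply: fT; exact: dr.
exists (T 2%N), (2 * T 3%N a); split.
  by apply/nbhsCP; exists r => //.
have ar : cmod (a - a) < r by rewrite subrr cmod0.
have [d d0 [dom dr]] := disc a ar.
have B0 : 0 <= 5 * d^-1 ^+ 4 by rewrite mulr_ge0// exprn_ge0// invr_ge0 ltW.
apply: (path_int_der (k := fun t v => ((om t - v) ^+ 2)^-1)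
  (k' := fun t v => 2 * ((om t - v) ^+ 3)^-1) d0 M0 B0 psiM).
- by move=> t v t01 vd; rewrite (opp t v a); exact: kernel2.
- by move=> v vd; apply: TP; exact: dr.
have [P [HP <-]] := TP 3%N a ar; exists (fun t => 2 * P t); split; last by ring.
by move=> t t01; rewrite mulrCA; apply: rderZ; exact: HP.
Qed.

End CauchyFormula.

(** * The identity theorem *)

Section Identity.
Variable R : realType.
Local Notation C := (C R).
Implicit Types (t x y e d s : R) (z w l k a b h u v : C) (f F H : C -> C).

Lemma derive1_derivable F a s : 0 < s ->
  (forall z, cmod (z - a) < s -> derivable F z 1) ->
  derivable (F^`()%classic : C -> C) a 1.
Proof.
move=> s0 Fd.
have [|g [l [gF gl]]] := @derivative_derivable R F a s s0.
  by move=> z zs; exists (F^`()%classic z); apply: derivable_cder; exact: Fd.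
apply: (@cder_derivable R _ a l); apply: cder_near gl.
by apply: filterS gF => z /cder_derive1 ->.
Qed.

(** [H / (z - a)^n] is holomorphic for every [n], so Cauchy's bound on a circle
    of radius more than [2 |w - a|] gives [|H w| = O(2^-n)]. *)
Lemma identity_disc H a s d w : 0 < d ->
  (forall z, cmod (z - a) < s -> exists l, cder H z l) ->
  (forall z, cmod (z - a) < d -> H z = 0) ->
  2 * cmod (w - a) < s -> H w = 0.
Proof.
move=> d0 Hd H0 ws.
have [wa|wa] := eqVneq w a; first by rewrite wa; apply: H0; rewrite subrr cmod0.
have wa0 : 0 < cmod (w - a) by rewrite cmod_gt0 subr_eq0.
pose r := (s + 2 * cmod (w - a)) / 2.
have rs : r < s by rewrite /r; lra.
have r2 : 2 * cmod (w - a) < r by rewrite /r; lra.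
have wr : cmod (w - a) < r by lra.
have r0 : 0 < r by lra.
have [M M0 HM] : exists2 M, 0 <= M & forall t, unit_itv t -> cmod (H (circ a r t)) <= M.
  apply: (@path_bounded R (fun t => H (circ a r t))) => t _.
  have [|l /cder_cvg Hc] := Hd (circ a r t); first by rewrite circ_dist.
  have oc : circ a r @ t --> circ a r t := @circ_cvg R a r t.
  exact: (@cvg_comp _ _ _ (circ a r) H _ _ _ oc Hc).
pose K := M * (r / (r - cmod (w - a))).
have Hn n : cmod (H w) <= K * 2^-1 ^+ n.
  (* Where [H] vanishes so does the quotient, also at [a] itself; hence [f] is 0 near [a] and
     holomorphic there. *)
  pose f z := H z / (z - a) ^+ n.
  have fd z : cmod (z - a) < s -> exists l, cder f z l.
    move=> zs; have [za|za] := eqVneq z a.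
      exists 0; apply: cder_near (cder_cst 0 z).
      apply/nbhsCP; exists d => // u; rewrite za => ud.
      by rewrite /f H0// mul0r.
    have [l Hl] := Hd z zs.
    have dza : cder (fun u => u - a) z (1 - 0).
      by apply: cderB; [exact: cder_id|exact: cder_cst].
    have n0 : (z - a) ^+ n != 0 by rewrite expf_neq0// subr_eq0.
    have := cderM Hl (@cderV R (fun u => (u - a) ^+ n) z _ n0 (cderX n dza)).
    by set L := (_ + _) => HL; exists L.
  have fw : cmod (f w) <= M / r ^+ n * (r / (r - cmod (w - a))).
    apply: (cauchy_bound r0 rs wr fd) => t t01.
    by rewrite /f cmodM cmodV cmodX circ_dist// ler_pM2r ?HM// invr_gt0 exprn_gt0.
  have -> : H w = f w * (w - a) ^+ n.
    by rewrite /f mulfVK// expf_neq0// subr_eq0.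
  rewrite cmodM cmodX; apply: le_trans (ler_wpM2r (exprn_ge0 _ (cmod_ge0 _)) fw) _.
  have -> : M / r ^+ n * (r / (r - cmod (w - a))) * cmod (w - a) ^+ n = K * (cmod (w - a) / r) ^+ n.
    rewrite /K (expr_div_n (cmod (w - a)) r n).
    have E (X Y Z : R) : M * X * Y * Z = M * Y * (Z * X) by ring.
    exact: E.
  apply: ler_wpM2l.
    by rewrite /K mulr_ge0// divr_ge0 ?ltW// subr_gt0.
  have q0 : 0 <= cmod (w - a) / r by rewrite divr_ge0// ltW.
  have q2 : cmod (w - a) / r <= 2^-1 by rewrite ler_pdivrMr//; lra.
  by rewrite lerXn2r// nnegrE.
by apply/eqP; rewrite -cmod_eq0 eq_le cmod_ge0 andbT; exact: (le_half_small Hn).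
Qed.

(** Connectedness of the segment: if [tau] is the supremum of the parameters up to which [H]
    vanishes near the segment, a disc centred at such a parameter close to [tau] reaches beyond
    it. *)
Lemma identity_segment H a b :
  (forall t, unit_itv t -> exists2 s, 0 < s &
     forall z, cmod (z - seg a b t) < s -> exists l, cder H z l) ->
  (exists2 d, 0 < d & forall z, cmod (z - a) < d -> H z = 0) -> H b = 0.
Proof.
move=> Hd Ha.
pose zero_near z := exists2 d, 0 < d & forall u, cmod (u - z) < d -> H u = 0.
pose A := [set t | unit_itv t /\ forall s, 0 <= s <= t -> zero_near (seg a b s)].
have A0 : A 0.
  split; first exact: unit_itv0.
  by move=> s s0; have -> : s = 0 by [lra]; rewrite seg0.
have Aub : ubound A 1 by move=> t [/andP[]].
have supA : has_sup A by split; [exists 0|exists 1].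
pose tau := sup A.
have tau0 : 0 <= tau by apply: ub_le_sup => //; exists 1.
have tau1 : tau <= 1 by apply: ge_sup => //; exists 0.
have tau01 : unit_itv tau by rewrite /unit_itv tau0.
have [s s0 Hs] := Hd tau tau01.
pose L := cmod (b - a) + 1.
have L0 : 0 < L by rewrite ltr_wpDl ?cmod_ge0.
have segd t t' : cmod (seg a b t - seg a b t') <= `|t - t'| * L.
  have -> : seg a b t - seg a b t' = ofR (t - t') * (b - a) by rewrite /seg ofRB; ring.
  by rewrite cmodM cmod_ofR ler_wpM2l// /L lerDl.
(* Parameters within [e] give points within [s / 8]. The disc of radius 7s/8 about [seg a b t] then
   lies in the disc of radius [s] about the point at [tau], and [identity_disc] is applied at
   distances below s/4 + s/8, twice which is below 7s/8. *)
pose e := s / 8 / L.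
have e0 : 0 < e by rewrite !divr_gt0.
have eL : e * L = s / 8 by rewrite /e mulfVK// gt_eqF.
have [t [t01 tz] te] := sup_adherent e0 supA.
have ttau : t <= tau by apply: ub_le_sup; [exists 1|split].
have td : cmod (seg a b t - seg a b tau) <= s / 8.
  apply: le_trans (segd _ _) _; rewrite -eL ler_pM2r//.
  by rewrite ler_norml; apply/andP; split; move: te; rewrite -/tau; lra.
have [d d0 Ht] : zero_near (seg a b t).
  by apply: tz; case/andP: t01 => -> _; rewrite lexx.
have Hzero z : cmod (z - seg a b tau) < s / 4 -> H z = 0.
  move=> zs; apply: (@identity_disc H (seg a b t) (s * (7 / 8)) d z d0 _ Ht).
    move=> u us; apply: Hs; apply: le_lt_trans (cmod_dist_triangle _ (seg a b t) _) _.
    by move: us td; lra.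
  have := cmod_dist_triangle z (seg a b tau) (seg a b t).
  by rewrite (cmod_distC (seg a b tau)); move: zs td; lra.
have znear s' : `|s' - tau| <= e -> zero_near (seg a b s').
  move=> s'e; exists (s / 8); first by rewrite divr_gt0.
  move=> u us; apply: Hzero; apply: le_lt_trans (cmod_dist_triangle _ (seg a b s') _) _.
  have := segd s' tau; have : `|s' - tau| * L <= s / 8 by rewrite -eL ler_pM2r.
  by move: us; lra.
have Aall x : unit_itv x -> x <= tau + e -> A x.
  move=> x01 xe; split=> // y /andP[y0 yx].
  have [yt|yt] := leP y t; first by apply: tz; rewrite y0.
  by apply: znear; rewrite ler_norml; apply/andP; split; move: te; rewrite -/tau; lra.
have tauE : tau = 1.
  apply/eqP; rewrite eq_le tau1 leNgt; apply/negP => tl.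
  pose x := Num.min 1 (tau + e).
  have xt : tau < x by rewrite /x lt_min tl ltrDl.
  have Ax : A x.
    apply: Aall; last by rewrite /x ge_min lexx orbT.
    by rewrite /unit_itv (le_trans tau0 (ltW xt)) /x ge_min lexx.
  have : x <= tau by apply: ub_le_sup => //; exists 1.
  by rewrite leNgt xt.
have [_ /(_ 1)] : A 1 by apply: Aall; [exact: unit_itv1|rewrite tauE lerDl ltW].
rewrite ler01 lexx => /(_ isT)[d' d'0]; rewrite seg1; apply.
by rewrite subrr cmod0.
Qed.

End Identity.

(** * The cut plane *)

Section CutPlane.
Variable R : realType.
Local Notation C := (C R).
Implicit Types (t x y e d s : R) (z w l k a b h u v : C) (f F G H : C -> C).

Definition half : C := ofR 2^-1.

Lemma cut_planeP z : cut_plane z <-> Imc z != 0 \/ 0 < Rec z < 1.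
Proof.
split=> [zc|[/eqP i0 []//|/andP[r0 r1] [_ [|]]]]; last 2 first.
- by rewrite leNgt r0.
- by rewrite leNgt r1.
have [i0|] := eqVneq (Imc z) 0; last by left.
right; rewrite !ltNge; apply/andP; split; apply/negP => r; apply: zc; split=> //.
  by left.
by right.
Qed.

(** If z is not real, v stays in the same open half-plane, and the imaginary part x Im z + y Im v
    vanishes only at the centre 1/2. If z lies in (0,1), the triangle stays in the convex strip 0 <
    Re < 1. *)
Lemma cut_plane_star z : cut_plane z -> exists2 d, 0 < d & forall v, cmod (v - z) < d ->
  forall x y, 0 <= x -> 0 <= y -> x + y <= 1 ->
  cut_plane (half + ofR x * (z - half) + ofR y * (v - half)).
Proof.
move=> /cut_planeP zc.
have rE v x y : Rec (half + ofR x * (z - half) + ofR y * (v - half)) =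
    (1 - x - y) / 2 + x * Rec z + y * Rec v.
  by rewrite !RecD !RecM !RecB !ImcB /half /Rec /Imc /=; ring.
have iE v x y : Imc (half + ofR x * (z - half) + ofR y * (v - half)) =
    x * Imc z + y * Imc v.
  by rewrite !ImcD !ImcM !RecB !ImcB /half /Rec /Imc /=; ring.
case: zc => [i0|/andP[r0 r1]].
  exists `|Imc z|; first by rewrite normr_gt0.
  move=> v vz x y x0 y0 xy; apply/cut_planeP; rewrite rE iE.
  have := le_lt_trans (Imc_le_cmod _) vz; rewrite ImcB => iv.
  have [xy0|xy0] := leP (x + y) 0.
    have [-> ->] : x = 0 /\ y = 0 by split; lra.
    by right; rewrite !mul0r; apply/andP; split; lra.
  left; have [ip|im] := ltP 0 (Imc z).
    have vp : 0 < Imc v.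
      by move: iv; rewrite (gtr0_norm ip) ltr_norml => /andP[? _]; lra.
    have [x1|x1] := ltP 0 x.
      by rewrite gt_eqF// ltr_pwDl ?mulr_gt0// mulr_ge0// ltW.
    have yp : 0 < y by lra.
    by rewrite gt_eqF// ltr_wpDl ?mulr_gt0// mulr_ge0// ltW.
  have im' : Imc z < 0 by rewrite lt_neqAle i0.
  have vp : Imc v < 0.
    by move: iv; rewrite (ltr0_norm im') ltr_norml => /andP[_ ?]; lra.
  have [x1|x1] := ltP 0 x.
    have H1 : x * Imc z < 0 by rewrite pmulr_rlt0.
    have H2 : y * Imc v <= 0 by rewrite mulr_ge0_le0// ltW.
    by rewrite lt_eqF//; lra.
  have yp : 0 < y by lra.
  have H1 : x * Imc z <= 0 by rewrite mulr_ge0_le0// ltW.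
  have H2 : y * Imc v < 0 by rewrite pmulr_rlt0.
  by rewrite lt_eqF//; lra.
exists (Num.min (Rec z) (1 - Rec z)); first by rewrite lt_min r0 subr_gt0.
move=> v vz x y x0 y0 xy; apply/cut_planeP; rewrite rE; right.
have := le_lt_trans (Rec_le_cmod _) vz; rewrite RecB lt_min !ltr_norml.
move=> /andP[/andP[? ?] /andP[? ?]].
have [v0 v1] : 0 < Rec v /\ Rec v < 1 by split; lra.
move: (Rec z) (Rec v) r0 r1 v0 v1 => p q p0 p1 q0 q1.
have [m [m0 mp mq m2]] : exists m, [/\ 0 < m, m <= p, m <= q & m <= 2^-1].
  exists (Num.min p (Num.min q 2^-1)); rewrite !lt_min p0 q0 !ge_min !lexx !orbT.
  by split=> //=; rewrite invr_gt0 ltr0n.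
have [n [n0 np nq n2]] : exists n, [/\ n < 1, p <= n, q <= n & 2^-1 <= n].
  exists (Num.max p (Num.max q 2^-1)); rewrite !gt_max p1 q1 !le_max !lexx !orbT.
  by split=> //; lra.
have xy' : 0 <= 1 - x - y by lra.
apply/andP; split.
  by apply: (lt_le_trans m0); nra.
by apply: le_lt_trans n0; nra.
Qed.

Lemma cut_plane_seg z t : cut_plane z -> unit_itv t -> cut_plane (seg half z t).
Proof.
move=> /cut_plane_star[d d0 H] /andP[t0 t1].
have := H z; rewrite subrr cmod0 => /(_ d0 t 0 t0 (lexx _)).
by rewrite addr0 ofR0 mul0r addr0; exact.
Qed.

Lemma cut_plane_open z : cut_plane z ->
  exists2 d, 0 < d & forall v, cmod (v - z) < d -> cut_plane v.
Proof.
move=> /cut_plane_star[d d0 H]; exists d => // v vd.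
have := H v vd 0 1 (lexx _) ler01; rewrite add0r ofR0 ofR1 mul0r addr0 mul1r subrKC.
exact.
Qed.

Lemma cut_plane_near z : cut_plane z -> \forall w \near z, cut_plane w.
Proof. by move=> /cut_plane_open[d d0 H]; apply/nbhsCP; exists d. Qed.

Lemma cut_plane_half : cut_plane half.
Proof.
by apply/cut_planeP; right; rewrite Rec_ofR invr_gt0 ltr0n /= invf_lt1// ltr1n.
Qed.

Lemma holoP F : holo_on_cut F <-> forall z, cut_plane z -> cder F z (F^`()%classic z).
Proof.
split=> H z zc; first exact: derivable_cder (H z zc).
exact: cder_derivable (H z zc).
Qed.

Lemma holo_cder F (l : C -> C) : (forall z, cut_plane z -> cder F z (l z)) -> holo_on_cut F.
Proof. by move=> H z zc; exact: cder_derivable (H z zc). Qed.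

Lemma holo_derive1 F : holo_on_cut F -> holo_on_cut (F^`()%classic : C -> C).
Proof.
move=> Fh z /cut_plane_open[d d0 dU]; apply: (derive1_derivable d0) => w wd.
by apply: Fh; exact: dU.
Qed.

Lemma holo_primitive f : holo_on_cut f ->
  exists F, forall z, cut_plane z -> cder F z (f z).
Proof.
move=> /holoP fh; exists (seg_int f half).
apply: (@star_primitive R (@cut_plane R) half f); first exact: cut_plane_star.
by move=> z /fh ?; eexists; eassumption.
Qed.

Lemma cder_eq_on_cut F G z l : (forall w, cut_plane w -> F w = G w) -> cut_plane z ->
  cder F z l -> cder G z l.
Proof. by move=> FG /cut_plane_near H; apply: cder_near; apply: filterS H. Qed.

Lemma derive1_eq_on_cut F G z : (forall w, cut_plane w -> F w = G w) -> holo_on_cut F ->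
  cut_plane z -> F^`()%classic z = G^`()%classic z.
Proof.
move=> FG /holoP Fh zc; apply/esym/cder_derive1.
exact: cder_eq_on_cut FG zc (Fh z zc).
Qed.

Lemma const_on_cut F : (forall z, cut_plane z -> cder F z 0) ->
  forall z, cut_plane z -> F z = F half.
Proof.
move=> F0 z zc; apply/eqP; rewrite -subr_eq0 -cmod_eq0 eq_le cmod_ge0 andbT.
rewrite -{1}(seg1 half z) -{2}(seg0 half z).
apply: (@rder_bound R (fun t => F (seg half z t)) (fun=> 0)) => t t01.
  rewrite -(mul0r (z - half)); apply: rder_comp; last exact: rder_segment.
  by apply: F0; exact: cut_plane_seg.
by rewrite cmod0.
Qed.

Lemma identity_cut H : holo_on_cut H ->
  (exists2 d, 0 < d & forall z, cmod (z - half) < d -> H z = 0) ->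
  forall z, cut_plane z -> H z = 0.
Proof.
move=> /holoP Hh H0 z zc; apply: identity_segment H0 => t t01.
have [d d0 dU] := cut_plane_open (cut_plane_seg zc t01).
by exists d => // w /dU/Hh ?; eexists; eassumption.
Qed.

End CutPlane.

(** * The differential equation *)

Section Operators.
Variable R : realType.
Local Notation C := (C R).
Implicit Types (x y e d s : R) (z w l k a b c : C) (F G u : C -> C) (L M : seq {poly C}).
Implicit Types (p q : {poly C}).

Lemma cder_horner p z : cder (fun w => p.[w]) z (p^`()).[z].
Proof.
elim/poly_ind: p => [|p a IH].
  rewrite deriv0 horner0; apply: der_ext (cder_cst 0 z) => w; by rewrite horner0.
rewrite derivMXaddC hornerD hornerMX.
have := cderD (cderM IH (cder_id z)) (cder_cst a z).
rewrite mulr1 addr0 [_ + p.[z]]addrC; apply: der_ext => w.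
by rewrite hornerMXaddC.
Qed.

Notation Dn F j := (iter j (@derive1 C C) F).

Lemma holo_iter F j : holo_on_cut F -> holo_on_cut (Dn F j).
Proof.
move=> Fh; elim: j => [|j IH]; first exact: Fh.
exact: (@holo_derive1 R _ IH).
Qed.

Lemma op_act_widen L F z n : (size L <= n)%N ->
  op_act L F z = \sum_(j < n) (L`_j).[z] * Dn F j z.
Proof.
move=> Ln; rewrite /op_act (big_ord_widen n (fun j => (L`_j).[z] * Dn F j z))//.
rewrite big_mkcond; apply: eq_bigr => j _; case: ltnP => // jL.
by rewrite nth_default// horner0 mul0r.
Qed.

Lemma op_act_add L M F z : op_act (op_add L M) F z = op_act L F z + op_act M F z.
Proof.
rewrite (op_act_widen F z (leq_maxl (size L) (size M))).
rewrite (op_act_widen F z (leq_maxr (size L) (size M))) -big_split.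
rewrite {1}/op_act size_mkseq; apply: eq_bigr => j _ /=.
by rewrite nth_mkseq// hornerD mulrDl.
Qed.

Lemma op_act_scale p L F z : op_act (op_scale p L) F z = p.[z] * op_act L F z.
Proof.
rewrite /op_act size_map mulr_sumr; apply: eq_bigr => j _.
by rewrite (nth_map 0)// hornerM mulrA.
Qed.

Lemma op_act_nil F z : op_act [::] F z = 0.
Proof. by rewrite /op_act big_ord0. Qed.

Lemma cder_op_act L F z : holo_on_cut F -> cut_plane z ->
  cder (op_act L F) z (op_act (op_dleft L) F z).
Proof.
move=> Fh zc.
have -> : op_act (op_dleft L) F z =
    \sum_(j < size L) ((L`_j)^`().[z] * Dn F j z + (L`_j).[z] * Dn F j.+1 z).
  rewrite big_split /op_act size_mkseq /=.
  under eq_bigr => j _ do rewrite nth_mkseq// hornerD mulrDl.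
  rewrite big_split; congr (_ + _).
    by rewrite big_ord_recr /= nth_default// deriv0 horner0 mul0r addr0.
  by rewrite big_ord_recl /= horner0 mul0r add0r.
apply: der_sum => j; apply: cderM; first exact: cder_horner.
exact: (proj1 (holoP _) (@holo_iter F j Fh) z zc).
Qed.

Lemma holo_op_act L F : holo_on_cut F -> holo_on_cut (op_act L F).
Proof. by move=> Fh; apply: holo_cder => z zc; exact: cder_op_act. Qed.

(** Both [theta_op] and [outer_op] are of first order, so this covers every composition in [Dop].
    Holomorphy of [F] makes all iterated derivatives differentiable, as the product rule behind
    [op_dleft] demands. *)
Lemma op_act_mul2 p q M F z : holo_on_cut F -> cut_plane z ->
  op_act (op_mul [:: p; q] M) F z =
  p.[z] * op_act M F z + q.[z] * (op_act M F)^`()%classic z.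
Proof.
move=> Fh zc; have -> : op_mul [:: p; q] M =
  op_add (op_scale p M) (op_add (op_scale q (op_dleft M)) [::]) by [].
rewrite !op_act_add !op_act_scale op_act_nil addr0.
by rewrite (cder_derive1 (cder_op_act M Fh zc)).
Qed.

(** [bop c] is the action of [theta_op c], that is [z d/dz + c - 1]. *)
Definition bop c F : C -> C := fun z => (c - 1) * F z + z * F^`()%classic z.

Lemma holo_bop c F : holo_on_cut F -> holo_on_cut (bop c F).
Proof.
move=> Fh; have /holoP H1 := Fh; have /holoP H2 := holo_derive1 Fh.
apply: holo_cder => z zc; apply: cderD; first by apply: cderZ; exact: H1.
by apply: cderM; [exact: cder_id|exact: H2].
Qed.

Lemma holo_iter_bop c m F : holo_on_cut F -> holo_on_cut (iter m (bop c) F).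
Proof.
move=> Fh; elim: m => [|m IH]; first exact: Fh.
exact: (@holo_bop c _ IH).
Qed.

Lemma bop_cder c F z l : cder F z l -> bop c F z = (c - 1) * F z + z * l.
Proof. by move=> /cder_derive1 H; rewrite /bop H. Qed.

Lemma bop_eq_on_cut c F G z : (forall w, cut_plane w -> F w = G w) -> holo_on_cut F ->
  cut_plane z -> bop c F z = bop c G z.
Proof. by move=> FG Fh zc; rewrite /bop (FG z zc) (derive1_eq_on_cut FG Fh zc). Qed.

Lemma iter_bop_eq_on_cut c m F G : (forall w, cut_plane w -> F w = G w) ->
  holo_on_cut F -> forall z, cut_plane z -> iter m (bop c) F z = iter m (bop c) G z.
Proof.
move=> FG Fh; elim: m => [|m IH] z zc; first exact: FG.
exact: (bop_eq_on_cut c IH (@holo_iter_bop c m _ Fh) zc).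
Qed.

Lemma iter_bop_lin c m F G k : holo_on_cut F -> holo_on_cut G -> forall z, cut_plane z ->
  iter m (bop c) (fun w => k * F w + G w) z = k * iter m (bop c) F z + iter m (bop c) G z.
Proof.
move=> Fh Gh; elim: m => [|m IH] z zc; first by [].
have HF := proj1 (holoP _) (@holo_iter_bop c m _ Fh).
have HG := proj1 (holoP _) (@holo_iter_bop c m _ Gh).
have H : cder (fun w => k * iter m (bop c) F w + iter m (bop c) G w) z
    (k * (iter m (bop c) F)^`()%classic z + (iter m (bop c) G)^`()%classic z).
  exact: (cderD (cderZ k (HF z zc)) (HG z zc)).
have H' : cder (iter m (bop c) (fun w => k * F w + G w)) z
    (k * (iter m (bop c) F)^`()%classic z + (iter m (bop c) G)^`()%classic z).
  by apply: (cder_eq_on_cut _ zc H) => w wc; rewrite (IH w wc).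
have E (X Y U V : C) : (c - 1) * (k * X + Y) + z * (k * U + V) =
  k * ((c - 1) * X + z * U) + ((c - 1) * Y + z * V) by ring.
rewrite 3!iterS (bop_cder c H') (IH z zc); exact: E.
Qed.

Lemma op_act_theta_iter m c F z : holo_on_cut F -> cut_plane z ->
  op_act (iter m (op_mul (theta_op c)) [:: 1]) F z = iter m (bop c) F z.
Proof.
move=> Fh; elim: m z => [|m IH] z zc /=.
  by rewrite /op_act big_ord_recl big_ord0 /= hornerC mul1r addr0.
rewrite (op_act_mul2 _ _ _ Fh zc) hornerC hornerX /bop (IH z zc).
by rewrite (derive1_eq_on_cut IH (@holo_op_act _ F Fh) zc).
Qed.

Lemma op_act_Dop m c F z : holo_on_cut F -> cut_plane z ->
  op_act (Dop m c) F z =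
  - iter m (bop c) F z + z * (1 - z) * (iter m (bop c) F)^`()%classic z.
Proof.
move=> Fh zc; rewrite /Dop (op_act_mul2 _ _ _ Fh zc) (op_act_theta_iter m c Fh zc).
have E w (wc : cut_plane w) := op_act_theta_iter m c Fh wc.
by rewrite (derive1_eq_on_cut E (@holo_op_act _ F Fh) zc) !hornerE mulN1r.
Qed.

Definition geo (z : C) : C := z / (1 - z).

Lemma cut_plane_neq1 z : cut_plane z -> 1 - z != 0.
Proof.
move=> zc; rewrite subr_eq0; apply/eqP => z1; apply: zc; rewrite -z1.
by split=> //; right; rewrite /Rec.
Qed.

Lemma cut_plane_neq0 z : cut_plane z -> z != 0.
Proof. by move=> /cut_plane_slit/slit_neq0. Qed.

Lemma cder_geo z : cut_plane z -> cder geo z ((1 - z)^-1 + z / (1 - z) ^+ 2).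
Proof.
move=> zc; have H1 : cder (fun w => 1 - w) z (0 - 1).
  by apply: cderB; [exact: cder_cst|exact: cder_id].
have := cderM (cder_id z) (@cderV R (fun w => 1 - w) z _ (cut_plane_neq1 zc) H1).
by rewrite sub0r opprK !mul1r.
Qed.

Lemma holo_geo : holo_on_cut geo.
Proof. by apply: holo_cder => z; exact: cder_geo. Qed.

Lemma geo_half : geo (half R) = 1.
Proof.
rewrite /geo (_ : 1 - half R = half R); first by rewrite mulfV// ofR_eq0 invr_neq0// pnatr_eq0.
by rewrite /half -ofR1 -ofRB; congr ofR; lra.
Qed.

Lemma outer_solution G : holo_on_cut G ->
  (forall z, cut_plane z -> - G z + z * (1 - z) * G^`()%classic z = 0) ->
  exists a, forall z, cut_plane z -> G z = a * geo z.
Proof.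
move=> /holoP Gh HG; pose v z := G z * ((1 - z) * z^-1).
exists (v (half R)) => z zc.
have <- : v z = v (half R).
  apply: const_on_cut zc => {}z zc.
  have z0 := cut_plane_neq0 zc; have z1 := cut_plane_neq1 zc.
  have H1 : cder (fun w => 1 - w) z (0 - 1).
    by apply: cderB; [exact: cder_cst|exact: cder_id].
  have := cderM (Gh z zc) (cderM H1 (@cderV R id z 1 z0 (cder_id z))).
  congr cder; have := HG z zc; set g := G^`()%classic z => Hg.
  have {Hg} -> : G z = z * (1 - z) * g.
    by apply/eqP; rewrite -subr_eq0 -oppr_eq0 opprB addrC; apply/eqP.
  by field; exact: z0.
have z0 := cut_plane_neq0 zc; have z1 := cut_plane_neq1 zc.
by rewrite /v /geo; field; rewrite z0 z1.
Qed.

Lemma Dop_solutionP m c F : holo_on_cut F ->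
  (exists a, forall z, cut_plane z -> iter m (bop c) F z = a * geo z) <->
  (forall z, cut_plane z -> op_act (Dop m c) F z = 0).
Proof.
move=> Fh; have Bh := @holo_iter_bop c m _ Fh; split.
  move=> [a Ha] z zc; rewrite op_act_Dop//.
  have H : cder (iter m (bop c) F) z (a * ((1 - z)^-1 + z / (1 - z) ^+ 2)).
    have := cderZ a (cder_geo zc); apply: cder_eq_on_cut zc => w wc.
    by rewrite Ha.
  rewrite (cder_derive1 H) Ha// /geo; field; exact: cut_plane_neq1.
move=> HD; apply: outer_solution => // z zc.
by rewrite -op_act_Dop// HD.
Qed.

Lemma cder_power_logpoly c p z : cut_plane z ->
  cder (fun w => cpow w (1 - c) * p.[Log w]) z
    ((1 - c) * cpow z (- c) * p.[Log z] + cpow z (1 - c) * (p^`().[Log z] * z^-1)).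
Proof.
move=> /cut_plane_slit zs; apply: cderM.
  by have := cder_cpow (1 - c) zs; rewrite addrAC subrr add0r.
by apply: (@cder_comp R (fun w => p.[w])); [exact: cder_horner|exact: cder_Log].
Qed.

Lemma bop_power_logpoly c p z : cut_plane z ->
  bop c (fun w => cpow w (1 - c) * p.[Log w]) z = cpow z (1 - c) * p^`().[Log z].
Proof.
move=> zc; rewrite (bop_cder c (cder_power_logpoly c p zc)).
have zs := cut_plane_slit zc; have z0 := cut_plane_neq0 zc.
have -> : cpow z (- c) = z^-1 * cpow z (1 - c).
  by rewrite cpowD cpow1// mulKf.
move: (cpow _ _) => X; by field; exact: z0.
Qed.

Lemma holo_power_logpoly c p : holo_on_cut (fun w => cpow w (1 - c) * p.[Log w]).
Proof. by apply: holo_cder => z; exact: cder_power_logpoly. Qed.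

Lemma iter_bop_power_logpoly c p m z : cut_plane z ->
  iter m (bop c) (fun w => cpow w (1 - c) * p.[Log w]) z =
  cpow z (1 - c) * p^`(m).[Log z].
Proof.
elim: m z => [|m IH] z zc; first by [].
rewrite derivnS -(bop_power_logpoly c _ zc) iterS.
exact: (bop_eq_on_cut c IH (@holo_iter_bop c m _ (@holo_power_logpoly c p)) zc).
Qed.

Lemma antiderivative_poly p n : (size p <= n)%N ->
  exists2 q : {poly C}, (size q <= n.+1)%N & q^`() = p.
Proof.
(* At [i = 0] the divisor is 0 and the coefficient is 0 by convention; differentiation discards
   it. *)
move=> pn; exists (\poly_(i < n.+1) (p`_i.-1 / i%:R)); first exact: size_poly.
apply/polyP => i; rewrite coef_deriv coef_poly ltnS /=.
case: ltnP => [_|ni]; last by rewrite mul0rn nth_default// (leq_trans pn).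
by rewrite -[(_ / _) *+ _]mulr_natr mulfVK// pnatr_eq0.
Qed.

(** After multiplication by [z^(c-1)] the operator [bop c] becomes [z d/dz], which is
    differentiation with respect to [Log z]. *)
Lemma kernel_iter_bop c m u : holo_on_cut u ->
  (forall z, cut_plane z -> iter m (bop c) u z = 0) ->
  exists2 p : {poly C}, (size p <= m)%N &
    forall z, cut_plane z -> u z = cpow z (1 - c) * p.[Log z].
Proof.
elim: m u => [|m IH] u uh u0.
  by exists 0; rewrite ?size_poly0// => z zc; rewrite horner0 mulr0; exact: u0.
have [|p pm up] := IH (bop c u) (@holo_bop c _ uh).
  by move=> z zc; rewrite -iterSr; exact: u0.
have [q qm qp] := antiderivative_poly pm.
(* [v] has derivative 0, and its constant value becomes the additional constant term of the
   polynomial. *)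
pose v z := cpow z (c - 1) * u z - q.[Log z].
exists (q + (v (half R))%:P).
  by rewrite (leq_trans (size_polyD _ _))// geq_max qm (leq_trans (size_polyC_leq1 _)).
move=> z zc; rewrite hornerD hornerC.
have <- : v z = v (half R).
  apply: const_on_cut zc => {}z zc.
  have zs := cut_plane_slit zc; have z0 := cut_plane_neq0 zc.
  have /holoP uc := uh.
  have := cderB (cderM (cder_cpow (c - 1) zs) (uc z zc))
    (@cder_comp R (fun w => q.[w]) (@Log R) z _ _ (cder_horner q (Log z)) (cder_Log zs)).
  congr cder; rewrite qp.
  have := up z zc; rewrite /bop; set g := u^`()%classic z => E.
  have -> : cpow z (c - 1 - 1) = z^-1 * cpow z (c - 1).
    by rewrite [in LHS]cpowD cpowN cpow1// mulrC.
  have cn0 := cpow_neq0 z (c - 1).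
  have -> : p.[Log z] = cpow z (c - 1) * ((c - 1) * u z + z * g).
    by rewrite E -opprB cpowN mulKf// cpow_neq0.
  by move: (cpow _ _) => X; field; exact: z0.
rewrite /v subrKC mulrA -cpowD.
by rewrite addrA subrK subrr cpow0 mul1r.
Qed.

(** The points exp(-n-1) of (0,1) have the distinct logarithms -n-1, which are too many roots for a
    nonzero polynomial. *)
Lemma logpoly_inj p : (forall z, cut_plane z -> p.[Log z] = 0) -> p = 0.
Proof.
move=> p0; apply/eqP/negPn/negP => pn0; pose rs : seq C := [seq - n.+1%:R | n <- iota 0 (size p)].
have sz : size rs = size p by rewrite size_map size_iota.
suff : (size rs < size p)%N by rewrite sz ltnn.
apply: max_poly_roots => //.
  apply/allP => _ /mapP[n _ ->]; apply/rootP.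
  have e0 : 0 < expR (- n.+1%:R : R) := expR_gt0 _.
  rewrite -(p0 (ofR (expR (- n.+1%:R)))).
    by rewrite Log_ofR// expRK ofRN ofR_nat.
  by apply/cut_planeP; right; rewrite Rec_ofR e0 expR_lt1 oppr_lt0 ltr0n.
rewrite map_inj_uniq ?iota_uniq// => i j /oppr_inj/eqP.
by rewrite eqr_nat => /eqP[].
Qed.

(** [lp] collects the logarithmic coefficients into one polynomial. For independence, the m-th
    iterate of [bop c] kills the logarithmic part and leaves [a ord0] times [geo], which is 1 at
    1/2; the polynomial then vanishes by [logpoly_inj]. For spanning, subtracting a multiple of [F]
    from a solution leaves an element of the kernel. *)
Theorem basis_of_iter_bop m c F : holo_on_cut F ->
  (forall z, cut_plane z -> iter m (bop c) F z = geo z) ->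
  basis_of_solutions (Dop m c) (sol_family m c F).
Proof.
move=> Fh FB.
pose lp (a : 'I_m.+1 -> C) : {poly C} := \sum_(j < m) a (lift ord0 j) *: 'X^j.
have lp_size (a : 'I_m.+1 -> C) : (size (lp a) <= m)%N.
  apply: (leq_trans (size_sum _ _ _)); apply/bigmax_leqP => j _.
  by rewrite (leq_trans (size_scale_leq _ _))// size_polyXn.
have lp_coef (a : 'I_m.+1 -> C) (j : 'I_m) : (lp a)`_j = a (lift ord0 j).
  rewrite coef_sum (bigD1 j)//= coefZ coefXn eqxx mulr1 big1 ?addr0// => i ij.
  have ji : (j == i :> nat) = false by rewrite eq_sym; exact: negbTE ij.
  by rewrite coefZ coefXn ji mulr0.
have sumE (a : 'I_m.+1 -> C) z : \sum_(i < m.+1) a i * sol_family m c F i z =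
    a ord0 * F z + cpow z (1 - c) * (lp a).[Log z].
  rewrite big_ord_recl; congr (_ + _).
  rewrite horner_sum mulr_sumr; apply: eq_bigr => j _.
  by rewrite hornerZ hornerXn /sol_family /= mulrCA.
have kerB p : (size p <= m)%N -> forall z, cut_plane z ->
    iter m (bop c) (fun w => cpow w (1 - c) * p.[Log w]) z = 0.
  by move=> pm z zc; rewrite iter_bop_power_logpoly// derivn_poly0// horner0 mulr0.
split; [|split].
- case=> [[|j] jm].
    split=> //; apply/Dop_solutionP => //; exists 1 => z zc.
    by rewrite mul1r; exact: FB.
  have E w : cpow w (1 - c) * Log w ^+ j = cpow w (1 - c) * ('X^j).[Log w].
    by rewrite hornerXn.
  have fE : sol_family m c F (Ordinal jm) = fun w => cpow w (1 - c) * ('X^j).[Log w].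
    by apply/funext => w; rewrite -E.
  rewrite fE; have ph := @holo_power_logpoly c 'X^j.
  split=> //; apply/Dop_solutionP => //; exists 0 => z zc.
  by rewrite mul0r kerB// size_polyXn.
- move=> a Ha.
  have a0 : a ord0 = 0.
    have hc : cut_plane (half R) := @cut_plane_half R.
    have := iter_bop_lin c m (a ord0) Fh (@holo_power_logpoly c (lp a)) hc.
    rewrite (kerB _ (lp_size a) _ hc) (FB _ hc) geo_half mulr1 addr0 => <-.
    have E z : cut_plane z -> a ord0 * F z + cpow z (1 - c) * (lp a).[Log z] =
        cpow z (1 - c) * (0 : {poly C}).[Log z].
      by move=> zc; rewrite -sumE Ha// horner0 mulr0.
    have s0 : (size (0%R : {poly C}) <= m)%N by rewrite size_poly0.
    rewrite -(kerB _ s0 _ hc); apply: (@iter_bop_eq_on_cut c m _ _ E _ _ hc).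
    have /holoP HF := Fh; have /holoP HL := @holo_power_logpoly c (lp a).
    by apply: holo_cder => z zc; exact: cderD (cderZ (a ord0) (HF z zc)) (HL z zc).
  have lp0 : lp a = 0.
    apply: logpoly_inj => z zc; have := Ha z zc.
    rewrite sumE a0 mul0r add0r => /eqP.
    by rewrite mulf_eq0 (negbTE (cpow_neq0 _ _)) => /eqP.
  by move=> i; case: (unliftP ord0 i) => [j ->|->//]; rewrite -lp_coef lp0 coef0.
- move=> G [Gh GD].
  have [|a Ga] := proj2 (@Dop_solutionP m c G Gh) _; first exact: GD.
  pose u z := - a * F z + G z.
  have uh : holo_on_cut u.
    have /holoP HF := Fh; have /holoP HG := Gh.
    by apply: holo_cder => z zc; exact: cderD (cderZ (- a) (HF z zc)) (HG z zc).
  have [|p pm up] := @kernel_iter_bop c m u uh.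
    by move=> z zc; rewrite iter_bop_lin// FB// Ga// mulNr addNr.
  pose A (i : 'I_m.+1) : C := if unlift ord0 i is Some j then p`_j else a.
  exists A => z zc; rewrite sumE.
  have -> : A ord0 = a by rewrite /A unlift_none.
  have -> : lp A = p.
    apply/polyP => i; have [im|mi] := ltnP i m.
      by rewrite (lp_coef A (Ordinal im)) /A liftK.
    by rewrite !nth_default// (leq_trans _ mi).
  by rewrite -(up z zc) /u; ring.
Qed.

End Operators.

(** * The polylogarithm *)

Section Polylogarithm.
Variable R : realType.
Local Notation C := (C R).
Implicit Types (t x y e d s : R) (z w l k a b c v : C) (F G u : C -> C) (m n N : nat).

(** The [n]-th term of the expansion of [Li_{m,c}], where a vanishing denominator
    is replaced by a logarithm, so that [bop c] lowers [m] in all cases. *)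
Definition gLi_term c m n z : C :=
  if n%:R + c == 0 then (m`!%:R)^-1 * z ^+ n.+1 * Log z ^+ m
  else z ^+ n.+1 / (n%:R + c) ^+ m.

Definition gLi_sum c m N z : C := \sum_(n < N) gLi_term c m n z.

Lemma cder_exprS n z : cder (fun w => w ^+ n.+1) z (n.+1%:R * z ^+ n).
Proof. by have := cderX n.+1 (cder_id z); rewrite mulr1. Qed.

(** The relation by which [bop c] lowers [m], solved for the derivative. In the resonant case c - 1
    = -(n + 1), so the derivative of the power cancels and that of the logarithm turns (m+1)! into
    m!. *)
Lemma cder_gLi_term c m n z : cut_plane z ->
  cder (gLi_term c m.+1 n) z ((gLi_term c m n z - (c - 1) * gLi_term c m.+1 n z) / z).
Proof.
move=> zc; have z0 := cut_plane_neq0 zc; have zs := cut_plane_slit zc.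
rewrite /gLi_term; case: eqP => [nc|/eqP nc].
  have := cderM (cderZ (m.+1`!%:R)^-1 (cder_exprS n z)) (cderX m.+1 (cder_Log zs)).
  congr cder; have {nc} -> : c = - n%:R by apply/eqP; rewrite -addr_eq0 addrC nc.
  have f0 : (m`!%:R : C) != 0 by rewrite pnatr_eq0 -lt0n fact_gt0.
  have s0 : (m.+1%:R : C) != 0 by rewrite pnatr_eq0.
  rewrite factS natrM !exprS /= -!natr1 in s0 *.
  by field; rewrite z0 f0 s0.
have := cderM (cder_exprS n z) (cder_cst ((n%:R + c) ^+ m.+1)^-1 z).
congr cder; have q0 : (n%:R + c) ^+ m != 0 by rewrite expf_neq0.
rewrite !exprS -natr1; move: ((n%:R + c) ^+ m) (z ^+ n) q0 => X Y X0.
by field; rewrite nc z0 X0.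
Qed.

Lemma cder_gLi_sum c m N z : cut_plane z ->
  cder (gLi_sum c m.+1 N) z ((gLi_sum c m N z - (c - 1) * gLi_sum c m.+1 N z) / z).
Proof.
move=> zc; have -> : (gLi_sum c m N z - (c - 1) * gLi_sum c m.+1 N z) / z =
   \sum_(n < N) (gLi_term c m n z - (c - 1) * gLi_term c m.+1 n z) / z.
  by rewrite /gLi_sum mulr_sumr -sumrB mulr_suml.
by apply: der_sum => n; exact: cder_gLi_term.
Qed.

(** z^(c-1) is an integrating factor for [bop c u = g]. *)
Lemma cder_twist c u z g : cut_plane z -> cder u z ((g - (c - 1) * u z) / z) ->
  cder (fun w => cpow w (c - 1) * u w) z (cpow z (c - 2) * g).
Proof.
move=> zc ug; have zs := cut_plane_slit zc; have z0 := cut_plane_neq0 zc.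
have := cderM (cder_cpow (c - 1) zs) ug; congr cder.
have -> : c - 1 - 1 = c - 2 by ring.
have -> : cpow z (c - 1) = z * cpow z (c - 2).
  have -> : c - 1 = 1 + (c - 2) by ring.
  by rewrite (cpowD z 1 (c - 2)) (cpow1 zs).
by move: (cpow _ _) => X; field.
Qed.

(** The error at level m + 1 is obtained by integrating the error at level m from 1/2 to z, so it
    must be small on the whole segment, which stays in the cut plane and in the unit disc. *)
Definition unif_cvg c m G : Prop := forall z, cut_plane z -> cmod z < 1 ->
  forall e, 0 < e -> exists N0, forall N, (N0 <= N)%N -> forall t, unit_itv t ->
  cmod (gLi_sum c m N (seg (half R) z t) - G (seg (half R) z t)) <= e.

Lemma expr_small (q e : R) : 0 <= q < 1 -> 0 < e ->
  exists N0, forall N, (N0 <= N)%N -> q ^+ N <= e.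
Proof.
move=> /andP[q0 q1] e0.
have : (fun n => q ^+ n) @ \oo --> 0 by apply: cvg_expr; rewrite ger0_norm.
move=> /cvgrPdist_le/(_ e e0)[N0 _ H]; exists N0 => N NN; have := H N NN.
by rewrite sub0r normrN ger0_norm// exprn_ge0.
Qed.

Lemma cmod_half : cmod (half R) = 2^-1.
Proof. by rewrite cmod_ofR ger0_norm. Qed.

(** At level 0 the logarithmic branch also reads z^(n+1), so the sum is geometric for every [c]. *)
Lemma gLi_sum0 c N z : cut_plane z -> gLi_sum c 0 N z - geo z = - z ^+ N.+1 / (1 - z).
Proof.
move=> zc; have z1 := cut_plane_neq1 zc.
have -> : gLi_sum c 0 N z = (z - z ^+ N.+1) / (1 - z).
  rewrite /gLi_sum; elim: N => [|N IH]; first by rewrite big_ord0 expr1 subrr mul0r.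
  rewrite big_ord_recr /= IH /gLi_term fact0 !expr0 !invr1 !mulr1 mul1r.
  by rewrite if_same !exprS; field.
by rewrite /geo; field.
Qed.

Lemma unif_cvg0 c : unif_cvg c 0 (@geo R).
Proof.
move=> z zc z1 e e0.
(* Points of the segment are convex combinations of 1/2 and z, so [q < 1] bounds their moduli and
   [1 - q] bounds |1 - v| from below. *)
pose q := Num.max 2^-1 (cmod z).
have q0 : 0 <= q by rewrite le_max cmod_ge0 orbT.
have q1 : q < 1 by rewrite gt_max z1 andbT invf_lt1// ltr1n.
have p0 : 0 < 1 - q by rewrite subr_gt0.
have [|N0 HN0] := @expr_small q (e * (1 - q)) _ (mulr_gt0 e0 p0); first by rewrite q0.
exists N0 => N NN t t01; have vc := cut_plane_seg zc t01.
set v := seg _ _ _ in vc *; rewrite gLi_sum0//.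
have vq : cmod v <= q.
  have -> : v = ofR (1 - t) * half R + ofR t * z by rewrite /v /seg ofRB ofR1; ring.
  apply: le_trans (cmodD _ _) _; rewrite !cmodM cmod_half !cmod_ofR.
  have /andP[t0 t1] := t01; rewrite !ger0_norm ?subr_ge0//.
  have m1 : 2^-1 <= q by rewrite le_max lexx.
  have m2 : cmod z <= q by rewrite le_max lexx orbT.
  by nra.
have v1 : 1 - q <= cmod (1 - v).
  have := cmodD (1 - v) v; rewrite subrK cmod1; lra.
rewrite cmodM cmodN cmodV cmodX ler_pdivrMr ?(lt_le_trans p0 v1)//.
apply: le_trans (_ : e * (1 - q) <= _); last by rewrite ler_pM2l.
apply: le_trans (HN0 N.+1 (leqW NN)).
by rewrite lerXn2r// nnegrE ?cmod_ge0.
Qed.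

(** From [n1] on the terms at 1/2 are dominated by a geometric series; [half_steps_limit] gives a
    factor 2 for the real and for the imaginary part, together 4. *)
Lemma gLi_sum_half_cvg c m : exists l n1, forall j,
  cmod (gLi_sum c m (n1 + j) (half R) - l) <= 4 * 2^-1 ^+ j.
Proof.
(* Beyond [n1] one has |n + c| >= 1, so no denominator vanishes or enlarges a term. *)
pose n1 := (Num.truncn (cmod c + 1)).+1.
have n1c : cmod c + 1 < n1%:R by exact: truncnS_gt.
pose x j := gLi_sum c m (n1 + j) (half R).
have xstep j : cmod (x j.+1 - x j) <= 2^-1 ^+ j.
  rewrite /x addnS /gLi_sum big_ord_recr /= addrAC subrr add0r /gLi_term.
  have nj : 1 <= cmod ((n1 + j)%:R + c).
    have := cmodB ((n1 + j)%:R + c) c; rewrite addrK -ofR_nat cmod_ofR ger0_norm//.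
    have : n1%:R <= (n1 + j)%:R :> R by rewrite ler_nat leq_addr.
    by move: n1c; lra.
  have /negbTE -> : (n1 + j)%:R + c != 0 by rewrite -cmod_gt0; lra.
  rewrite cmodM cmodV !cmodX cmod_half ler_pdivrMr ?exprn_gt0//; last by lra.
  apply: le_trans (_ : 2^-1 ^+ j * 1 <= _).
    rewrite mulr1 -addSn exprD ler_piMl ?exprn_ge0//.
    by rewrite exprn_ile1// invf_le1// ler1n.
  by rewrite ler_pM2l ?half_gt0// exprn_ege1.
have xr j : `|Rec (x j.+1) - Rec (x j)| <= 2^-1 ^+ j.
  by rewrite -RecB; exact: le_trans (Rec_le_cmod _) (xstep j).
have xi j : `|Imc (x j.+1) - Imc (x j)| <= 2^-1 ^+ j.
  by rewrite -ImcB; exact: le_trans (Imc_le_cmod _) (xstep j).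
have [X HX] := half_steps_limit xr; have [Y HY] := half_steps_limit xi.
exists (ofR X + iC R * ofR Y), n1 => j; rewrite -/(x j).
apply: le_trans (cmod_le _) _.
have -> : Rec (x j - (ofR X + iC R * ofR Y)) = Rec (x j) - X.
  by rewrite RecB RecD RecM /iC /ofR /Rec /Imc /=; ring.
have -> : Imc (x j - (ofR X + iC R * ofR Y)) = Imc (x j) - Y.
  by rewrite ImcB ImcD ImcM /iC /ofR /Rec /Imc /=; ring.
by have := HX j; have := HY j; lra.
Qed.

Lemma seg_cvg a b t : seg a b @ t --> seg a b t.
Proof. exact: (rder_cvg (@rder_segment R a (b - a) t)). Qed.

Lemma cpow_seg_bounded z a : cut_plane z -> exists2 M, 0 <= M &
  forall t, unit_itv t -> cmod (cpow (seg (half R) z t) a) <= M.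
Proof.
move=> zc; apply: (@path_bounded R (fun t => cpow (seg (half R) z t) a)) => t t01.
have zs := cut_plane_slit (cut_plane_seg zc t01).
have pc := cder_cvg (cder_cpow a zs).
have sc : seg (half R) z @ t --> seg (half R) z t := @seg_cvg (half R) z t.
exact: (@cvg_comp _ _ _ (seg (half R) z) (fun w => cpow w a) _ _ _ sc pc).
Qed.

(** The continuation of [Li_{m+1,c}] is the solution of [bop c G' = G] whose value
    at [1/2] is the sum of the series. *)
Lemma unif_cvg_step c m G : holo_on_cut G -> unif_cvg c m G ->
  exists G', [/\ holo_on_cut G', forall z, cut_plane z -> bop c G' z = G z &
    unif_cvg c m.+1 G'].
Proof.
move=> Gh GU; have Gc := proj1 (holoP G) Gh.
have fh : holo_on_cut (fun z => cpow z (c - 2) * G z).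
  by apply: holo_cder => z zc; exact: cderM (cder_cpow (c - 2) (cut_plane_slit zc)) (Gc z zc).
have [P HP] := holo_primitive fh.
have [l [n1 Hl]] := gLi_sum_half_cvg c m.+1.
pose K := l * cpow (half R) (c - 1) - P (half R).
pose G' z := cpow z (1 - c) * (K + P z).
have hc : cut_plane (half R) := @cut_plane_half R.
have inv z : cpow z (1 - c) * cpow z (c - 1) = 1.
  by rewrite -cpowD (_ : 1 - c + (c - 1) = 0) ?cpow0//; ring.
have G'half : G' (half R) = l.
  by rewrite /G' /K addrNK mulrCA inv mulr1.
have dG' z : cut_plane z -> cder G' z ((G z - (c - 1) * G' z) / z).
  move=> zc; have zs := cut_plane_slit zc; have z0 := cut_plane_neq0 zc.
  have := cderM (cder_cpow (1 - c) zs) (cderD (cder_cst K z) (HP z zc)); congr cder.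
  have -> : cpow z (1 - c - 1) = cpow z (1 - c) * z^-1.
    by rewrite [in LHS]cpowD cpowN cpow1.
  have E1 : cpow z (1 - c) * cpow z (c - 2) = z^-1.
    by rewrite -cpowD (_ : 1 - c + (c - 2) = - 1) ?cpowN ?cpow1//; ring.
  rewrite add0r [cpow z (1 - c) * (_ * G z)]mulrA E1 /G'.
  move: (cpow z (1 - c)) (G z) (P z) => X Y Z; by field.
have G'h : holo_on_cut G' by apply: holo_cder => z zc; exact: dG'.
exists G'; split=> //.
  move=> z zc; rewrite (bop_cder c (dG' z zc)).
  by field; exact: cut_plane_neq0.
move=> z zc z1 e e0.
have [M1 M10 HM1] := cpow_seg_bounded (c - 2) zc.
have [M2 M20 HM2] := cpow_seg_bounded (1 - c) zc.
pose A := cmod (z - half R); pose B := cmod (cpow (half R) (c - 1)).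
have A0 : 0 <= A := cmod_ge0 _; have B0 : 0 <= B := cmod_ge0 _.
(* [A * M1] is the cost of integrating the error at level m over the segment, [B] weights the error
   at 1/2, [M2] undoes the twist, and 1 keeps [D] positive. *)
pose D := M2 * (A * M1) + M2 * B + 1.
have D0 : 0 < D by rewrite ltr_wpDl// addr_ge0 ?mulr_ge0.
have eD0 : 0 < e / D by rewrite divr_gt0.
have [N1 HN1] := GU z zc z1 _ eD0.
have [j Hj] := half_small (divr_gt0 eD0 (ltr0n R 4)).
exists (maxn N1 (n1 + j)) => N; rewrite geq_max => /andP[NN1 Nj] t t01.
(* The twisted error: its derivative involves only the error at level m, so the mean value
   inequality from 1/2 to [v] controls it. *)
pose E w := cpow w (c - 1) * (gLi_sum c m.+1 N w - G' w).
have dE w : cut_plane w -> cder E w (cpow w (c - 2) * (gLi_sum c m N w - G w)).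
  move=> wc; apply: cder_twist => //.
  have := cderB (cder_gLi_sum c m N wc) (dG' w wc); congr cder.
  by field; exact: cut_plane_neq0.
have half_bound : cmod (gLi_sum c m.+1 N (half R) - G' (half R)) <= e / D.
  rewrite G'half; have [i ->] : exists i, N = (n1 + (j + i))%N.
    by exists (N - (n1 + j))%N; rewrite addnA subnKC.
  apply: le_trans (Hl _) _; rewrite exprD mulrCA mulrC.
  apply: le_trans (_ : (2^-1 ^+ j) * 4 <= _).
    have : 2^-1 ^+ i <= 1 :> R by rewrite exprn_ile1// invf_le1// ler1n.
    by have := half_gt0 R j; have := half_gt0 R i; nra.
  by rewrite -ler_pdivlMr// ltW.
set v := seg (half R) z t.
have seg_v s : seg (half R) v s = seg (half R) z (t * s).
  by rewrite /v /seg ofRM; ring.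
have ts s : unit_itv s -> unit_itv (t * s).
  move=> /andP[s0 s1]; have /andP[t0 t1] := t01.
  by rewrite /unit_itv mulr_ge0// mulr_ile1.
have vE : cmod (E v - E (half R)) <= A * M1 * (e / D).
  suff : cmod (E (seg (half R) v 1) - E (seg (half R) v 0)) <= A * M1 * (e / D).
    by rewrite seg1 seg0.
  apply: (@rder_bound R (fun s => E (seg (half R) v s))
    (fun s => cpow (seg (half R) v s) (c - 2) *
      (gLi_sum c m N (seg (half R) v s) - G (seg (half R) v s)) * (v - half R))) => s s01.
    apply: rder_comp; last exact: rder_segment.
    by apply: dE; rewrite seg_v; apply: cut_plane_seg => //; exact: ts.
  rewrite seg_v cmodM (cmodM (cpow _ _)).
  have vA : cmod (v - half R) <= A by exact: seg_dist.
  have -> : A * M1 * (e / D) = M1 * (e / D) * A by ring.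
  apply: ler_pM; [by rewrite mulr_ge0 ?cmod_ge0|exact: cmod_ge0| |exact: vA].
  apply: ler_pM; [exact: cmod_ge0|exact: cmod_ge0|exact: HM1 (ts s s01)|].
  by apply: HN1 => //; exact: ts.
have Ehalf : cmod (E (half R)) <= B * (e / D).
  by rewrite /E cmodM ler_wpM2l.
have -> : gLi_sum c m.+1 N v - G' v = cpow v (1 - c) * E v.
  by rewrite /E mulrA inv mul1r.
rewrite cmodM; apply: le_trans (_ : M2 * (A * M1 * (e / D) + B * (e / D)) <= _).
  apply: ler_pM; rewrite ?cmod_ge0//; first exact: HM2.
  by have := cmodD (E v - E (half R)) (E (half R)); rewrite subrK; lra.
have -> : M2 * (A * M1 * (e / D) + B * (e / D)) = (D - 1) * (e / D).
  by rewrite /D; ring.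
have {2}-> : e = D * (e / D) by rewrite mulrCA mulfV ?mulr1// gt_eqF.
by rewrite ler_pM2r// gerBl.
Qed.

Theorem gLi_exists c m : exists G, [/\ holo_on_cut G,
  forall z, cut_plane z -> iter m (bop c) G z = geo z & unif_cvg c m G].
Proof.
elim: m => [|m [G [Gh GB GU]]].
  by exists (@geo R); split=> //; [exact: holo_geo|exact: unif_cvg0].
have [G' [Gh' GB' GU']] := unif_cvg_step Gh GU.
exists G'; split=> // z zc; rewrite iterSr -GB//.
by apply: (@iter_bop_eq_on_cut R c m _ _ GB' _ z zc); exact: holo_bop.
Qed.

Lemma unif_cvg_cvg c m G z : unif_cvg c m G -> cut_plane z -> `|z| < 1 ->
  forall e, 0 < e -> exists N0, forall N, (N0 <= N)%N -> cmod (gLi_sum c m N z - G z) < e.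
Proof.
move=> GU zc; rewrite normC_cmod -ofR1 ltr_ofR => z1 e e0.
have e20 : 0 < e / 2 by rewrite divr_gt0.
have [N0 H] := GU z zc z1 _ e20; exists N0 => N NN.
have := H N NN 1 (unit_itv1 R); rewrite seg1 => H1.
by apply: le_lt_trans H1 _; rewrite ltr_pdivrMr// ltr_pMr// ltr1n.
Qed.

Lemma cvg_ooP (f : nat -> C) l : f @ \oo --> l <->
  forall e, 0 < e -> exists N0, forall N, (N0 <= N)%N -> cmod (f N - l) < e.
Proof.
split.
  by move=> /cvgCP H e e0; have [N0 _ HN] := H e e0; exists N0 => N NN; exact: HN.
by move=> H; apply/cvgCP => e e0; have [N0 HN] := H e e0; exists N0.
Qed.

(** The disc of radius 1/4 about 1/2 lies in the cut plane and in the unit disc; uniqueness of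
    limits there feeds the identity theorem. *)
Lemma cut_plane_unique F G (f : C -> nat -> C) : holo_on_cut F -> holo_on_cut G ->
  (forall z, cut_plane z -> `|z| < 1 -> f z @ \oo --> F z) ->
  (forall z, cut_plane z -> `|z| < 1 -> f z @ \oo --> G z) ->
  forall z, cut_plane z -> F z = G z.
Proof.
move=> Fh Gh fF fG z zc; apply/eqP; rewrite -subr_eq0; apply/eqP.
have Fc := proj1 (holoP F) Fh; have Gc := proj1 (holoP G) Gh.
apply: (@identity_cut R (fun z => F z - G z) _ _ z zc).
  by apply: holo_cder => w wc; exact: cderB (Fc w wc) (Gc w wc).
exists 4^-1 => [|w wh]; first by rewrite invr_gt0.
have wr := le_lt_trans (Rec_le_cmod _) wh.
have wc : cut_plane w.
  apply/cut_planeP; right; move: wr; rewrite RecB Rec_ofR ltr_norml => /andP[a b].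
  by apply/andP; split; lra.
have w1 : `|w| < 1.
  rewrite normC_cmod -ofR1 ltr_ofR.
  by have := cmodD (w - half R) (half R); rewrite subrK cmod_half; lra.
apply/eqP; rewrite -cmod_eq0 eq_le cmod_ge0 andbT leNgt; apply/negP => p.
have p2 : 0 < cmod (F w - G w) / 2 by rewrite divr_gt0.
have /cvg_ooP/(_ _ p2)[N1 H1] := fF w wc w1.
have /cvg_ooP/(_ _ p2)[N2 H2] := fG w wc w1.
have := H1 _ (leq_maxl N1 N2); have := H2 _ (leq_maxr N1 N2).
set g := f w _; have := cmod_dist_triangle (F w) g (G w).
by rewrite (cmod_distC (F w) g); lra.
Qed.

Lemma Li_seriesE c m z N : not_nonpos_int c ->
  series (Li_term m c z) N = gLi_sum c m N z.
Proof.
move=> hc; rewrite /series /= big_mkord; apply: eq_bigr => n _.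
rewrite /gLi_term; case: eqP => // /eqP; rewrite addrC addr_eq0 => /eqP cn.
by case: (hc n).
Qed.

(** The index [k] skipped by the series is the one at which [gLi_sum] carries the logarithmic term;
    it is present as soon as [k < N], which is enough for limits. *)
Lemma Listar_seriesE (k : nat) m z N : (k < N)%N ->
  series (Listar_term m k z) N + (m`!%:R)^-1 * z ^+ k.+1 * Log z ^+ m =
  gLi_sum (- k%:R) m N z.
Proof.
move=> kN; rewrite /series /= big_mkord /gLi_sum.
rewrite (bigD1 (Ordinal kN))// [RHS](bigD1 (Ordinal kN))//=.
rewrite /Listar_term /gLi_term eqxx subrr eqxx add0r addrC; congr (_ + _).
apply: eq_bigr => n nk; have {nk} : (n != k :> nat) by [].
by rewrite subr_eq0 eqr_nat => /negbTE ->.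
Qed.

Lemma is_Li_cvg c m F : not_nonpos_int c -> is_Li m c F <-> holo_on_cut F /\
  forall z, cut_plane z -> `|z| < 1 -> (fun N => gLi_sum c m N z) @ \oo --> F z.
Proof.
move=> hc; have E z : series (Li_term m c z) = (fun N => gLi_sum c m N z).
  by apply/funext => N; exact: Li_seriesE.
by split=> -[Fh H]; split=> // z zc z1; have := H z zc z1; rewrite E.
Qed.

Lemma is_Listar_cvg (k : nat) m F : is_Listar m k F <-> holo_on_cut F /\
  forall z, cut_plane z -> `|z| < 1 -> (fun N => gLi_sum (- k%:R) m N z) @ \oo --> F z.
Proof.
split=> -[Fh H]; (split; first exact: Fh) => z zc z1; apply/cvg_ooP => e e0.
  have /cvg_ooP/(_ e e0)[N0 HN] := H z zc z1; exists (maxn N0 k.+1) => N.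
  rewrite geq_max => /andP[N0N kN]; rewrite -(Listar_seriesE m z kN).
  by have := HN N N0N; rewrite opprB addrA.
have /cvg_ooP/(_ e e0)[N0 HN] := H z zc z1; exists (maxn N0 k.+1) => N.
rewrite geq_max => /andP[N0N kN]; have := HN N N0N; rewrite -(Listar_seriesE m z kN).
by rewrite opprB addrA.
Qed.

(** Nothing is known of [F] outside the unit disc beyond holomorphy, so the equation is inherited
    from the constructed continuation, with which [F] coincides by uniqueness. *)
Theorem gLi_continuation c m F : holo_on_cut F ->
  (forall z, cut_plane z -> `|z| < 1 -> (fun N => gLi_sum c m N z) @ \oo --> F z) ->
  forall z, cut_plane z -> iter m (bop c) F z = geo z.
Proof.
move=> Fh HF z zc; have [G [Gh GB GU]] := gLi_exists c m.
have FG : forall w, cut_plane w -> F w = G w.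
  apply: (@cut_plane_unique F G (fun z N => gLi_sum c m N z) Fh Gh HF) => w wc w1.
  by apply/cvg_ooP; exact: unif_cvg_cvg.
by rewrite (@iter_bop_eq_on_cut R c m _ _ FG Fh z zc) GB.
Qed.

Lemma gLi_continuation_exists c m : exists F, holo_on_cut F /\
  forall z, cut_plane z -> `|z| < 1 -> (fun N => gLi_sum c m N z) @ \oo --> F z.
Proof.
have [G [Gh GB GU]] := gLi_exists c m; exists G; split; first exact: Gh.
move=> w wc w1.
by apply/cvg_ooP; exact: unif_cvg_cvg.
Qed.

End Polylogarithm.

(** * Singular points *)

Section MonomialActions.
Variable K : comNzRingType.
Implicit Types (x y u : K).

(** For an operator with coefficients a_j z^j, this is coefficient j of its composite with
    [theta_op], where [x] is c - 1 and [y], [u] are a_j, a_(j-1): the Euler form is preserved. *)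
Lemma theta_monomial x y u j :
  x%:P * (y *: 'X^j) + 'X * (y *: ('X^(j.-1) *+ j) + (if j is i.+1 then u *: 'X^i else 0)) =
  ((x + j%:R) * y + (if j is i.+1 then u else 0)) *: 'X^j.
Proof.
case: j => [|j].
  by rewrite mulr0n scaler0 !addr0 mulr0 addr0 mul_polyC scalerA.
by rewrite -!mul_polyC !polyCD !polyCM !polyCD polyC_natr exprS -mulr_natr /=; ring.
Qed.

(** The same for [outer_op], whose factor z(1 - z) raises the degree by one more and so produces the
    affine factor. *)
Lemma outer_monomial y u j :
  -1 * (y *: 'X^j) +
    'X * (1 - 'X) * (y *: ('X^(j.-1) *+ j) + (if j is i.+1 then u *: 'X^i else 0)) =
  (- (j%:R * y + (if j is i.+1 then u else 0)) *: 'X +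
    (j%:R * y + (if j is i.+1 then u else 0) - y)%:P) * 'X^j.
Proof.
case: j => [|j].
  rewrite mulr0n scaler0 mul0r !addr0 mulr0 oppr0 scale0r sub0r addr0 add0r.
  by rewrite expr0 mulr1 mulN1r alg_polyC polyCN.
rewrite -!mul_polyC !polyCB !polyCN !polyCD !polyCM polyC_natr exprS -mulr_natr /=.
by ring.
Qed.

End MonomialActions.

Section Fuchs.
Variable R : realType.
Local Notation C := (C R).
Implicit Types (c z : C) (L M : seq {poly C}) (p q : {poly C}) (a : nat -> C).

Lemma nth_op_add L M j : (op_add L M)`_j = L`_j + M`_j.
Proof.
have [jm|mj] := ltnP j (maxn (size L) (size M)); first by rewrite nth_mkseq.
rewrite [LHS]nth_default ?size_mkseq//; move: mj; rewrite geq_max => /andP[jL jM].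
by rewrite !nth_default// addr0.
Qed.

Lemma nth_op_scale p L j : (op_scale p L)`_j = p * L`_j.
Proof.
have [jL|Lj] := ltnP j (size L); first by rewrite (nth_map 0).
by rewrite !nth_default ?size_map// mulr0.
Qed.

Lemma nth_op_dleft L j :
  (op_dleft L)`_j = deriv L`_j + (if j is j'.+1 then L`_j' else 0).
Proof.
have [jL|Lj] := ltnP j (size L).+1; first by rewrite nth_mkseq.
rewrite [LHS]nth_default ?size_mkseq//; case: j Lj => // j Lj.
by rewrite !nth_default ?deriv0 ?addr0// ltnW.
Qed.

Lemma op_mul2E p q M :
  op_mul [:: p; q] M = op_add (op_scale p M) (op_add (op_scale q (op_dleft M)) [::]).
Proof. by []. Qed.

Lemma size_op_mul2 p q M : size (op_mul [:: p; q] M) = (size M).+1.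
Proof.
by rewrite op_mul2E !(size_mkseq, size_map) maxn0; apply/maxn_idPr; rewrite leqnSn.
Qed.

Lemma nth_op_mul2 p q M j : (op_mul [:: p; q] M)`_j =
  p * M`_j + q * (deriv M`_j + (if j is j'.+1 then M`_j' else 0)).
Proof.
by rewrite op_mul2E !nth_op_add !nth_op_scale nth_op_dleft [[::]`_j]nth_nil addr0.
Qed.

Lemma theta_iter_coef m c :
  size (iter m (op_mul (theta_op c)) [:: 1]) = m.+1 /\
  exists a, [/\ a m = 1, forall j, (m < j)%N -> a j = 0 &
    forall j, (iter m (op_mul (theta_op c)) [:: 1])`_j = a j *: 'X^j].
Proof.
elim: m => [|m [sz [a [am a0 aE]]]].
  split=> //; exists (fun j => (j == 0%N)%:R); split=> //; first by case.
  by case=> [|j] /=; [rewrite scale1r expr0|rewrite nth_nil scale0r].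
split; first by rewrite iterS size_op_mul2 sz.
exists (fun j => (c - 1 + j%:R) * a j + (if j is j'.+1 then a j' else 0)); split.
- by rewrite a0// mulr0 add0r.
- by case=> // j mj; rewrite !a0// ?mulr0 ?add0r// ltnW.
move=> j; rewrite iterS nth_op_mul2 !aE derivZ derivXn.
case: j => [|j]; first exact: (theta_monomial (c - 1) (a 0%N) 0 0).
by rewrite aE; exact: (theta_monomial (c - 1) (a j.+1) (a j) j.+1).
Qed.

(** All Fuchs conditions are read off this shape: coefficient j is divisible by z^j and has degree
    at most j + 1. *)
Lemma Dop_coef m c : op_order (Dop m c) = m.+1 /\
  op_coef (Dop m c) m.+1 = (1 - 'X) * 'X^(m.+1) /\
  exists a b, forall j, op_coef (Dop m c) j = (a j *: 'X + (b j)%:P) * 'X^j.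
Proof.
have [sz [a [am a0 aE]]] := theta_iter_coef m c.
split; first by rewrite /op_order /Dop size_op_mul2 sz.
pose b j := if j is j'.+1 then a j' else 0.
have E j : op_coef (Dop m c) j =
    (- (j%:R * a j + b j) *: 'X + (j%:R * a j + b j - a j)%:P) * 'X^j.
  rewrite /op_coef /Dop nth_op_mul2 !aE derivZ derivXn.
  case: j => [|j]; first exact: (outer_monomial (a 0%N) 0 0).
  by rewrite aE; exact: (outer_monomial (a j.+1) (a j) j.+1).
split; last by eexists; eexists; exact: E.
rewrite E /b a0// am mulr0 add0r subr0 scaleN1r addrC.
by congr (_ * _).
Qed.

Section Conditions.
Variables (m : nat) (c : C).
Local Notation D := (Dop m c).

Lemma op_lead_Dop : op_lead D = (1 - 'X) * 'X^(m.+1).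
Proof. by have [oE [lE _]] := Dop_coef m c; rewrite /op_lead oE. Qed.

Let oneBX : (1 - 'X : {poly C}) = - ('X - 1%:P).
Proof. by rewrite opprB polyC1. Qed.

Let oneBX_neq0 : (1 - 'X : {poly C}) != 0.
Proof. by rewrite oneBX oppr_eq0 polyXsubC_eq0. Qed.

Let Xn_neq0 n : ('X^n : {poly C}) != 0.
Proof. by rewrite monic_neq0// monicXn. Qed.

Lemma op_lead_Dop_neq0 : op_lead D != 0.
Proof. by rewrite op_lead_Dop mulf_neq0. Qed.

Lemma mup_lead_other z : z != 0 -> z != 1 -> mup z (op_lead D) = 0%N.
Proof.
move=> z0 z1; apply: mupNroot; rewrite op_lead_Dop /root !hornerE.
by rewrite mulf_neq0 ?expf_neq0// subr_eq0 eq_sym.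
Qed.

Lemma mup_lead_0 : mup 0 (op_lead D) = m.+1.
Proof.
rewrite op_lead_Dop mupMr; last by rewrite /root !hornerE subr0 oner_eq0.
by rewrite -['X]subr0 -polyC0 mup_XsubCX eqxx.
Qed.

Lemma mup_lead_1 : mup 1 (op_lead D) = 1%N.
Proof.
rewrite op_lead_Dop mupMl; last by rewrite /root hornerXn expr1n oner_eq0.
rewrite oneBX -mulN1r mupMr; last by rewrite /root hornerN hornerC oppr_eq0 oner_eq0.
by rewrite -[X in mup _ X]expr1 mup_XsubCX eqxx.
Qed.

Lemma Dop_ordinary z : z != 0 -> z != 1 -> ordinary_point D z.
Proof. by move=> z0 z1 j _ _; rewrite mup_lead_other. Qed.

(** At 0 divisibility by z^j makes up for the zero of order m + 1 of the leading coefficient. At 1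
    that coefficient has a simple zero, covered by the exponent m + 1 - j >= 1 of each lower
    coefficient. Elsewhere it does not vanish. *)
Lemma Dop_fuchs z : fuchs_condition D z.
Proof.
have [oE [lE [a [b E]]]] := Dop_coef m c.
move=> j; rewrite oE => jm jn0.
have [->|z0] := eqVneq z 0.
  rewrite mup_lead_0 addnBA// addnC -addnBA; last first.
    rewrite mup_geq// E polyC0 subr0; exact: dvdp_mull.
  by rewrite leq_addr.
have [->|z1] := eqVneq z 1; last by rewrite mup_lead_other.
rewrite mup_lead_1; have [jlt|jge] := ltnP j m.+1.
  by rewrite (leq_trans _ (leq_addl _ _))// subn_gt0.
have -> : j = m.+1 by apply/eqP; rewrite eqn_leq jm jge.
by rewrite -mup_lead_1 /op_lead oE leq_addr.
Qed.

(** The leading coefficient has degree m + 2, exactly (j + 1) + (m + 1 - j). *)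
Lemma Dop_fuchs_infty : fuchs_condition_infty D.
Proof.
have [oE [lE [a [b E]]]] := Dop_coef m c.
move=> j; rewrite oE => jm jn0.
have -> : (size (op_lead D)).-1 = m.+2.
  by rewrite op_lead_Dop size_mulXn// oneBX size_polyN size_XsubC addn2.
have sz : (size (op_coef D j) <= j.+2)%N.
  rewrite E; apply: (leq_trans (size_polyMleq _ _)); rewrite size_polyXn addnS /=.
  rewrite -add2n leq_add2r (leq_trans (size_polyD _ _))// geq_max.
  by rewrite (leq_trans (size_scale_leq _ _)) ?size_polyX// (leq_trans (size_polyC_leq1 _)).
have : ((size (op_coef D j)).-1 <= j.+1)%N by case: (size _) sz.
move=> s1; apply: (leq_trans (leq_add s1 (leqnn _))).
by rewrite addSn subnKC.
Qed.

Lemma Dop_singular z : singular_point D z -> z = 0 \/ z = 1.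
Proof.
move=> zs; have [->|z0] := eqVneq z 0; first by left.
have [->|z1] := eqVneq z 1; first by right.
by case: zs; exact: Dop_ordinary.
Qed.

End Conditions.

End Fuchs.

Theorem theorem8p1 (R : realType) (m : nat) (c : C R) :
  (* D^c_{m+1} has order m+1 *)
  (op_order (Dop m c) = m.+1 /\ op_lead (Dop m c) != 0) /\
  (* (1) Li_{m,c} (exists and) solves D^c_{m+1} F = 0 *)
  (not_nonpos_int c ->
     (exists F : C R -> C R, is_Li m c F) /\
     forall F, is_Li m c F -> forall z, cut_plane z -> op_act (Dop m c) F z = 0) /\
  (* (2) singular points in {0,1,oo}, all regular singular; Fuchsian *)
  ((forall z0, singular_point (Dop m c) z0 -> z0 = 0 \/ z0 = 1) /\
   (forall z0, singular_point (Dop m c) z0 -> regular_singular_point (Dop m c) z0) /\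
   fuchs_condition_infty (Dop m c) /\
   fuchsian (Dop m c)) /\
  (* (3) basis for c not in Z_{<=0} *)
  (not_nonpos_int c ->
     forall F, is_Li m c F -> basis_of_solutions (Dop m c) (sol_family m c F)) /\
  (* (4) basis for c = -k in Z_{<=0} *)
  (forall k : nat, c = - k%:R ->
     (exists F : C R -> C R, is_Listar m k F) /\
     forall F, is_Listar m k F -> basis_of_solutions (Dop m c) (sol_family m c F)).
Proof.
have [order _] := Dop_coef m c.
(* Assertions (3) and (4) at once: [gLi_sum] is the partial sum of either series, completed by the
   logarithmic term when [c] is a nonpositive integer. *)
have basis F : holo_on_cut F ->
    (forall z, cut_plane z -> `|z| < 1 -> (fun N => gLi_sum c m N z) @ \oo --> F z) ->
    basis_of_solutions (Dop m c) (sol_family m c F).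
  by move=> Fh HF; apply: (basis_of_iter_bop Fh); exact: gLi_continuation Fh HF.
split; first by split; [exact: order|exact: op_lead_Dop_neq0].
split=> [hc|].
  split.
    have [F HF] := gLi_continuation_exists c m.
    by exists F; apply/(is_Li_cvg m F hc).
  move=> F /(is_Li_cvg m F hc)[Fh HF].
  apply/(Dop_solutionP m c Fh); exists 1 => z zc.
  by rewrite mul1r; exact: gLi_continuation Fh HF z zc.
split.
  split; first exact: Dop_singular.
  split; first by move=> z zs; split; [exact: zs|exact: Dop_fuchs].
  split; first exact: Dop_fuchs_infty.
  by split; [exact: Dop_fuchs|exact: Dop_fuchs_infty].
split; first by move=> hc F /(is_Li_cvg m F hc)[Fh HF]; exact: basis.
move=> k ck; split.
  have [F HF] := gLi_continuation_exists c m.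
  by exists F; apply/is_Listar_cvg; rewrite -ck.
move=> F /is_Listar_cvg; rewrite -ck => -[Fh HF]; exact: basis.
Qed.
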